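(* Let $\phi$ satisfy $(\phi_1)$, $(\phi_2)$, $(\phi_3)$. Let $g:\Omega\times\mathbb{R}\to\mathbb{R}$ be a Carathéodory function, let $\alpha\in\{\ell,m\}$, and suppose there is $a\in L^{N/\alpha}(\Omega)$ such that $$|g(x,t)|\le a(x)(1+|t|^{\alpha-1})\quad\text{for all }(x,t)\in\Omega\times\mathbb{R}.$$ Assume that one of the following holds: (i) $\Phi\not\approx t^m$ and $\alpha=\ell$; (ii) $\Phi\approx t^m$ and $\alpha=m$. Let $u\in W^{1,\Phi}_0(\Omega)$ be a weak solution of $$-\Delta_\Phi u=g(x,u)\ \text{ in }\Omega,\qquad u=0\ \text{ on }\partial\Omega.$$ Then $u\in L^q(\Omega)$ for all $q\in[1,\infty)$.
   Context: Let $N\ge 2$ and let $\Omega\subset\mathbb{R}^N$ be a bounded domain with smooth boundary. Let $\phi:\mathbb{R}\to\mathbb{R}$ be a $C^1$-function and let $\Phi:\mathbb{R}\to\mathbb{R}$ be the even function given by $\Phi(t)=\int_0^t s\phi(s)\,ds$. The conditions are: $(\phi_1)$ $t\phi(t)\to 0$ as $t\to 0$ and $t\phi(t)\to\infty$ as $t\to\infty$; $(\phi_2)$ $t\phi(t)$ is strictly increasing in $(0,\infty)$; $(\phi_3)$ there exist $\ell\in[1,N)$ and $m\in(1,N)$ such that $\ell-1\le \frac{(t\phi(t))'}{\phi(t)}\le m-1<\ell^*-1$ for all $t>0$, where $\ell^*=\frac{\ell N}{N-\ell}$. The $\Phi$-Laplacian is $\Delta_\Phi u=\mathrm{div}(\phi(|\nabla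 u|)\nabla u)$. An $N$-function is a convex, continuous, even function $\Theta:\mathbb{R}\to[0,\infty)$ with $\Theta(t)/t\to0$ as $t\to0$, $\Theta(t)/t\to\infty$ as $t\to\infty$, and $\Theta(t)>0$ for $t>0$. For $N$-functions $\Phi,\Psi$ write $\Phi\approx\Psi$ if there exist $c_1,c_2>0$ and $t_0\ge0$ such that $c_1\Psi(t)\le\Phi(t)\le c_2\Psi(t)$ for all $t\ge t_0$; write $\Phi\not\approx\Psi$ otherwise. Here $t^m$ denotes the $N$-function $t\mapsto|t|^m$. The Orlicz space is $L_\Phi(\Omega)=\{u:\Omega\to\mathbb{R}\text{ measurable}:\int_\Omega\Phi(|u|/\lambda)\,dx<\infty\text{ for some }\lambda>0\}$ with Luxemburg norm $\|u\|_\Phi=\inf\{\lambda>0:\int_\Omega\Phi(|u|/\lambda)\,dx\le1\}$. The Orlicz-Sobolev space $W^{1,\Phi}(\Omega)$ consists of $u\in L_\Phi(\Omega)$ whose weak first derivatives lie in $L_\Phi(\Omega)$, with norm $\|u\|_{1,\Phi}=\|u\|_\Phi+\sum_{i=1}^N\|\partial u/\partial x_i\|_\Phi$, and $W^{1,\Phi}_0(\Omega)$ is the closure of $C_0^\infty(\Omega)$ in $W^{1,\Phi}(\Omega)$. A function $u\in W^{1,\Phi}_0(\Omega)$ is a weak solution of $-\Delta_\Phi u=g(x,u)$ in $\Omega$, $u=0$ on $\partial\Omega$, if $\int_\Omega\phi(|\nabla u|)\nabla u\cdot\nabla v\,dx=\int_\Omega g(x,u)v\,dx$ for all $v\in W^{1,\Phi}_0(\Omega)$.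 *)

(* Defs.v *)
From HB Require Import structures.
From mathcomp Require Import all_boot all_order all_algebra.
From mathcomp Require Import all_classical all_reals all_analysis.

Set Implicit Arguments.
Unset Strict Implicit.
Unset Printing Implicit Defensive.
Import Order.TTheory GRing.Theory Num.Theory.
Import numFieldNormedType.Exports.
Local Open Scope classical_set_scope.
Local Open Scope ring_scope.

(* The Lebesgue outer measure is the infimum of the total volumes of the
   countable coverings by boxes, and the Lebesgue measure is its restriction
   to the Caratheodory-measurable sets. *)

Section lebesgue.
Variables (R : realType) (N : nat).

(* [None] is the empty box; it is only there so that the empty set has
   volume 0 also in dimension 0, where the empty product is 1. *)
Definition box (c : option ('rV[R]_N * 'rV[R]_N)) : set 'rV[R]_N :=
  if c is Some ab then
    [set x | forall i, ab.1 ord0 i <= x ord0 i <= ab.2 ord0 i]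
  else set0.

Definition box_vol (c : option ('rV[R]_N * 'rV[R]_N)) : \bar R :=
  if c is Some ab then
    (\prod_(i < N) Num.max 0 (ab.2 ord0 i - ab.1 ord0 i))%:E
  else 0%E.

Definition box_cover (A : set 'rV[R]_N) :
    set (nat -> option ('rV[R]_N * 'rV[R]_N)) :=
  [set c | A `<=` \bigcup_k box (c k)].

Definition lebesgue_outer (A : set 'rV[R]_N) : \bar R :=
  ereal_inf [set (\sum_(k <oo) box_vol (c k))%E | c in box_cover A].

Local Open Scope ereal_scope.

Let box_vol_ge0 c : 0 <= box_vol c.
Proof.
case: c => [ab|//] /=; rewrite lee_fin; apply: prodr_ge0 => i _.
by rewrite le_max lexx.
Qed.

Let lebesgue_outer_ge0 A : 0 <= lebesgue_outer A.
Proof.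
apply: le_ereal_inf_tmp => x [c _ <-{x}].
by apply: nneseries_ge0 => n _ _; exact: box_vol_ge0.
Qed.

Let lebesgue_outer0 : lebesgue_outer set0 = 0.
Proof.
apply/eqP; rewrite eq_le; apply/andP; split; last exact: lebesgue_outer_ge0.
apply: ereal_inf_lbound; exists (fun=> None) => //.
by rewrite eseries0.
Qed.

Let le_lebesgue_outer : {homo lebesgue_outer : A B / A `<=` B >-> A <= B}.
Proof.
move=> A B AB; apply: ereal_inf_le_tmp => x [c Bc <-{x}].
by exists c => //; exact: subset_trans AB Bc.
Qed.

Let lebesgue_outer_sigma_subadditive : sigma_subadditive lebesgue_outer.
Proof.
move=> A; have [[i ioo]|] := pselect (exists i, lebesgue_outer (A i) = +oo).
  rewrite (eseries_pinfty _ _ ioo) ?leey// => n _.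
  by rewrite -ltNye (lt_le_trans _ (lebesgue_outer_ge0 _)).
rewrite -forallNE => Aoo.
suff add2e (e : {posnum R}) : lebesgue_outer (\bigcup_n A n) <=
    \sum_(i <oo) lebesgue_outer (A i) + e%:num%:E.
  by apply/lee_addgt0Pr => _/posnumP[].
rewrite (le_trans _ (epsilon_trick _ _ _))//.
pose P n c := box_cover (A n) c /\ \sum_(k <oo) box_vol (c k) <=
  lebesgue_outer (A n) + (e%:num / (2 ^ n.+1)%:R)%:E.
have [G PG] : {G & forall n, P n (G n)}.
  apply: (@choice _ _ P) => n; rewrite /P /lebesgue_outer.
  set S := (X in ereal_inf X); move infS : (ereal_inf S) => iS.
  case: iS infS => [r Sr|Soo|Soo].
  - have en1 : (0 < e%:num / (2 ^ n.+1)%:R)%R by [].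
    have /(lb_ereal_inf_adherent en1) : ereal_inf S \is a fin_num by rewrite Sr.
    move=> [x [c Ac xS]]; rewrite -xS => xlt.
    by exists c; split => //; rewrite -Sr; exact/ltW.
  - by have := Aoo n; rewrite /lebesgue_outer Soo.
  - suff : lbound S 0 by move/le_ereal_inf_tmp; rewrite Soo.
    by move=> /= _ [c _ <-]; apply: nneseries_ge0 => *; exact: box_vol_ge0.
pose v := box_vol \o uncurry G.
have v_ge0 x : 0 <= v x by exact: box_vol_ge0.
apply: (@le_trans _ _ (\esum_(i in setT) v i)).
  apply: ereal_inf_lbound => /=.
  have /card_esym/ppcard_eqP[f] := card_nat2.
  exists (uncurry G \o f).
    move=> t [i _ /((PG i).1)[j _ Bijt]]; exists (f^-1%FUN (i, j)) => //=.
    by rewrite invK ?inE.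
  rewrite -(esum_pred_image v _ xpredT) ?[fun=> _]set_true//.
  by rewrite image_eq.
rewrite (_ : esum _ _ = \sum_(i <oo) \sum_(j <oo) box_vol (G i j)); last first.
  pose J : nat -> set (nat * nat) := fun i => [set (i, j) | j in setT].
  rewrite (_ : setT = \bigcup_k J k); last first.
    by rewrite predeqE => -[a b]; split => // _; exists a => //; exists b.
  rewrite esum_bigcupT /=; last 2 first.
    - apply/trivIsetP => i j _ _ ij.
      rewrite predeqE => -[n m] /=; split => //= -[] [_] _ [<-{n} _].
      by move=> [m' _] [] /esym/eqP; rewrite (negbTE ij).
    - by move=> /= [n m]; exact: v_ge0.
  rewrite -(image_id [set: nat]) -fun_true esum_pred_image//; last first.
    by move=> n _; exact: esum_ge0.
  apply: eq_eseriesr => /= j _.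
  rewrite -(esum_pred_image v (pair j) predT)//=; last first.
    by move=> ? ? _ _; exact: (@can_inj _ _ _ snd).
  by congr esum; rewrite predeqE => -[a b]; split; move=> [i _ <-]; exists i.
apply: lee_lim.
- apply: is_cvg_nneseries => n *.
  by apply: nneseries_ge0 => m *; exact: (v_ge0 (n, m)).
- by apply: is_cvg_nneseries => n *; apply: adde_ge0.
- by near=> n; apply: lee_sum => i _; exact: (PG i).2.
Unshelve. all: by end_near. Qed.

HB.instance Definition _ := isOuterMeasure.Build R 'rV[R]_N lebesgue_outer
  lebesgue_outer0 lebesgue_outer_ge0 le_lebesgue_outer
  lebesgue_outer_sigma_subadditive.

Definition lebT := caratheodory_type lebesgue_outer.

Definition leb : set lebT -> \bar R := lebesgue_outer.

Let leb0 : leb set0 = 0.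
Proof. exact: outer_measure0. Qed.

Let leb_ge0 A : 0 <= leb A.
Proof. exact: outer_measure_ge0. Qed.

Let leb_semi_sigma_additive : semi_sigma_additive leb.
Proof. exact: caratheodory_measure_sigma_additive. Qed.

HB.instance Definition _ := isMeasure.Build _ lebT R leb
  leb0 leb_ge0 leb_semi_sigma_additive.

End lebesgue.
Arguments leb : clear implicits.

Section smooth.
Variable R : realType.

Definition iter_partial n (s : seq 'I_n) (f : 'rV[R]_n -> R) : 'rV[R]_n -> R :=
  foldr (fun i h x => 'D_(delta_mx ord0 i) h x) f s.

Definition smooth n (f : 'rV[R]_n -> R) : Prop :=
  forall s : seq 'I_n, continuous (iter_partial s f) /\
    forall i x, derivable (iter_partial s f) x (delta_mx ord0 i).

(* Near each boundary point Omega is, up to the choice of the coordinate k and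
   of the orientation sigma of the k-th axis, the epigraph of a smooth function
   of the remaining coordinates. *)
Definition smooth_boundary N (Omega : set 'rV[R]_N) : Prop :=
  forall p, closure Omega p -> ~ interior Omega p ->
  exists (U : set 'rV[R]_N) (k : 'I_N) (sigma : bool)
         (gamma : 'rV[R]_N.-1 -> R),
    [/\ nbhs p U, smooth gamma &
        forall x, U x ->
          (Omega x <-> 0 < (-1) ^+ sigma * (x ord0 k - gamma (col' k x)))].

Definition smooth_bounded_domain N (Omega : set 'rV[R]_N) : Prop :=
  [/\ Omega !=set0, open Omega, connected Omega, bounded_set Omega &
      smooth_boundary Omega].

Definition test_function N (Omega : set 'rV[R]_N) (psi : 'rV[R]_N -> R) :=
  [/\ smooth psi, compact (closure [set x | psi x != 0]) &
      closure [set x | psi x != 0] `<=` Omega].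

End smooth.

Section structural.
Variable R : realType.
Implicit Types (phi : R -> R) (l m : R).

Definition C1 phi : Prop :=
  (forall t : R, derivable phi t 1) /\ continuous (derive1 phi).

(* [`|t|] makes Phi even whatever the values of phi on the negative axis. *)
Definition Phi_of phi (t : R) : R :=
  \int[lebesgue_measure]_(s in `[0, `|t|]) (s * phi s).

Definition cond_phi1 phi : Prop :=
  (t * phi t @[t --> 0^'] --> (0 : R)) /\ (t * phi t @[t --> +oo] --> +oo).

Definition cond_phi2 phi : Prop :=
  forall s t : R, 0 < s -> s < t -> s * phi s < t * phi t.

Definition sobolev_conj (N : nat) (l : R) : R := l * N%:R / (N%:R - l).

Definition cond_phi3 (N : nat) l m phi : Prop :=
  [/\ 1 <= l < N%:R, 1 < m < N%:R, m - 1 < sobolev_conj N l - 1 &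
      forall t : R, 0 < t ->
        l - 1 <= derive1 (fun s : R => s * phi s) t / phi t <= m - 1].

Definition Nfun_equiv (Phi Psi : R -> R) : Prop :=
  exists c1 c2 t0 : R, [/\ 0 < c1, 0 < c2, 0 <= t0 &
    forall t, t0 <= t -> c1 * Psi t <= Phi t <= c2 * Psi t].

End structural.

(* A function on Omega is represented by a total function on R^N whose values
   outside Omega are irrelevant. *)

Section spaces.
Variables (R : realType) (N : nat).
Implicit Types (Phi : R -> R) (Omega : set 'rV[R]_N) (u v : 'rV[R]_N -> R).

Definition in_Lp Omega (p : R) u : Prop :=
  (u \_ Omega : lebT R N -> R) \in Lfun (leb R N) p%:E.

Definition in_orlicz Phi Omega u : Prop :=
  measurable_fun (Omega : set (lebT R N)) u /\
  exists2 lam : R, 0 < lam &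
    (\int[leb R N]_(x in Omega) (Phi (`|u x| / lam))%:E < +oo)%E.

Definition luxemburg Phi Omega u : \bar R :=
  ereal_inf [set lam%:E | lam in
    [set lam : R | 0 < lam /\
      (\int[leb R N]_(x in Omega) (Phi (`|u x| / lam))%:E <= 1)%E]].

Definition loc_integrable Omega u : Prop :=
  forall K : set 'rV[R]_N, compact K -> K `<=` Omega ->
    (leb R N).-integrable K (EFin \o u).

Definition is_weak_partial Omega (i : 'I_N) u v : Prop :=
  [/\ loc_integrable Omega u, loc_integrable Omega v &
      forall psi, test_function Omega psi ->
        \int[leb R N]_(x in Omega) (u x * 'D_(delta_mx ord0 i) psi x) =
        - \int[leb R N]_(x in Omega) (v x * psi x)].

(* a representative of the i-th weak derivative of u; it is meaningful only if
   that derivative exists (and is then unique almost everywhere on Omega) *)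
Definition wpartial Omega (i : 'I_N) u : 'rV[R]_N -> R :=
  xget (cst 0) [set v | is_weak_partial Omega i u v].

Definition W1 Phi Omega u : Prop :=
  in_orlicz Phi Omega u /\
  forall i, (exists v, is_weak_partial Omega i u v) /\
            in_orlicz Phi Omega (wpartial Omega i u).

Definition W1norm Phi Omega u : \bar R :=
  (luxemburg Phi Omega u +
   \sum_(i < N) luxemburg Phi Omega (wpartial Omega i u))%E.

Definition W10 Phi Omega u : Prop :=
  W1 Phi Omega u /\
  forall e : R, 0 < e -> exists2 psi, test_function Omega psi &
    (W1norm Phi Omega (fun x => (u x - psi x)%R) < e%:E)%E.

Definition wgrad_norm Omega u (x : 'rV[R]_N) : R :=
  Num.sqrt (\sum_(i < N) wpartial Omega i u x ^+ 2).

Definition caratheodory_fun Omega (g : 'rV[R]_N -> R -> R) : Prop :=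
  (forall t, measurable_fun (Omega : set (lebT R N)) (g^~ t)) /\
  {ae leb R N, forall x, Omega x -> continuous (g x)}.

(* [u] is a weak solution of - Delta_Phi u = g(x, u) in Omega, u = 0 on the
   boundary; the equality of the two integrals includes their existence. *)
Definition weak_solution (phi : R -> R) Omega (g : 'rV[R]_N -> R -> R) u :
    Prop :=
  let flux v x := phi (wgrad_norm Omega u x) *
    \sum_(i < N) wpartial Omega i u x * wpartial Omega i v x in
  W10 (Phi_of phi) Omega u /\
  forall v, W10 (Phi_of phi) Omega v ->
    [/\ (leb R N).-integrable Omega (EFin \o flux v),
        (leb R N).-integrable Omega (EFin \o (fun x => g x (u x) * v x)) &
        \int[leb R N]_(x in Omega) flux v x =
        \int[leb R N]_(x in Omega) (g x (u x) * v x)].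

End spaces.

(* Main.v *)
Require Import Defs.
From HB Require Import structures.
From mathcomp Require Import all_boot all_order all_algebra.
From mathcomp Require Import all_classical all_reals all_analysis.
From mathcomp Require Import measurable_realfun ring lra.
Set Implicit Arguments.
Unset Strict Implicit.
Unset Printing Implicit Defensive.
Import Order.TTheory GRing.Theory Num.Theory.
Import numFieldNormedType.Exports.
Local Open Scope ring_scope.

(** The proof is the Brezis-Kato iteration, run in terms of the energy density
    B t = |t| p(|t|), where p t = t phi t: since
    phi(|grad u|) grad u . grad u = B(|grad u|), testing the equation with a
    function G(u) gives the integral of B(|grad u|) G'(u) on the left.

    Both growth cases yield one coercivity estimate,
    c0 |t|^alpha <= B t + C0.  Under the lower index condition p t / t^(l - 1) is
    nondecreasing ([coercive_of_lower_index]), and if Phi is equivalent to t^m it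
    follows from Phi <= B ([coercive_of_equiv]).  The rest of the
    argument works for every alpha in [1, N[ with this property.

    For 0 < e <= 1 let q = (1 + u^2) / (1 + e u^2), a weight between 1 and 1 / e,
    and let s >= 0.  Testing with G(u) = u q^(alpha s) bounds the integral E of
    |grad u|^alpha q^(alpha s) by that of a (C + 3 |H(u)|^alpha) and lower order
    terms, where H(u) = u q^s ([energy_inequality]).  Split a at a level k: below k
    it costs k times the integral of |H(u)|^alpha; above k, Hoelder with the
    exponents N / alpha and chi = N / (N - alpha), followed by the Sobolev
    inequality for H(u), bounds its contribution by a small multiple of E, which
    is absorbed ([energy_bound]).  The result does not depend on e, so letting
    e -> 0 shows that u in L^(alpha (1 + 2 s)) implies u in
    L^(chi alpha (1 + 2 s)) ([integrability_step]).  Sobolev's inequality for u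
    itself starts the iteration, and chi > 1 makes it reach every exponent.

    Two tools make this rigorous.

    First, G(u) is not itself known to be admissible, so one tests with G(psi_n),
    where the test functions psi_n converge to u.  The approximation is measured by
    B: along a fast sequence the sum over n of B(grad u - grad psi_n) is integrable,
    which gives at once convergence almost everywhere and a dominating function
    ([W10_approximation], [flux_limit], [gradient_power_limit]).  Unbounded G is
    then reached by truncation ([identity_linear_growth]).

    Second, the Sobolev inequality for smooth functions vanishing near the boundary
    of a cube.  On a regular grid the Gagliardo-Nirenberg inequality is a finite
    Loomis-Whitney inequality ([discrete_gagliardo_nirenberg]); Riemann sums carry
    it to integrals ([gagliardo_nirenberg]) without iterated integration in R^N,
    and powers of f give the other exponents ([sobolev]). *)

(** * A discrete Gagliardo-Nirenberg inequality *)
Section discrete.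
Variables (R : realType).

Lemma powR_prod (I : finType) (A : {pred I}) (h : I -> R) (r : R) :
  (forall i, 0 <= h i) ->
  (\prod_(i in A) h i) `^ r = \prod_(i in A) h i `^ r.
Proof.
move=> h0.
suff [_ //] : 0 <= \prod_(i in A) h i /\ (\prod_(i in A) h i) `^ r = \prod_(i in A) h i `^ r.
elim/big_rec2 : _ => [|i x y _ [x0 <-]]; first by rewrite powR1.
by rewrite powRM// mulr_ge0.
Qed.

(** Normalise each g i to have sum 1; then the product of the roots is at most the
    arithmetic mean of the g i t, and the means sum to 1 over t. *)
Lemma finite_hoelder (I J : finType) (A : {pred I}) (g : I -> J -> R) :
  (0 < #|A|)%N -> (forall i t, 0 <= g i t) ->
  \sum_t \prod_(i in A) g i t `^ (#|A|%:R^-1) <=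
  \prod_(i in A) (\sum_t g i t) `^ (#|A|%:R^-1).
Proof.
move=> A0 g0; set k := #|A|.
have k0 : k%:R != 0 :> R by rewrite pnatr_eq0 -lt0n.
have kV0 : k%:R^-1 != 0 :> R by rewrite invr_eq0.
pose S i := \sum_t g i t.
have S0 i : 0 <= S i by exact: sumr_ge0.
have [/existsP[i /andP[iA /eqP Si]]|] := boolP [exists i, (i \in A) && (S i == 0)].
  rewrite big1 ?prodr_ge0// => [? _|t _]; first exact: powR_ge0.
  rewrite (bigD1 i)//= (_ : g i t = 0) ?powR0 ?mul0r//.
  by move/psumr_eq0P : Si => ->.
rewrite negb_exists => /forallP Sn0.
have Sgt0 i : i \in A -> 0 < S i.
  by move=> iA; rewrite lt0r S0 andbT; have := Sn0 i; rewrite iA.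
have key t : \prod_(i in A) g i t `^ k%:R^-1 <=
    \prod_(i in A) S i `^ k%:R^-1 * ((\sum_(i in A) g i t / S i) / k%:R).
  pose h i := g i t / S i.
  have h0 i : 0 <= h i by rewrite divr_ge0.
  have -> : \prod_(i in A) g i t `^ k%:R^-1 =
      \prod_(i in A) S i `^ k%:R^-1 * \prod_(i in A) h i `^ k%:R^-1.
    rewrite -big_split/=; apply: eq_bigr => i iA.
    by rewrite -powRM// /h mulrC divfK// gt_eqF// Sgt0.
  rewrite ler_wpM2l ?prodr_ge0// => [*|]; first exact: powR_ge0.
  rewrite -powR_prod//.
  set M := _ / _.
  have M0 : 0 <= M by rewrite divr_ge0// sumr_ge0// => *; exact: h0.
  have [+ _] := @leif_AGM _ _ A h (fun i _ => h0 i).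
  rewrite -/k -[X in _ <= X ^+ _]/M -powR_mulrn// => le1.
  have kge0 : 0 <= k%:R^-1 :> R by rewrite invr_ge0.
  have /= := ge0_ler_powR kge0 _ _ le1; rewrite !nnegrE prodr_ge0// powR_ge0.
  by rewrite -powRrM mulfV// powRr1// => /(_ isT isT).
apply: (le_trans (ler_sum _ (fun t _ => key t))).
rewrite -mulr_sumr -mulr_suml exchange_big/=.
rewrite [X in _ * (X / _)](eq_bigr (fun=> 1)); last first.
  by move=> i iA; rewrite -mulr_suml divff// gt_eqF// Sgt0.
by rewrite sumr_const -/k divff// mulr1.
Qed.

Variables (N n : nat).
Local Notation I := 'I_N.
Local Notation X := 'I_n.
Local Notation K := {ffun I -> X}.

Definition upf (x : K) (i : I) (t : X) : K := [ffun j => if j == i then t else x j].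

Definition agree (S : {set I}) (x y : K) := [forall j, (j \notin S) ==> (y j == x j)].

Lemma agreeP (S : {set I}) (x y : K) : reflect (forall j, j \notin S -> y j = x j) (agree S x y).
Proof.
apply: (iffP forallP) => h j; first by move=> jS; have /implyP/(_ jS)/eqP := h j.
by apply/implyP => jS; rewrite h.
Qed.

(** Summing F over the axes in S only, the other coordinates being those of x, is
    what lets the Loomis-Whitney inequality be proved one axis at a time. *)
Definition psum (S : {set I}) (F : K -> R) (x : K) := \sum_(y | agree S x y) F y.

Lemma psum_ge0 S F x : (forall y, 0 <= F y) -> 0 <= psum S F x.
Proof. by move=> F0; exact: sumr_ge0. Qed.

Lemma psum0 F x : psum finset.set0 F x = F x.
Proof.
rewrite /psum (big_pred1 x)// => y; apply/agreeP/eqP => [h|->//].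
by apply/ffunP => j; rewrite h// inE.
Qed.

Lemma psumT F x : psum finset.setT F x = \sum_y F y.
Proof. by apply: eq_bigl => y; apply/agreeP => j; rewrite inE. Qed.

Lemma psumU1 (S : {set I}) j F x : j \notin S ->
  psum (j |: S) F x = \sum_t psum S F (upf x j t).
Proof.
move=> jS; rewrite /psum (partition_big (fun y : K => y j) predT)//=.
apply: eq_bigr => t _; apply: eq_bigl => y.
apply/andP/agreeP => [[/agreeP h /eqP <-] i iS|h].
  by rewrite ffunE; case: eqP => [->//|/eqP ij]; rewrite h// !inE negb_or ij.
split; last by rewrite h// ffunE eqxx.
by apply/agreeP => i; rewrite !inE negb_or => /andP[/negbTE ij iS]; rewrite h// ffunE ij.
Qed.

Lemma psum_upf (S : {set I}) j F x t : j \notin S ->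
  psum S (fun y => F (upf y j t)) x = psum S F (upf x j t).
Proof.
move=> jS; rewrite /psum [RHS](reindex_onto (fun y => upf y j t) (fun y => upf y j (x j))).
  apply: eq_bigl => y; apply/agreeP/andP => [h|[/agreeP h /eqP e] i iS].
    split.
      by apply/agreeP => i iS; rewrite !ffunE; case: eqP => // _; rewrite h.
    by apply/eqP/ffunP => i; rewrite !ffunE; case: eqP => // ->; rewrite h.
  rewrite -e !ffunE; case: eqP => [->//|/eqP/negbTE ij].
  by have := h i iS; rewrite !ffunE ij.
move=> y /agreeP h; apply/ffunP => i; rewrite !ffunE; case: eqP => // ->.
by rewrite h// ffunE eqxx.
Qed.

Hypothesis N2 : (2 <= N)%N.

(** Add the axes one by one.  When axis j is summed, the factor f j does not move,
    and the N - 1 other factors are handled by Hoelder with equal exponents. *)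
Lemma loomis_whitney_partial (f : I -> K -> R) (s : seq I) (x : K) :
  uniq s ->
  (forall i y, 0 <= f i y) -> (forall i y t, f i (upf y i t) = f i y) ->
  psum [set i in s] (fun y => \prod_i f i y `^ (N.-1%:R^-1)) x <=
  \prod_i (psum ([set i in s] :\ i) (f i) x) `^ (N.-1%:R^-1).
Proof.
move=> + f0 fi; elim: s x => [|j s IH] x.
  move=> _; rewrite finset.set_nil psum0; apply: ler_prod => i _.
  by rewrite powR_ge0 finset.set0D psum0 lexx.
rewrite /= => /andP[js us].
have jS : j \notin [set i in s] by rewrite inE.
have -> : [set i in j :: s] = j |: [set i in s].
  by apply/setP => i; rewrite !inE.
rewrite psumU1//.
set S := [set i in s] in IH jS *.
apply: (le_trans (ler_sum _ (fun t _ => IH (upf x j t) us))).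
have indep t : psum (S :\ j) (f j) (upf x j t) = psum (S :\ j) (f j) x.
  rewrite -psum_upf ?inE ?eqxx//; congr psum; apply/funext => y; exact: fi.
rewrite (bigD1 j)//=.
have -> : (j |: S) :\ j = S :\ j.
  by apply/setP => i; rewrite !inE; case: eqP.
have cardA : #|[pred i : I | i != j]| = N.-1.
  by rewrite -[in RHS](card_ord N) (cardD1 j (mem 'I_N)) inE /= add0n; apply: eq_card => i; rewrite !inE andbT.
under eq_bigr => t _ do rewrite (bigD1 j)//= indep.
rewrite -mulr_sumr ler_wpM2l ?powR_ge0//.
have A0 : (0 < #|[pred i : I | i != j]|)%N by rewrite cardA -ltnS prednK// ltnW.
have := @finite_hoelder _ _ [pred i : I | i != j] (fun i t => psum (S :\ i) (f i) (upf x j t)) A0.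
rewrite cardA => /(_ (fun i t => psum_ge0 _ _ (f0 i))).
move=> /le_trans; apply; apply: ler_prod => i ij; rewrite powR_ge0/=.
rewrite -psumU1; last by rewrite !inE (negbTE js) andbF.
rewrite (_ : j |: (S :\ i) = (j |: S) :\ i)//.
apply/setP => k; rewrite !inE; case: (k =P j) => [->|]//=.
by move: ij; rewrite inE eq_sym => ->.
Qed.

(** Bound f at x, for each axis i, by the sum of D i over the line through x parallel
    to that axis.  This bound is independent of coordinate i, so the Loomis-Whitney
    inequality applies to the product over i of its (N - 1)-th roots. *)
Lemma discrete_gagliardo_nirenberg (f : K -> R) (D : I -> K -> R) (x0 : K) :
  (forall i x, `|f x| <= \sum_t `|D i (upf x i t)|) ->
  \sum_x `|f x| `^ (N%:R / N.-1%:R) <=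
  \prod_i (\sum_x `|D i x|) `^ (N.-1%:R^-1).
Proof.
move=> fD.
pose r i x := \sum_t `|D i (upf x i t)|.
have r0 i x : 0 <= r i x by exact: sumr_ge0.
have ri i y t : r i (upf y i t) = r i y.
  apply: eq_bigr => t' _; congr (`|D i _|).
  by apply/ffunP => j; rewrite !ffunE; case: eqP.
have := loomis_whitney_partial x0 (enum_uniq 'I_N) r0 ri.
rewrite (_ : [set i in enum 'I_N] = finset.setT); last first.
  by apply/setP => i; rewrite !inE mem_enum.
rewrite psumT => lw.
(* Summing the line sums r i over the N - 1 other axes sums D i over the grid. *)
have -> : \prod_i (\sum_x `|D i x|) `^ N.-1%:R^-1 =
   \prod_i psum (finset.setT :\ i) (r i) x0 `^ N.-1%:R^-1.
  apply: eq_bigr => i _; congr (_ `^ _).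
  have <- := psumT (fun x => `|D i x|) x0.
  rewrite -(finset.setD1K (finset.in_setT i)) psumU1 ?inE ?eqxx//.
  rewrite /psum /r exchange_big/=; apply: eq_bigr => t _.
  by rewrite -[LHS]psum_upf ?inE ?eqxx//; rewrite (finset.setD1K (finset.in_setT i)).
apply: le_trans lw; apply: ler_sum => x _.
have N1 : N.-1%:R^-1 >= 0 :> R by rewrite invr_ge0.
(* |f x| to the power N / (N - 1) is spread as one factor per axis. *)
apply: (@le_trans _ _ (\prod_(i < N) `|f x| `^ N.-1%:R^-1)).
  by rewrite prodr_const card_ord mulrC powRrM powR_mulrn// powR_ge0.
apply: ler_prod => i _; rewrite powR_ge0/=.
by apply: ge0_ler_powR; rewrite ?nnegrE//; exact: fD.
Qed.

Lemma sum_grid_eq0 (G : K -> R) (i : I) (x0 : K) :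
  (forall x, \sum_t G (upf x i t) = 0) -> \sum_x G x = 0.
Proof.
move=> G0; rewrite -(psumT G x0) -(finset.setD1K (finset.in_setT i)).
rewrite psumU1 ?inE ?eqxx//.
under eq_bigr do rewrite -psum_upf ?inE ?eqxx//.
by rewrite /psum exchange_big/= big1.
Qed.

End discrete.

Local Open Scope classical_set_scope.
Local Open Scope ring_scope.

(** * Lebesgue measure on R^N *)
Section measure.
Variables (R : realType) (N : nat).
Local Notation V := 'rV[R]_N.
Local Notation mu := (leb R N).
Local Notation T := (lebT R N).

Lemma box_vol_ge0 (c : option (V * V)) : (0 <= box_vol c)%E.
Proof.
case: c => [ab|//] /=; rewrite lee_fin; apply: prodr_ge0 => i _.
by rewrite le_max lexx.
Qed.

Definition upd (a : V) i t : V := \row_j (if j == i then t else a ord0 j).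

Lemma updE a i t j : upd a i t ord0 j = if j == i then t else a ord0 j.
Proof. by rewrite mxE. Qed.

Definition cutl i t (c : option (V * V)) : option (V * V) :=
  if c is Some ab then Some (ab.1, upd ab.2 i (Num.min (ab.2 ord0 i) t))
  else None.

Definition cutr i t (c : option (V * V)) : option (V * V) :=
  if c is Some ab then Some (upd ab.1 i (Num.max (ab.1 ord0 i) t), ab.2)
  else None.

(** Additivity of the volume under a cut by the hyperplane x_i = t; the truncations
    by min and max keep this true when the hyperplane misses the box. *)
Lemma box_vol_cut i t c :
  (box_vol c = box_vol (cutl i t c) + box_vol (cutr i t c))%E.
Proof.
case: c => [[a b]|]; last by rewrite /= adde0.
rewrite /= -EFinD; congr EFin.
rewrite (bigD1 i)//= [X in _ = X + _](bigD1 i)//= [X in _ = _ + X](bigD1 i)//=.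
rewrite !updE eqxx.
set P := (X in _ * X = _).
rewrite (_ : \prod_(j < N | j != i) _ = P); last first.
  by apply: eq_bigr => j /negbTE ji; rewrite updE ji.
rewrite [X in _ = _ + _ * X](_ : _ = P); last first.
  by apply: eq_bigr => j /negbTE ji; rewrite updE ji.
rewrite -mulrDl; congr (_ * _).
rewrite /Num.min /Num.max; case: (ltP (b ord0 i) t) => ?;
  case: (ltP (a ord0 i) t) => ?; do ! case: ltP => ?; lra.
Qed.

(** Cutting every box of a covering along the hyperplane produces coverings of both
    parts without changing the total volume, which is the Caratheodory criterion. *)
Lemma halfspace_measurable i (t : R) :
  measurable ([set x | x ord0 i <= t] : set T).
Proof.
apply: le_caratheodory_measurable => X.
apply: le_ereal_inf_tmp => _ [c cX <-].
under eq_eseriesr do rewrite (box_vol_cut i t).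
rewrite nneseriesD; try by move=> *; exact: box_vol_ge0.
apply: leeD; apply: ereal_inf_lbound.
- exists (cutl i t \o c) => // x [/cX [k _ xk] /= xt]; exists k => //=.
  move: xk; case: (c k) => [[a b]|]//= + j.
  rewrite updE; case: eqP => // [->] /(_ i) /andP[-> /= ?].
  by rewrite le_min xt andbT.
- exists (cutr i t \o c) => // x [/cX [k _ xk] /= xt]; exists k => //=.
  move: xk; case: (c k) => [[a b]|]//= + j.
  rewrite updE; case: eqP => // [->] /(_ i) /andP[? ->].
  by rewrite andbT ge_max; apply/andP; split => //; apply: ltW; rewrite ltNge; apply/negP.
Qed.

Lemma coord_measurable i : measurable_fun (setT : set T) (fun x : V => x ord0 i).
Proof.
move=> _; apply: (measurability _ (RGenInftyO.measurableE R)) => //.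
move=> _ [_ [t ->] <-]; rewrite setTI.
rewrite (_ : _ @^-1` _ =
   \bigcup_n [set x : T | x ord0 i <= t - n.+1%:R^-1]); last first.
  apply/seteqP; split => x /=.
    rewrite in_itv /= => xt.
    have [n hn] := ltr_add_invr xt; exists n => //=; by rewrite lerBrDr ltW.
  move=> [n _ /= xn]; rewrite in_itv /=; apply: (le_lt_trans xn).
  by rewrite gtrBl invr_gt0.
by apply: bigcupT_measurable => n; exact: halfspace_measurable.
Qed.

Definition obox (a b : V) : set V := [set x | forall i, a ord0 i < x ord0 i < b ord0 i].

Lemma forall_measurable (P : 'I_N -> set T) :
  (forall i, measurable (P i)) -> measurable [set x : T | forall i, P i x].
Proof.
move=> mP.
rewrite (_ : [set x | _] = \bigcap_i P i).
  by apply: fin_bigcap_measurable => //; exact: finite_finset.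
by apply/seteqP; split => x /=; [move=> Px i _|move=> Px i; exact: Px].
Qed.

Lemma coord_itv_measurable i (I : interval R) :
  measurable ([set x | x ord0 i \in I] : set T).
Proof.
have := @coord_measurable i measurableT _ (measurable_itv I).
by rewrite setTI.
Qed.

Lemma obox_measurable a b : measurable (obox a b : set T).
Proof.
apply: (@forall_measurable (fun i => [set x : T | x ord0 i \in `]a ord0 i, b ord0 i[])).
by move=> i; exact: coord_itv_measurable.
Qed.

Lemma box_measurable c : measurable (box c : set T).
Proof.
case: c => [[a b]|]//=.
apply: (@forall_measurable (fun i => [set x : T | x ord0 i \in `[a ord0 i, b ord0 i]])).
by move=> i; exact: coord_itv_measurable.
Qed.

(** Rational boxes form a countable base: this is what makes open sets measurable. *)
Lemma rat_box_in_open (U : set V) x : open U -> U x ->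
  exists q r : 'rV[rat]_N, obox (map_mx ratr q) (map_mx ratr r) x /\
    box (Some (map_mx ratr q, map_mx ratr r)) `<=` U.
Proof.
rewrite openE => oU /oU /nbhs_ballP [e /= e0 eU].
have hq i : exists q : rat, ratr q \in `]x ord0 i - e, x ord0 i[.
  by apply: rat_in_itvoo; rewrite gtrBl.
have hr i : exists q : rat, ratr q \in `]x ord0 i, x ord0 i + e[.
  by apply: rat_in_itvoo; rewrite ltrDl.
have [q qP] := choice hq; have [r rP] := choice hr.
exists (\row_i q i), (\row_i r i); split.
  move=> i; rewrite !mxE.
  by move: (qP i) (rP i); rewrite !in_itv /= => /andP[_ ->] /andP[-> _].
move=> y /= yP; apply: eU; split => // i j.
rewrite (ord1 i) {i}; move: (yP j) (qP j) (rP j).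
rewrite !mxE !in_itv /= /ball/= ltr_norml.
by move=> /andP[? ?] /andP[? ?] /andP[? ?]; apply/andP; split; lra.
Qed.

Definition rbox (c : 'rV[rat]_N * 'rV[rat]_N) : option (V * V) :=
  Some (map_mx ratr c.1, map_mx ratr c.2).

Lemma open_bigcup_rbox (U : set V) : open U ->
  U = \bigcup_c (if `[< box (rbox c) `<=` U >] then box (rbox c) else set0).
Proof.
move=> oU; apply/seteqP; split => [x Ux|x [c _]]; last first.
  by case: asboolP => // h; exact: h.
have [q [r [xqr sU]]] := rat_box_in_open oU Ux.
exists (q, r) => //; rewrite asboolT// => i.
by have /andP[/ltW ? /ltW ?] := xqr i; apply/andP.
Qed.

Lemma open_leb_measurable (U : set V) : open U -> measurable (U : set T).
Proof.
move=> oU; rewrite (open_bigcup_rbox oU); apply: countable_bigcupT_measurable => // c.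
by case: asboolP => // _; exact: box_measurable.
Qed.

Lemma closed_leb_measurable (U : set V) : closed U -> measurable (U : set T).
Proof.
move=> cU; rewrite -(setCK U); apply: measurableC.
by apply: open_leb_measurable; rewrite openC.
Qed.

Lemma continuous_leb_measurable (f : V -> R) (D : set V) : continuous f ->
  measurable_fun (D : set T) f.
Proof.
move=> /continuousP cf; apply: (@measurable_funS _ _ _ _ setT) => // _.
apply: (measurability _ (RGenOpens.measurableE R)) => //.
move=> _ [_ [a [b ->]] <-]; rewrite setTI.
by apply: open_leb_measurable; apply: cf; exact: interval_open.
Qed.

Lemma leb_box_le c : (mu (box c) <= box_vol c)%E.
Proof.
apply: ereal_inf_lbound; exists (fun k : nat => if (k == 0)%N then c else None).
  by move=> x cx; exists 0%N.
rewrite nneseries_recl//; last by move=> *; exact: box_vol_ge0.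
by rewrite eseries0 ?adde0// => -[].
Qed.

Lemma leb_translate_le (A : set V) h : (mu [set x | A (x + h)%R] <= mu A)%E.
Proof.
apply: le_ereal_inf_tmp => _ [c cA <-].
apply: ereal_inf_lbound.
exists (fun k => omap (fun ab => (ab.1 - h, ab.2 - h)) (c k)).
  move=> x /= /cA [k _ ck]; exists k => //.
  move: ck; case: (c k) => [[a b]|]//= + i => /(_ i).
  by rewrite !mxE; lra.
apply: eq_eseriesr => k _; case: (c k) => [[a b]|]//=.
by congr EFin; apply: eq_bigr => i _; rewrite !mxE; congr Num.max; ring.
Qed.

Lemma leb_translate (A : set V) h : mu [set x | A (x + h)] = mu A.
Proof.
apply/eqP; rewrite eq_le leb_translate_le /=.
have := leb_translate_le [set x | A (x + h)] (- h).
by congr (mu _ <= _)%E; apply/seteqP; split => x /=; rewrite addrNK.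
Qed.

Definition ooptbox (c : option (V * V)) : set V :=
  if c is Some ab then obox ab.1 ab.2 else set0.

(** The boxes are open because bump functions live on open boxes.  The k-th
    box of a nearly optimal covering is enlarged so little that its volume grows by
    at most e / 2^(k + 2). *)
Lemma leb_outer_regular (E : set V) (e : R) : (mu E < +oo)%E -> 0 < e ->
  exists c : nat -> option (V * V), E `<=` \bigcup_k ooptbox (c k) /\
    (mu (\bigcup_k ooptbox (c k)) <= mu E + e%:E)%E.
Proof.
move=> Efin e0.
have muE : mu E \is a fin_num by rewrite ge0_fin_numE.
have e20 : 0 < e / 2 by rewrite divr_gt0.
have [x [c cE <-] cs] := lb_ereal_inf_adherent e20 muE.
have H k : exists c' : option (V * V), box (c k) `<=` ooptbox c' /\
   (box_vol c' <= box_vol (c k) + ((e / 2) / (2 ^ k.+1)%:R)%:E)%E.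
  case: (c k) => [[a b]|]; last first.
    by exists None; split => //=; rewrite add0e lee_fin divr_ge0// ltW.
  pose vol (d : R) := \prod_(i < N) Num.max 0 (b ord0 i - a ord0 i + 2 * d).
  have cvol : continuous vol.
    apply: continuous_big => [|i _ d]; first exact: mul_continuous.
    apply: (@continuous_max R R (cst 0) (fun d => b ord0 i - a ord0 i + 2 * d)); first exact: cvg_cst.
    apply: cvgD; first exact: cvg_cst.
    by apply: cvgM; [exact: cvg_cst|exact: cvg_id].
  have ek : 0 < e / 2 / (2 ^ k.+1)%:R by rewrite divr_gt0// ltr0n expn_gt0.
  have /cvgrPdist_lt /(_ _ ek) := cvol 0.
  move=> /nbhs_ballP [d /= d0] /(_ (d / 2)) dP.
  have dd : ball 0 d (d / 2).
    by rewrite /ball/= sub0r normrN gtr0_norm ?divr_gt0//; lra.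
  exists (Some (a - const_mx (d / 2), b + const_mx (d / 2))); split.
    by move=> y /= + i => /(_ i); rewrite !mxE; lra.
  rewrite /= -EFinD lee_fin.
  have := dP dd; rewrite ltr_norml => /andP[+ _].
  have -> : vol 0 = \prod_(i < N) Num.max 0 (b ord0 i - a ord0 i).
    by apply: eq_bigr => i _; congr Num.max; ring.
  have -> : vol (d / 2) = \prod_(i < N) Num.max 0 ((b + const_mx (d / 2)) ord0 i - (a - const_mx (d / 2)) ord0 i).
    by apply: eq_bigr => i _; rewrite !mxE; congr Num.max; ring.
  lra.
have [c' c'P] := choice H.
exists c'; split.
  by move=> y /cE [k _ yk]; exists k => //; exact: (c'P k).1.
apply: (@le_trans _ _ (\sum_(k <oo) box_vol (c' k))%E).
  apply: ereal_inf_lbound; exists c' => //= y [k _ yk]; exists k => //.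
  move: yk; case: (c' k) => [[a b]|]//= + i => /(_ i) /andP[/ltW -> /ltW ->//].
apply: (@le_trans _ _ (\sum_(k <oo) box_vol (c k) + (e / 2)%:E)%E).
  apply: le_trans (epsilon_trick _ _ _); last 2 first.
  - by move=> *; exact: box_vol_ge0.
  - exact: ltW.
  by apply: lee_nneseries => k *; [exact: box_vol_ge0|exact: (c'P k).2].
rewrite [e in leRHS](_ : e = e / 2 + e / 2); last by field.
by rewrite EFinD addeA leeD2r// ltW.
Qed.
End measure.

(** * Smooth functions built from elementary ones *)
Section theta.
Variable R : realType.

(** Partial derivatives are one-variable derivatives along a line, so the chain rule
    and the mean value theorem in one variable apply to them. *)
Lemma is_derive_line (V : normedModType R) (f : V -> R) x v d :
  is_derive x v f d <-> is_derive (0 : R) 1 (fun h : R => f (h *: v + x)) d.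
Proof.
have E : 'D_1 (fun h : R => f (h *: v + x)) 0 = 'D_v f x.
  rewrite /derive; set g1 := fun h => h^-1 *: _; set g2 := fun h => h^-1 *: _.
  suff -> : g1 = g2 by [].
  by apply/funext => h; rewrite /g1 /g2 /= addr0 scale0r add0r [h *: 1]mulr1.
split=> -[df <-].
  by apply: DeriveDef; [exact: (derivable1P _ _ _).1 df|exact: E].
by apply: DeriveDef; [exact: (derivable1P _ _ _).2 df|rewrite -E].
Qed.

Lemma is_derive_scalar_comp (V : normedModType R) (g : R -> R) (f : V -> R) x v a b :
  is_derive (f x) 1 g a -> is_derive x v f b ->
  is_derive x v (fun y => g (f y)) (a * b).
Proof.
move=> dg /is_derive_line df; apply/is_derive_line.
by apply: is_derive1_comp; rewrite scale0r add0r.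
Qed.

(** The functions P(1 / t) exp(- 1 / t), extended by 0, form a family closed under
    differentiation. *)
Definition theta (p : {poly R}) (t : R) : R :=
  if 0 < t then p.[t^-1] * expR (- t^-1) else 0.

(** exp(- 1 / t) decays faster than every power of t, so it compensates P(1 / t) and
    leaves a factor t^2, which gives the derivative 0 at the origin. *)
Lemma theta_bound p : exists2 C, 0 <= C &
  forall t : R, `|t| <= 1 -> `|theta p t| <= C * t ^+ 2.
Proof.
pose S := \sum_(i < size p) `|p`_i|.
have S0 : 0 <= S by exact: sumr_ge0.
exists (S * (size p).+2`!%:R); first by rewrite mulr_ge0.
move=> t t1; rewrite /theta; case: ltP => t0; last first.
  by rewrite normr0; apply: mulr_ge0; [exact: mulr_ge0|exact: sqr_ge0].
rewrite gtr0_norm// in t1.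
have y1 : 1 <= t^-1 by rewrite invr_ge1// ?unitfE ?gt_eqF.
have hp : `|p.[t^-1]| <= S * t^-1 ^+ size p.
  rewrite horner_coef mulr_suml (le_trans (ler_norm_sum _ _ _))//.
  apply: ler_sum => i _; rewrite normrM ler_wpM2l// normrX (ger0_norm (le_trans ler01 y1)).
  by apply: ler_weXn2l => //; exact: ltnW.
have he : expR (- t^-1) <= (size p).+2`!%:R * t ^+ (size p).+2.
  rewrite expRN -[t in leRHS]invrK exprVn -invf_div lef_pV2 ?posrE ?expR_gt0//; last first.
    by rewrite divr_gt0// ?exprn_gt0 ?invr_gt0// ltr0n fact_gt0.
  have := @expR_ge1Dxn _ t^-1 (size p).+1; rewrite invr_ge0 (ltW t0) => /(_ isT).
  by apply: le_trans; rewrite lerDr.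
rewrite normrM (ger0_norm (expR_ge0 _)).
apply: le_trans (ler_pM _ _ hp he) _ ; rewrite ?expR_ge0//.
have -> : forall a b c d : R, a * b * (c * d) = a * (b * (c * d)) by move=> *; ring.
rewrite -mulrA ler_wpM2l//.
have -> : t ^+ (size p).+2 = t ^+ size p * t ^+ 2 by rewrite -exprD addn2.
have : t^-1 ^+ size p * t ^+ size p = 1.
  by rewrite -exprMn mulVf ?expr1n ?gt_eqF.
move: (t^-1 ^+ _) (t ^+ size p) => a b ab.
by rewrite mulrCA [a * _]mulrA ab mul1r.
Qed.

Lemma is_derive_theta (p : {poly R}) (t : R) :
  is_derive t 1 (theta p) (theta ('X^2 * (p - p^`())) t).
Proof.
have [t0|t0|->] := ltgtP t 0.
- rewrite {2}/theta ltNge (ltW t0)/=.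
  have H : \near t, (cst 0 : R -> R) t = theta p t; last first.
    by apply: (near_eq_is_derive H); exact: is_derive_cst.
  near=> s; rewrite /theta ltNge ltW//=.
  by near: s; exact: lt_nbhsl.
- rewrite {2}/theta t0.
  have H : \near t, ((horner p \o GRing.inv) * (expR \o (fun s => - s^-1))) t = theta p t.
    near=> s; rewrite /theta ifT//.
    by near: s; exact: lt_nbhsr.
  apply: (near_eq_is_derive H).
  have tn0 : t != 0 by rewrite gt_eqF.
  have dinv : is_derive t 1 (fun s : R => s^-1) (- t^-1 ^+ 2).
    have di := @derivable_id R R t 1.
    apply: DeriveDef; first exact: (@derivableV _ _ id).
    by rewrite (@deriveV _ _ id)// derive_id -exprVn [_ *: _]mulr1.
  apply: is_derive_eq.
  rewrite !hornerE /=.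
  set E := expR _; set a := p.[_]; set b := p^`().[_].
  rewrite -[_ *: _]/(_ * _) -[X in _ + X]/(_ * _).
  by ring.
rewrite {2}/theta ltxx.
have [C C0 hC] := theta_bound p.
suff H : h^-1 *: ((theta p \o shift 0) (h *: 1) - theta p 0) @[h --> 0^'] --> (0 : R).
  by apply: DeriveDef; [apply/cvg_ex; exists 0|apply/cvg_lim].
apply/cvgrPdist_le => e e0.
near=> h.
have h0 : h != 0 by near: h; exact: nbhs_dnbhs_neq.
rewrite sub0r normrN /= addr0 [_ *: 1]mulr1 {2}/theta ltxx subr0.
rewrite [_ *: _]/(_ * _) normrM normfV.
rewrite ler_pdivrMl ?normr_gt0//.
apply: (@le_trans _ _ (C * h ^+ 2)).
  by apply: hC; near: h; exact: dnbhs0_le.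
rewrite -real_normK ?num_real// expr2 mulrCA ler_wpM2l//.
have : `|h| <= e / (C + 1).
  by near: h; apply: dnbhs0_le; rewrite divr_gt0// ltr_wpDl.
rewrite ler_pdivlMr ?ltr_wpDl// mulrC; apply: le_trans.
by rewrite ler_wpM2r// lerDl.
Unshelve. all: by end_near. Qed.

Lemma is_derive1_continuous (f : R -> R) (x df : R) :
  is_derive x 1 f df -> {for x, continuous f}.
Proof. by move=> [/derivable1_diffP/differentiable_continuous]. Qed.

Lemma ler_powR2r (a x y : R) : 0 <= a -> 0 <= x -> x <= y -> x `^ a <= y `^ a.
Proof.
move=> a0 x0 xy; apply: ge0_ler_powR => //; rewrite nnegrE//.
exact: le_trans xy.
Qed.

Lemma continuous_norm_powR (a : R) : 0 <= a -> continuous (fun t : R => `|t| `^ a).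
Proof.
rewrite le_eqVlt => /orP[/eqP <- t|a0 t].
  rewrite (_ : (fun t => _) = fun=> 1); first exact: cvg_cst.
  by apply/funext => s; rewrite powRr0.
have [->|t0] := eqVneq t 0.
  rewrite /continuous_at normr0 powR0 ?gt_eqF//.
  apply/cvgrPdist_le => e e0.
  have h : \forall s \near (0 : R), `|s| <= e `^ a^-1.
    by apply: nbhs0_le; exact: powR_gt0.
  move: h; apply: filterS => s h.
  rewrite sub0r normrN ger0_norm ?powR_ge0//.
  have -> : e = (e `^ a^-1) `^ a.
    by rewrite -powRrM mulVf ?gt_eqF// powRr1// ltW.
  by apply: ler_powR2r => //; exact: ltW.
apply: (@continuous_comp _ _ _ (fun t : R => `|t|) (fun t => t `^ a)).
  exact: norm_continuous.
by apply/is_derive1_continuous/is_derive1_powR; rewrite normr_gt0.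
Qed.

Lemma continuous_powR_comp (X : topologicalType) (h : X -> R) (a : R) :
  0 <= a -> continuous h -> continuous (fun x => `|h x| `^ a).
Proof.
move=> a0 ch x; apply: (@continuous_comp _ _ _ h (fun t : R => `|t| `^ a)); first exact: ch.
exact: continuous_norm_powR.
Qed.

Lemma theta_gt0 (t : R) : 0 < t -> 0 < theta 1 t.
Proof. by move=> t0; rewrite /theta t0 hornerC mul1r expR_gt0. Qed.

Lemma theta_le0 p (t : R) : t <= 0 -> theta p t = 0.
Proof. by rewrite /theta ltNge => ->. Qed.

End theta.

Section smooth_class.
Variables (R : realType) (N : nat).
Local Notation V := 'rV[R]_N.
Local Notation e_ i := (delta_mx ord0 i : V).

(** Smoothness quantifies over all iterated partial derivatives.  A syntactic class
    containing the functions of interest and closed under one partial derivative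
    reduces it to a single differentiation step. *)
Inductive smooth_expr : (V -> R) -> Prop :=
| SmoothBase f : smooth f -> smooth_expr f
| SmoothCst c : smooth_expr (fun=> c)
| SmoothCoord i : smooth_expr (fun x => x ord0 i)
| SmoothAdd f g : smooth_expr f -> smooth_expr g ->
    smooth_expr (fun x => f x + g x)
| SmoothMul f g : smooth_expr f -> smooth_expr g ->
    smooth_expr (fun x => f x * g x)
| SmoothPow f a : smooth_expr f -> (forall x, 0 < f x) ->
    smooth_expr (fun x => f x `^ a)
| SmoothTheta p f : smooth_expr f -> smooth_expr (fun x => theta p (f x)).

Lemma smooth_derive (f : V -> R) i : smooth f -> smooth (fun x => 'D_(e_ i) f x).
Proof.
move=> sf s; have := sf (rcons s i).
by rewrite /iter_partial foldr_rcons.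
Qed.

Lemma is_derive_coord i j (x : V) :
  is_derive x (e_ i) (fun y : V => y ord0 j) ((j == i)%:R).
Proof.
apply/is_derive_line.
rewrite (_ : (fun h => _) = (fun h : R => h * (j == i)%:R + x ord0 j)); last first.
  by apply/funext => h; rewrite !mxE eqxx.
by apply: is_derive_eq; rewrite scaler0 add0r [_%:A]mulr1 addr0.
Qed.

Lemma eq_smooth_expr (f g : V -> R) :
  f =1 g -> smooth_expr f -> smooth_expr g.
Proof. by move=> /funext ->. Qed.

(** Each constructor differentiates back into the class: powers lower their exponent
    and a theta function becomes another one. *)
Lemma smooth_expr_step (f : V -> R) : smooth_expr f ->
  continuous f /\ forall i, (forall x, derivable f x (e_ i)) /\
    smooth_expr (fun x => 'D_(e_ i) f x).
Proof.
elim=> {f}.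
- move=> f sf; have [cf df] := sf [::]; split => // i; split; first exact: df.
  exact/SmoothBase/smooth_derive.
- move=> c; split; first exact: cst_continuous.
  move=> i; split; first by move=> x; exact: derivable_cst.
  apply: (@eq_smooth_expr (fun=> 0)); last exact: SmoothCst.
  by move=> x; rewrite derive_cst.
- move=> j; split; first exact: coord_continuous.
  move=> i; split; first by move=> x; have [] := is_derive_coord i j x.
  apply: (@eq_smooth_expr (fun=> (j == i)%:R)); last exact: SmoothCst.
  by move=> x; have [_ ->] := is_derive_coord i j x.
- move=> f g _ [cf df] _ [cg dg]; split.
    by move=> x; exact: (cvgD (cf x) (cg x)).
  move=> i; have [dfi sfi] := df i; have [dgi sgi] := dg i.
  split; first by move=> x; exact: derivableD.
  apply: (@eq_smooth_expr (fun x => 'D_(e_ i) f x + 'D_(e_ i) g x)).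
    by move=> x; rewrite -deriveD.
  exact: SmoothAdd.
- move=> f g sf [cf df] sg [cg dg]; split.
    by move=> x; exact: (cvgM (cf x) (cg x)).
  move=> i; have [dfi sfi] := df i; have [dgi sgi] := dg i.
  split; first by move=> x; exact: derivableM.
  apply: (@eq_smooth_expr (fun x => f x * 'D_(e_ i) g x + g x * 'D_(e_ i) f x)).
    by move=> x; rewrite -deriveM.
  by apply: SmoothAdd; exact: SmoothMul.
- move=> f a sf [cf df] f0; split.
    move=> x; apply: (@continuous_comp _ _ _ f (fun t => t `^ a)); first exact: cf.
    exact/is_derive1_continuous/is_derive1_powR.
  move=> i; have [dfi sfi] := df i.
  have H x : is_derive x (e_ i) (fun x => f x `^ a)
      (a * f x `^ (a - 1) * 'D_(e_ i) f x).
    apply: (@is_derive_scalar_comp _ _ (fun t => t `^ a)).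
      exact: is_derive1_powR.
    exact: derivableP.
  split; first by move=> x; have [] := H x.
  apply: (@eq_smooth_expr (fun x => a * f x `^ (a - 1) * 'D_(e_ i) f x)).
    by move=> x; have [_ ->] := H x.
  apply: SmoothMul => //; apply: (SmoothMul (SmoothCst a)).
  exact: SmoothPow.
- move=> p f sf [cf df]; split.
    move=> x; apply: (@continuous_comp _ _ _ f (theta p)); first exact: cf.
    exact/is_derive1_continuous/is_derive_theta.
  move=> i; have [dfi sfi] := df i.
  have H x : is_derive x (e_ i) (fun x => theta p (f x))
      (theta ('X^2 * (p - p^`())) (f x) * 'D_(e_ i) f x).
    apply: is_derive_scalar_comp; first exact: is_derive_theta.
    exact: derivableP.
  split; first by move=> x; have [] := H x.
  apply: (@eq_smooth_expr (fun x => theta ('X^2 * (p - p^`())) (f x) * 'D_(e_ i) f x)).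
    by move=> x; have [_ ->] := H x.
  by apply: SmoothMul => //; exact: SmoothTheta.
Qed.

Lemma smooth_expr_smooth (f : V -> R) : smooth_expr f -> smooth f.
Proof.
move=> sf s.
suff : smooth_expr (iter_partial s f).
  move=> /smooth_expr_step [cf df]; split => // i x.
  exact: (df i).1.
elim: s => //= i s /smooth_expr_step [_ /(_ i) []//].
Qed.

End smooth_class.

(** * The fundamental lemma of the calculus of variations *)
Section fundamental_lemma.
Variables (R : realType) (N : nat).
Local Notation V := 'rV[R]_N.
Local Notation mu := (leb R N).
Local Notation T := (lebT R N).

Definition bump (c : option (V * V)) (x : V) : R :=
  if c is Some ab then
    \prod_(i < N) (theta 1 (x ord0 i - ab.1 ord0 i) * theta 1 (ab.2 ord0 i - x ord0 i))
  else 0.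

Lemma theta_ge0 (t : R) : 0 <= theta 1 t.
Proof.
have [t0|t0] := leP t 0; first by rewrite theta_le0.
by rewrite ltW// theta_gt0.
Qed.

Lemma bump_ge0 c x : 0 <= bump c x.
Proof.
by case: c => //= ab; apply: prodr_ge0 => i _; rewrite mulr_ge0 ?theta_ge0.
Qed.

Lemma bump_gt0 c x : ooptbox c x -> 0 < bump c x.
Proof.
case: c => //= ab xab; apply: prodr_gt0 => i _.
by have /andP[? ?] := xab i; rewrite mulr_gt0// theta_gt0// subr_gt0.
Qed.

Lemma bump_eq0 c x : ~ ooptbox c x -> bump c x = 0.
Proof.
case: c => //= -[a b] /=; rewrite -existsNP => -[i /negP].
rewrite negb_and -!leNgt => xab; rewrite (bigD1 i)//=.
suff -> : theta 1 (x ord0 i - a ord0 i) * theta 1 (b ord0 i - x ord0 i) = 0.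
  by rewrite mul0r.
by case/orP: xab => xab; [rewrite theta_le0 ?mul0r//|rewrite [X in _ * X]theta_le0 ?mulr0//];
  rewrite subr_le0.
Qed.

Lemma smooth_bump c : smooth_expr (bump c).
Proof.
case: c => [[a b]|]; last exact: SmoothCst.
apply: (@eq_smooth_expr _ _ (fun x : V => \prod_(i <- enum 'I_N)
   (theta 1 (x ord0 i + (- a ord0 i)) * theta 1 (b ord0 i + (-1) * x ord0 i)))).
  by move=> x; rewrite big_enum/=; apply: eq_bigr => i _; rewrite mulN1r.
elim: (enum 'I_N) => [|i s IH].
  apply: (@eq_smooth_expr _ _ (fun=> 1)); last exact: SmoothCst.
  by move=> x; rewrite big_nil.
apply: (eq_smooth_expr (fun x => esym (big_cons _ _ _ _ _ _))) => /=.
apply: SmoothMul => //; apply: SmoothMul; apply: SmoothTheta; apply: SmoothAdd.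
- exact: SmoothCoord.
- exact: SmoothCst.
- exact: SmoothCst.
- by apply: SmoothMul; [exact: SmoothCst|exact: SmoothCoord].
Qed.

Variable Omega : set V.
Hypothesis oOmega : open Omega.

Variable d : V -> R.
Hypothesis dloc : loc_integrable Omega d.
Hypothesis dtest : forall psi, test_function Omega psi ->
  \int[mu]_(x in Omega) (d x * psi x) = 0.

Lemma box_compact (c : option (V * V)) : compact (box c : set V).
Proof.
case: c => [[a b]|]; last exact: compact0.
have := @rV_compact R N (fun i => `[a ord0 i, b ord0 i]%classic) (fun i => @segment_compact _ _ _).
by congr compact; apply/seteqP; split => x /= h i; have := h i; rewrite ?in_itv.
Qed.

Lemma box_closed (c : option (V * V)) : closed (box c : set V).
Proof. by apply: compact_closed; [exact: norm_hausdorff|exact: box_compact]. Qed.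

Lemma ooptbox_sub (c : option (V * V)) : ooptbox c `<=` box c.
Proof. by case: c => //= ab x xab i; have /andP[/ltW -> /ltW ->] := xab i. Qed.

Lemma ooptbox_measurable (c : option (V * V)) : measurable (ooptbox c : set T).
Proof. by case: c => //= ab; exact: obox_measurable. Qed.

(** With rho n the n-th partial sum of the bumps of the c k, localised to the box
    q, the test functions n rho^2 / (1 + n rho^2) lie between 0 and 1 and tend to the
    indicator of the set over which d is integrated. *)
Lemma integral_open_eq0 (q : option (V * V)) (c : nat -> option (V * V)) :
  box q `<=` Omega ->
  (\int[mu]_(x in (\bigcup_k ooptbox (c k)) `&` ooptbox q) (d x)%:E = 0)%E.
Proof.
move=> qO.
set W := \bigcup_k _.
pose rho n x := (\sum_(k < n) bump (c k) x) * bump q x.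
pose eta n x := n%:R * rho n x ^+ 2 * (1 + n%:R * rho n x ^+ 2) `^ (-1).
have den_gt0 n x : 0 < 1 + n%:R * rho n x ^+ 2.
  by rewrite ltr_pwDl// mulr_ge0// sqr_ge0.
have rho_ge0 n x : 0 <= rho n x.
  by rewrite mulr_ge0 ?bump_ge0// sumr_ge0// => *; exact: bump_ge0.
have sm n : smooth_expr (eta n).
  have srho : smooth_expr (rho n).
    apply: SmoothMul; last exact: smooth_bump.
    elim: n => [|n IH].
      apply: (@eq_smooth_expr _ _ (fun=> 0)); last exact: SmoothCst.
      by move=> x; rewrite big_ord0.
    apply: (@eq_smooth_expr _ _ (fun x => \sum_(k < n) bump (c k) x + bump (c n) x)).
      by move=> x; rewrite big_ord_recr.
    by apply: SmoothAdd => //; exact: smooth_bump.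
  have s2 : smooth_expr (fun x => n%:R * rho n x ^+ 2).
    by apply: SmoothMul; [exact: SmoothCst|exact: SmoothMul].
  apply: SmoothMul => //; apply: SmoothPow => //.
  by apply: SmoothAdd => //; exact: SmoothCst.
have eta01 n x : 0 <= eta n x <= 1.
  rewrite /eta powR_inv1 ?(ltW (den_gt0 _ _))//.
  apply/andP; split.
    by apply: mulr_ge0; [rewrite mulr_ge0// sqr_ge0|rewrite invr_ge0 (ltW (den_gt0 _ _))].
  by rewrite ler_pdivrMr// mul1r lerDr.
have eta0 n x : ~ ooptbox q x -> eta n x = 0.
  by move=> /bump_eq0; rewrite /eta /rho => ->; rewrite mulr0 expr0n/= mulr0 mul0r.
have eta_test n : test_function Omega (eta n).
  have sq : closure [set x | eta n x != 0] `<=` box q.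
    apply: (subset_trans (closureS _)) (@box_closed q) => x /= ex.
    by apply: contrapT => nq; move: ex; rewrite eta0 ?eqxx// => /ooptbox_sub.
  split; first exact: smooth_expr_smooth.
    exact: (subclosed_compact (@closed_closure _ _) (@box_compact q) sq).
  exact: subset_trans qO.
have mK : measurable (box q : set T) by exact: box_measurable.
have intd : mu.-integrable (box q) (EFin \o d) by apply: dloc => //; exact: box_compact.
have md := measurable_int mu intd.
have meta n : measurable_fun (box q : set T) (fun x => d x * eta n x).
  apply: measurable_funM; first exact/measurable_EFinP.
  apply: continuous_leb_measurable.
  by have [] := smooth_expr_step (sm n).
have eta_lim x : eta n x @[n --> \oo] --> (\1_(W `&` ooptbox q) x : R).
  have [xW|xW] := pselect ((W `&` ooptbox q) x); last first.
    rewrite indicE memNset//= (_ : (fun _ => _) = fun=> 0); first exact: cvg_cst.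
    apply/funext => n.
    have [xq|xq] := pselect (ooptbox q x); last exact: eta0.
    rewrite /eta /rho (_ : \sum_(k < n) _ = 0) ?mul0r ?expr0n ?mulr0 ?mul0r//.
    rewrite big1// => k _; apply: bump_eq0 => xk; apply: xW; split => //.
    by exists k.
  rewrite indicE mem_set//=.
  case: xW => -[k0 _ xk0] xq.
  pose r := bump (c k0) x * bump q x.
  have r0 : 0 < r by rewrite mulr_gt0// bump_gt0.
  have rhor n : (k0 < n)%N -> r <= rho n x.
    move=> kn; rewrite /r /rho ler_wpM2r ?bump_ge0//.
    rewrite (bigD1 (Ordinal kn))//= lerDl sumr_ge0// => *; exact: bump_ge0.
  apply/cvgrPdist_le => e e0; near=> n.
  have kn : (k0 < n)%N by near: n; exact: nbhs_infty_gt.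
  have n1 : r ^- 2 / e <= n%:R.
    by near: n; exact: nbhs_infty_ger.
  rewrite /eta powR_inv1 ?(ltW (den_gt0 _ _))//.
  have -> : 1 - n%:R * rho n x ^+ 2 / (1 + n%:R * rho n x ^+ 2) = (1 + n%:R * rho n x ^+ 2)^-1.
    by field; rewrite gt_eqF.
  rewrite ger0_norm ?invr_ge0 ?(ltW (den_gt0 _ _))// invf_ple ?posrE//.
  apply: (@le_trans _ _ (n%:R * r ^+ 2)).
    by rewrite -ler_pdivrMr ?exprn_gt0// mulrC.
  rewrite (@le_trans _ _ (n%:R * rho n x ^+ 2))// ?lerDr//.
  by rewrite ler_wpM2l// ler_pXn2r ?nnegrE ?rhor// ?(ltW r0)// (le_trans (ltW r0))// rhor.
rewrite setIC.
have -> : ooptbox q `&` W = box q `&` (W `&` ooptbox q).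
  by apply/seteqP; split => x /= => [[? ?]|[_ []//]]; split => //; exact: ooptbox_sub.
rewrite integral_mkcondr.
have mW : measurable (W `&` ooptbox q : set T).
  apply: measurableI; last exact: ooptbox_measurable.
  by apply: bigcupT_measurable => k; exact: ooptbox_measurable.
have [] := @dominated_convergence _ _ _ mu _ mK (fun n x => (d x * eta n x)%:E)
  ((EFin \o d) \_ (W `&` ooptbox q)) (abse \o (EFin \o d)).
- by move=> n; exact/measurable_EFinP.
- by apply/(measurable_restrict _ _ _).1 => //; apply: measurable_funS md => // x [].
- apply: aeW => x _; rewrite /patch.
  have -> : (if x \in W `&` ooptbox q then (EFin \o d) x else 0%E) =
     (d x * \1_(W `&` ooptbox q) x)%:E.
    by rewrite indicE; case: (x \in _) => /=; rewrite ?mulr1 ?mulr0.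
  by apply: cvg_EFin; [exact: nearW|apply: cvgM; [exact: cvg_cst|exact: eta_lim]].
- exact: integrable_abse.
- apply: aeW => x n _ /=; rewrite lee_fin normrM ler_piMr//.
  by have /andP[? ?] := eta01 n x; rewrite ger0_norm.
move=> _ _ /cvg_lim => <- //.
rewrite (_ : (fun n => _) = fun=> 0%E); first by rewrite lim_cst.
apply/funext => n.
have int_eta : mu.-integrable (box q) (EFin \o (fun x => d x * eta n x)).
  apply: (le_integrable mK _ _ intd); first exact/measurable_EFinP.
  move=> x _ /=; rewrite lee_fin normrM ler_piMr//.
  by have /andP[? ?] := eta01 n x; rewrite ger0_norm.
have := dtest (eta_test n); rewrite /Rintegral.
rewrite [X in fine X](_ : _ = \int[mu]_(x in box q) (d x * eta n x)%:E)%E.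
  move=> h; rewrite -[LHS]fineK; last exact: integrable_fin_num.
  by rewrite h.
rewrite integral_mkcond [RHS]integral_mkcond; congr (integral _ _ _).
apply/funext => x; rewrite /patch.
case: ifPn => xO; case: ifPn => xq //.
  by rewrite eta0 ?mulr0// => /ooptbox_sub /mem_set; exact/negP.
by have := qO x (set_mem xq) => /mem_set; rewrite (negbTE xO).
Unshelve. all: by end_near. Qed.

Lemma ooptbox_bounded (q : option (V * V)) : (mu (ooptbox q) < +oo)%E.
Proof.
apply: (@le_lt_trans _ _ (mu (box q))).
  exact/le_outer_measure/ooptbox_sub.
apply: le_lt_trans (leb_box_le q) _.
by case: q => [ab|]; rewrite /= ltry.
Qed.

(** Outer regularity encloses E in an open set that differs from it by little
    measure, over which the integral of d is small by absolute continuity. *)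
Lemma integral_measurable_eq0 (q : option (V * V)) (E : set T) :
  box q `<=` Omega -> measurable E -> E `<=` ooptbox q ->
  (\int[mu]_(x in E) (d x)%:E = 0)%E.
Proof.
move=> qO mE Eq.
have mK : measurable (box q : set T) by exact: box_measurable.
have mq : measurable (ooptbox q : set T) by exact: ooptbox_measurable.
have intd : mu.-integrable (box q) (EFin \o d) by apply: dloc => //; exact: box_compact.
pose d' : V -> R := d \_ (box q).
have intd' : mu.-integrable setT (EFin \o (d' : T -> R)).
  have := (integrable_mkcond (EFin \o (d : T -> R)) mK).1 intd.
  by congr (integrable _ _ _); apply/funext => x; rewrite /d' /patch/=; case: ifP.
have Efin : (mu E < +oo)%E.
  by apply: (le_lt_trans _ (ooptbox_bounded q)); exact: le_outer_measure.
have subint A : measurable (A : set T) -> A `<=` ooptbox q ->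
    mu.-integrable A (EFin \o d).
  move=> mA Aq; apply: (integrableS mK mA _ intd).
  exact: (subset_trans Aq (@ooptbox_sub q)).
have fin := integrable_fin_num mE (subint _ mE Eq).
rewrite -(fineK fin); congr EFin; apply/eqP; rewrite -normr_le0.
apply/ler_addgt0Pr => e e0; rewrite add0r.
have [r [r0 hr]] := integral_normr_continuous intd' e0.
have [c [Ec cE]] := leb_outer_regular Efin (divr_gt0 r0 (ltr0n _ 2)).
set W := \bigcup_k _ in Ec cE.
have mW : measurable (W : set T).
  by apply: bigcupT_measurable => k; exact: ooptbox_measurable.
pose D := (W `&` ooptbox q) `\` E.
have mD : measurable (D : set T) by apply: measurableD => //; exact: measurableI.
have WE : W `&` ooptbox q = E `|` D.
  apply/seteqP; split => x; rewrite /D.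
    by move=> Wx; have [Ex|nEx] := pselect (E x); [left|right].
  by move=> [Ex|[]//]; split; [exact: Ec|exact: Eq].
have Dq : D `<=` ooptbox q by move=> x [[]].
have /eqP := integral_open_eq0 c qO; rewrite -/W WE.
rewrite integral_setU//=; last 2 first.
- apply: measurable_int (subint _ _ _); first exact: measurableU.
  by move=> x [/Eq|/Dq].
- by apply/disj_setPS => x [Ex [_]].
have finD := integrable_fin_num mD (subint _ mD Dq).
rewrite -(fineK fin) -(fineK finD) -EFinD eqe addr_eq0 => /eqP ->.
rewrite normrN.
have muD : (mu D < r%:E)%E.
  apply: (@le_lt_trans _ _ (r / 2)%:E); last by rewrite lte_fin; lra.
  apply: (@le_trans _ _ (mu (W `\` E))).
    by apply: le_outer_measure => x [[]].
  have mWfin : (mu W < +oo)%E by apply: le_lt_trans cE _; rewrite lte_add_pinfty ?ltry.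
  rewrite measureD// setIidr//.
  have muE : mu E \is a fin_num by rewrite ge0_fin_numE.
  by rewrite leeBlDl.
have := hr _ mD muD => hlt.
apply: le_trans (ltW hlt).
have dd' : {in D, (fun x => d x) =1 d'}.
  by move=> x /set_mem [[_ xq] _]; rewrite /d' /patch mem_set//; exact: ooptbox_sub.
have dI := subint _ mD Dq.
have := le_normr_Rintegral mD dI.
rewrite /Rintegral => /le_trans; apply.
rewrite le_eqVlt; apply/orP; left; apply/eqP; congr fine; apply: eq_integral => x xD.
by rewrite dd'.
Qed.

(** An integrable function whose integral vanishes over every measurable subset of a
    box vanishes almost everywhere there; countably many rational boxes cover
    Omega. *)
Lemma fundamental_lemma : {ae mu, forall x, Omega x -> d x = 0}.
Proof.
pose P n (x : T) := if unpickle n is Some c then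
  box (rbox R c) `<=` Omega -> ooptbox (rbox R c) x -> d x = 0 else True.
have Pae : {ae mu, forall x n, P n x}.
  apply/ae_foralln => n; rewrite /P; case: unpickle => [c|]; last exact: aeW.
  have [cO|nc] := pselect (box (rbox R c) `<=` Omega); last exact: aeW.
  have mq : measurable (ooptbox (rbox R c) : set T) by exact: ooptbox_measurable.
  have intd : mu.-integrable (ooptbox (rbox R c)) (EFin \o d).
    have mK : measurable (box (rbox R c) : set T) by exact: box_measurable.
    have intK : mu.-integrable (box (rbox R c)) (EFin \o d).
      by apply: dloc => //; exact: box_compact.
    exact: (integrableS mK mq (@ooptbox_sub _) intK).
  have := @integral_ae_eq _ _ _ mu _ mq (cst 0%E) (EFin \o d) intd (measurable_cst _).
  have h : forall E : set T, E `<=` ooptbox (rbox R c) -> measurable E ->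
    (\int[mu]_(x in E) (EFin \o d) x = \int[mu]_(x in E) cst 0 x)%E.
    move=> E Eq mE; rewrite [RHS]integral0_eq//.
    exact: integral_measurable_eq0 Eq.
  move=> /(_ h); apply: filterS => x hx _ xq.
  by have [] := hx xq.
move: Pae; apply: filterS => x Px Ox.
have [q [r [xqr qrO]]] := rat_box_in_open oOmega Ox.
have := Px (pickle (q, r)); rewrite /P pickleK; exact.
Qed.

End fundamental_lemma.

(** * Riemann sums and the Gagliardo-Nirenberg inequality *)
Section riemann.
Variables (R : realType) (N : nat) (M : R).
Hypothesis M0 : 0 < M.
Local Notation V := 'rV[R]_N.
Local Notation mu := (leb R N).
Local Notation T := (lebT R N).
Local Notation e_ i := (delta_mx ord0 i : V).

(** Half open, so that the cells of a grid partition it. *)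
Definition cube : set V := [set x | forall i, - M <= x ord0 i < M].

Definition mesh (n : nat) : R := 2 * M / n.+1%:R.

Definition gridpt n (k : {ffun 'I_N -> 'I_n.+1}) : V :=
  \row_i (- M + mesh n * (k i)%:R).

Definition cell n (k : {ffun 'I_N -> 'I_n.+1}) : set V :=
  [set x | forall i, gridpt k ord0 i <= x ord0 i < gridpt k ord0 i + mesh n].

Lemma mesh_gt0 n : 0 < mesh n.
Proof. by rewrite divr_gt0// mulr_gt0. Qed.

Lemma meshE n : mesh n * n.+1%:R = 2 * M.
Proof. by rewrite divfK// pnatr_eq0. Qed.

Lemma mesh_cvg0 : mesh n @[n --> \oo] --> 0.
Proof.
rewrite [X in _ --> X](_ : 0 = 2 * M * 0); last by rewrite mulr0.
by apply: cvgM; [exact: cvg_cst|exact: cvg_harmonic].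
Qed.

Lemma cube_measurable : measurable (cube : set T).
Proof.
apply: (@forall_measurable _ _ (fun i => [set x : T | x ord0 i \in `[- M, M[])).
by move=> i; exact: coord_itv_measurable.
Qed.

Lemma cell_measurable n (k : {ffun 'I_N -> 'I_n.+1}) : measurable (cell k : set T).
Proof.
apply: (@forall_measurable _ _ (fun i =>
  [set x : T | x ord0 i \in `[gridpt k ord0 i, gridpt k ord0 i + mesh n[])).
by move=> i; exact: coord_itv_measurable.
Qed.

Lemma cell_sub_cube n (k : {ffun 'I_N -> 'I_n.+1}) : cell k `<=` cube.
Proof.
move=> x xk i; have := xk i; rewrite mxE => /andP[h1 h2].
have m0 := mesh_gt0 n.
have kn : mesh n * (k i)%:R + mesh n <= 2 * M.
  by rewrite -[X in _ + X]mulr1 -mulrDr natr1 -(meshE n) ler_pM2l// ler_nat.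
have : 0 <= mesh n * (k i)%:R by rewrite mulr_ge0// ltW.
by move: h1 h2 kn; move: (mesh n * _) => z; lra.
Qed.

Lemma cube_cell n x : cube x -> exists2 k : {ffun 'I_N -> 'I_n.+1}, cell k x &
  forall k', cell k' x -> k' = k.
Proof.
move=> xC; have m0 := mesh_gt0 n.
pose t i := (x ord0 i + M) / mesh n.
have t0 i : 0 <= t i.
  by have := xC i => /andP[? ?]; rewrite divr_ge0 ?(ltW m0)//; lra.
have tn i : t i < n.+1%:R.
  have := xC i => /andP[? ?].
  by rewrite ltr_pdivrMr// /mesh mulrC divfK ?pnatr_eq0//; lra.
have kP i : (Num.trunc (t i) < n.+1)%N.
  have /andP[h _] := truncn_itv (t0 i).
  by rewrite -(ltr_nat R); exact: le_lt_trans h (tn i).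
exists [ffun i => Ordinal (kP i)].
  move=> i; rewrite mxE ffunE /=.
  have /andP[h1 h2] := truncn_itv (t0 i).
  have xE : x ord0 i = - M + mesh n * t i.
    by rewrite /t mulrC divfK ?gt_eqF//; ring.
  rewrite {1 2}xE lerD2l ler_pM2l// h1/= -addrA ltrD2l.
  by rewrite -[X in _ + X]mulr1 -mulrDr natr1 ltr_pM2l.
move=> k' xk'; apply/ffunP => i; rewrite ffunE; apply: val_inj => /=.
have := xk' i; rewrite mxE => /andP[h1 h2].
apply/esym; apply: truncn_def.
rewrite ler_pdivlMr// ltr_pdivrMr// ![_%:R * _]mulrC -[in X in _ && X]natr1 mulrDr mulr1.
by apply/andP; split; lra.
Qed.

Lemma cube_fin : (mu cube < +oo)%E.
Proof.
apply: (@le_lt_trans _ _ (mu (box (Some (const_mx (- M), const_mx M))))).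
  apply: le_outer_measure => x xC i; rewrite !mxE.
  by have /andP[-> /ltW ->] := xC i.
by apply: le_lt_trans (leb_box_le _) _; rewrite ltry.
Qed.

(** By translation invariance all cells have the same measure.  Its value is never
    computed: the constants below only involve the measure of the cube. *)
Definition cellvol n : R := fine (mu (cell [ffun=> ord0 : 'I_n.+1])).

Lemma leb_cell n (k : {ffun 'I_N -> 'I_n.+1}) : mu (cell k) = (cellvol n)%:E.
Proof.
pose k0 : {ffun 'I_N -> 'I_n.+1} := [ffun=> ord0 : 'I_n.+1].
rewrite /cellvol fineK; last first.
  rewrite ge0_fin_numE//; apply: le_lt_trans cube_fin.
  exact/le_outer_measure/cell_sub_cube.
rewrite -[RHS](leb_translate _ (gridpt k0 - gridpt k)); congr mu.
apply/seteqP; split => x /= h i; have := h i; rewrite !mxE;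
  move: (mesh n * _) (mesh n * _) => a b /andP[? ?]; apply/andP; split; lra.
Qed.

Lemma cellvol_ge0 n : 0 <= cellvol n.
Proof. by rewrite fine_ge0. Qed.

Definition stepf n (F : V -> R) (x : V) : R :=
  \sum_(k : {ffun 'I_N -> 'I_n.+1}) F (gridpt k) * \1_(cell k) x.

Lemma stepfE n F (k : {ffun 'I_N -> 'I_n.+1}) x : cell k x -> stepf n F x = F (gridpt k).
Proof.
move=> xk; have [k1 _ k1P] := cube_cell n (cell_sub_cube xk).
rewrite /stepf (bigD1 k)//= indicE mem_set// mulr1 big1 ?addr0// => k' k'k.
rewrite indicE memNset ?mulr0// => xk'.
by move: k'k; rewrite (k1P _ xk) (k1P _ xk') eqxx.
Qed.

Lemma stepf_measurable n F : measurable_fun (cube : set T) (stepf n F).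
Proof.
apply: measurable_sum => k; apply: measurable_funM => //.
by apply: measurable_indic; exact: cell_measurable.
Qed.

Lemma integrable_bounded (f : V -> R) B : measurable_fun (cube : set T) f ->
  (forall x, cube x -> `|f x| <= B) -> mu.-integrable cube (EFin \o f).
Proof.
move=> mf fB; apply: measurable_bounded_integrable => //.
- exact: cube_measurable.
- exact: cube_fin.
exists B; split; first exact: num_real.
by move=> B' BB' x xC; apply: (le_trans (fB _ xC)); exact: ltW.
Qed.

Lemma stepf_integral n F :
  \int[mu]_(x in cube) stepf n F x =
  \sum_(k : {ffun 'I_N -> 'I_n.+1}) F (gridpt k) * cellvol n.
Proof.
have mC := cube_measurable.
have int1 (k : {ffun 'I_N -> 'I_n.+1}) : mu.-integrable cube (EFin \o (\1_(cell k) : V -> R)).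
  apply: (@integrable_bounded _ 1); first by apply: measurable_indic; exact: cell_measurable.
  by move=> x _; rewrite indicE; case: (_ \in _); rewrite ?normr1 ?normr0.
have term (k : {ffun 'I_N -> 'I_n.+1}) :
    \int[mu]_(x in cube) (F (gridpt k) * \1_(cell k) x) = F (gridpt k) * cellvol n.
  rewrite RintegralZl//; congr (_ * _); rewrite /Rintegral.
  rewrite integral_indic//; last exact: cell_measurable.
  by rewrite (setIidl (@cell_sub_cube n k)); exact: (congr1 fine (leb_cell k)).
have intZ (k : {ffun 'I_N -> 'I_n.+1}) :
    mu.-integrable cube (EFin \o (fun x => F (gridpt k) * \1_(cell k) x)).
  exact: (integrableZl mC (F (gridpt k)) (int1 k)).
rewrite /stepf; elim: (index_enum _) => [|k s IH].
  under eq_Rintegral do rewrite big_nil.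
  by rewrite big_nil Rintegral_cst ?mul0r.
under eq_Rintegral do rewrite big_cons.
rewrite RintegralD//; last first.
  have := @integrable_sum _ _ _ mu _ mC _ s xpredT (fun k x => (F (gridpt k) * \1_(cell k) x)%:E) (fun k _ => intZ k).
  by congr (integrable _ _ _); apply/funext => x; rewrite /= -sumEFin.
by rewrite big_cons term IH.
Qed.

Lemma cube_vol n : fine (mu cube) = cellvol n *+ n.+1 ^ N.
Proof.
have mC := cube_measurable.
have := stepf_integral n (cst 1).
rewrite (@eq_Rintegral _ _ _ _ _ (cst 1)) => [|x /set_mem xC]; last first.
  by have [k xk _] := cube_cell n xC; rewrite (stepfE _ xk).
rewrite Rintegral_cst// mul1r => ->.
under eq_bigr do rewrite mul1r.
by rewrite sumr_const card_ffun !card_ord.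
Qed.

(** A Riemann sum is the integral of a step function, so that dominated convergence
    applies.  The integrand may vary with the mesh, as difference quotients do. *)
Lemma riemann_cvg (Fn : nat -> V -> R) (F : V -> R) (B : R) :
  (forall n y, cube y -> `|Fn n y| <= B) ->
  (forall x (e : R), cube x -> 0 < e -> \forall n \near \oo, forall y : V,
     (forall i, y ord0 i <= x ord0 i < y ord0 i + mesh n) -> `|F x - Fn n y| <= e) ->
  \sum_(k : {ffun 'I_N -> 'I_n.+1}) Fn n (gridpt k) * cellvol n @[n --> \oo] -->
  \int[mu]_(x in cube) F x.
Proof.
move=> FB Fcv.
have mC := cube_measurable.
have gridC n (k : {ffun 'I_N -> 'I_n.+1}) : cube (gridpt k).
  by apply: (@cell_sub_cube _ k) => i; rewrite lexx ltrDl mesh_gt0.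
have lim x : cube x -> stepf n (Fn n) x @[n --> \oo] --> F x.
  move=> xC; apply/cvgrPdist_le => e e0.
  have := Fcv x e xC e0; apply: filterS => n h.
  by have [k xk _] := cube_cell n xC; rewrite (stepfE _ xk); exact: h.
have bnd n x : cube x -> `|stepf n (Fn n) x| <= B.
  by move=> xC; have [k xk _] := cube_cell n xC; rewrite (stepfE _ xk) FB.
have mF : measurable_fun (cube : set T) F.
  by apply: (@measurable_fun_cvg _ T R (cube : set T) (fun n => stepf n (Fn n)) F) => // n; exact: stepf_measurable.
have [] := @dominated_convergence _ _ _ mu _ mC (fun n x => (stepf n (Fn n) x)%:E)
  (EFin \o F) (cst B%:E).
- by move=> n; exact/measurable_EFinP/stepf_measurable.
- exact/measurable_EFinP.
- by apply: aeW => x xC; apply: cvg_EFin; [exact: nearW|exact: lim].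
- have h : mu.-integrable cube (EFin \o (cst B : V -> R)).
    by apply: (@integrable_bounded _ `|B|) => //; exact: measurable_cst.
  exact: h.
- by apply: aeW => x n xC /=; rewrite lee_fin bnd.
move=> intF _ h.
under eq_cvg do rewrite -stepf_integral.
have finF := integrable_fin_num mC intF.
by rewrite /Rintegral; apply: fine_cvg; rewrite fineK.
Qed.

Lemma bounded_on_box (F : V -> R) (r : R) : continuous F ->
  exists2 B : R, 0 <= B & forall y : V, (forall i, `|y ord0 i| <= r) -> `|F y| <= B.
Proof.
move=> cF.
have cK : compact (box (Some (const_mx (- r) : V, const_mx r))) by exact: box_compact.
have /compact_bounded [B [_ hB]] := continuous_compact (continuous_subspaceT cF) cK.
exists (`|B| + 1); first by rewrite addr_ge0.
move=> y yr; apply: hB; first by rewrite (le_lt_trans (ler_norm B))// ltrDl.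
by exists y => // i; rewrite !mxE -ler_norml.
Qed.

Variables (f : V -> R) (g : 'I_N -> V -> R).
Hypothesis cf : continuous f.
Hypothesis cg : forall i, continuous (g i).
Hypothesis df : forall i x, is_derive x (e_ i) f (g i x).
Hypothesis f0 : forall (x : V) i, M <= `|x ord0 i| -> f x = 0.

Lemma axis_mvt i (y : V) (h : R) : 0 < h ->
  exists2 c : R, 0 <= c <= h & f (h *: e_ i + y) - f y = g i (c *: e_ i + y) * h.
Proof.
move=> h0.
have dphi (s : R) : is_derive s 1 (fun s : R => f (s *: e_ i + y)) (g i (s *: e_ i + y)).
  apply/is_derive_line.
  have := (is_derive_line _ _ _ _).1 (df i (s *: e_ i + y)).
  congr (is_derive _ _ _ _); apply/funext => r.
  by rewrite addrA -scalerDl [r%:A]mulr1.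
have cphi : {within `[0, h], continuous (fun s : R => f (s *: e_ i + y))}.
  by apply: continuous_subspaceT => s; exact: is_derive1_continuous (dphi s).
have [c cab] := MVT_segment (ltW h0) (fun s _ => dphi s) cphi.
rewrite subr0 scale0r add0r => fE.
by exists c => //; move: cab; rewrite in_itv.
Qed.

Lemma axis_coord i (y : V) (c : R) j : (c *: e_ i + y) ord0 j = (if j == i then c else 0) + y ord0 j.
Proof. by rewrite !mxE eqxx/=; case: eqP => _; rewrite ?mulr1 ?mulr0. Qed.

(** The increment over one mesh along axis i: on the grid it plays the part of the
    partial derivative, and it telescopes. *)
Definition gdiff n i (y : V) : R := f (mesh n *: e_ i + y) - f y.

Lemma gdiff_bounded i : exists B : R, forall n (y : V), cube y -> `|gdiff n i y / mesh n| <= B.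
Proof.
have [B B0 hB] := bounded_on_box (3 * M) (cg (i := i)).
exists B => n y yC.
have m0 := mesh_gt0 n.
have [c /andP[c0 cm]] := axis_mvt i y m0; rewrite /gdiff => ->.
rewrite mulfK ?gt_eqF//; apply: hB => j; rewrite axis_coord.
have m2 : mesh n <= 2 * M.
  by rewrite /mesh ler_pdivrMr// ler_peMr ?mulr_ge0// ?(ltW M0)// ler1n.
have /andP[? ?] := yC j; rewrite ler_norml; case: eqP => _; apply/andP; split; lra.
Qed.

Lemma gdiff_cvg i (x : V) (e : R) : 0 < e -> \forall n \near \oo, forall y : V,
   (forall i, y ord0 i <= x ord0 i < y ord0 i + mesh n) ->
   `|g i x - gdiff n i y / mesh n| <= e.
Proof.
move=> e0.
have /cvgrPdist_le/(_ _ e0)/nbhs_ballP[d /= d0 dP] := @cg i x.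
near=> n => y yx.
have m0 := mesh_gt0 n.
have [c /andP[c0 cm]] := axis_mvt i y m0; rewrite /gdiff => ->.
rewrite mulfK ?gt_eqF//; apply: dP; split => // k j.
rewrite (ord1 k) axis_coord /ball/= ltr_norml.
have md : mesh n < d.
  by near: n; exact: (cvgr_lt 0 mesh_cvg0).
have /andP[? ?] := yx j; case: eqP => _; apply/andP; split; lra.
Unshelve. all: by end_near. Qed.

Lemma comp_grid_cvg (F : V -> R) (x : V) (e : R) : continuous F -> 0 < e ->
  \forall n \near \oo, forall y : V,
   (forall i, y ord0 i <= x ord0 i < y ord0 i + mesh n) -> `|F x - F y| <= e.
Proof.
move=> cF e0.
have /cvgrPdist_le/(_ _ e0)/nbhs_ballP[d /= d0 dP] := cF x.
near=> n => y yx.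
have m0 := mesh_gt0 n.
apply: dP; split => // k j; rewrite (ord1 k) /ball/= ltr_norml.
have md : mesh n < d.
  by near: n; exact: (cvgr_lt 0 mesh_cvg0).
have /andP[? ?] := yx j; apply/andP; split; lra.
Unshelve. all: by end_near. Qed.

Section fixed_mesh.
Variable n : nat.
Local Notation K := {ffun 'I_N -> 'I_n.+1}.

Let G (k : K) i (t : nat) : R := f (upd (gridpt k) i (- M + mesh n * t%:R)).

Lemma gdiff_upf (k : K) i t : gdiff n i (gridpt (upf k i t)) = G k i t.+1 - G k i t.
Proof.
rewrite /gdiff /G; congr (f _ - f _); apply/rowP => j; rewrite ?axis_coord !mxE !ffunE.
  by case: eqP => _; rewrite ?add0r// -natr1; ring.
by case: eqP.
Qed.

Lemma grid_line_first (k : K) i : G k i 0 = 0.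
Proof. by apply: (@f0 _ i); rewrite updE eqxx mulr0 addr0 normrN gtr0_norm. Qed.

Lemma grid_line_last (k : K) i : G k i n.+1 = 0.
Proof.
apply: (@f0 _ i); rewrite updE eqxx meshE (_ : - M + 2 * M = M); last by ring.
by rewrite gtr0_norm.
Qed.

Lemma sum_gdiff_upf (k : K) i : \sum_t gdiff n i (gridpt (upf k i t)) = 0.
Proof.
under eq_bigr do rewrite gdiff_upf.
rewrite -(big_mkord xpredT (fun t => G k i t.+1 - G k i t)) telescope_sumr//.
by rewrite grid_line_last grid_line_first subr0.
Qed.

(** f vanishes on the lower face of the cube; telescope from there. *)
Lemma gridpt_le_gdiff (k : K) i :
  `|f (gridpt k)| <= \sum_t `|gdiff n i (gridpt (upf k i t))|.
Proof.
have -> : f (gridpt k) = G k i (k i).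
  by congr f; apply/rowP => j; rewrite !mxE; case: eqP => // ->.
under eq_bigr do rewrite gdiff_upf.
rewrite -(big_mkord xpredT (fun t => `|G k i t.+1 - G k i t|)).
rewrite (@big_cat_nat _ _ _ (k i))//=; last exact: ltnW.
have -> : G k i (k i) = \sum_(0 <= t < k i) (G k i t.+1 - G k i t).
  by rewrite telescope_sumr// grid_line_first subr0.
rewrite (le_trans (ler_norm_sum _ _ _))// lerDl; exact: sumr_ge0.
Qed.

End fixed_mesh.

(** The Riemann sums of the difference quotients telescope to 0 along every line. *)
Lemma integral_partial_eq0 i : \int[mu]_(x in cube) g i x = 0.
Proof.
have [B hB] := gdiff_bounded i.
have := @riemann_cvg (fun n y => gdiff n i y / mesh n) (g i) B hB
  (fun x e _ e0 => gdiff_cvg i x e0).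
move=> /cvg_lim <- //.
rewrite (_ : (fun n => _) = fun=> 0); first by rewrite lim_cst.
apply/funext => n; apply: (@sum_grid_eq0 _ _ _ _ i [ffun=> ord0]) => k.
rewrite -mulr_suml -mulr_suml sum_gdiff_upf; ring.
Qed.

Hypothesis N2 : (2 <= N)%N.

(** By translation invariance the measure is a multiple of the volume; the constant
    corrects for that factor. *)
Definition gn_const : R := ((2 * M) ^+ N / fine (mu cube)) `^ (N.-1%:R^-1).

(** The limit of the discrete inequality along finer and finer grids. *)
Lemma gagliardo_nirenberg :
  \int[mu]_(x in cube) `|f x| `^ (N%:R / N.-1%:R) <=
  gn_const * \prod_i (\int[mu]_(x in cube) `|g i x|) `^ (N.-1%:R^-1).
Proof.
have N1 : (0 < N.-1)%N by rewrite -ltnS prednK// ltnW.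
have N1R : N.-1%:R != 0 :> R by rewrite pnatr_eq0 -lt0n.
set p := N%:R / N.-1%:R; set r := N.-1%:R^-1.
have r0 : 0 <= r by rewrite invr_ge0.
have p0 : p != 0 by rewrite mulf_neq0 ?invr_eq0// pnatr_eq0 -lt0n ltnW.
have pr : p = 1 + r.
  by rewrite /p /r -{1}(prednK (ltnW N2)) -natr1 mulrDl divff// mul1r.
pose A n := \sum_(k : {ffun 'I_N -> 'I_n.+1}) `|f (gridpt k)| `^ p * cellvol n.
pose D n i := \sum_(k : {ffun 'I_N -> 'I_n.+1}) `|gdiff n i (gridpt k) / mesh n| * cellvol n.
have p_ge0 : 0 <= p by rewrite pr addr_ge0.
have cfp : continuous (fun x => `|f x| `^ p).
  exact: continuous_powR_comp.
have cubeM (y : V) : cube y -> forall i, `|y ord0 i| <= M.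
  by move=> yC i; have /andP[? /ltW ?] := yC i; rewrite ler_norml; apply/andP.
have cvgA : A n @[n --> \oo] --> \int[mu]_(x in cube) `|f x| `^ p.
  have [B B0 hB] := bounded_on_box M cfp.
  apply: (@riemann_cvg (fun=> fun y => `|f y| `^ p) _ B).
    by move=> n y /cubeM yC; exact: hB.
  by move=> x e _ e0; exact: comp_grid_cvg.
have cvgD i : D n i @[n --> \oo] --> \int[mu]_(x in cube) `|g i x|.
  have [B hB] := gdiff_bounded i.
  apply: (@riemann_cvg (fun n y => `|gdiff n i y / mesh n|) _ B).
    by move=> n y yC; rewrite normr_id hB.
  move=> x e _ e0; move: (gdiff_cvg i x e0); apply: filterS => n h y /h.
  exact: le_trans (ler_dist_dist _ _).
have D0 n i : 0 <= D n i by apply: sumr_ge0 => k _; rewrite mulr_ge0// cellvol_ge0.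
(* The discrete inequality, with cellvol and mesh restored by homogeneity. *)
have AD n : A n <= gn_const * \prod_i D n i `^ r.
  have m0 := mesh_gt0 n.
  have [c0|c0] := eqVneq (cellvol n) 0.
    rewrite /A big1 ?mulr_ge0 ?powR_ge0 ?prodr_ge0// => [? _|k _]; first exact: powR_ge0.
    by rewrite c0 mulr0.
  have cgt0 : 0 < cellvol n by rewrite lt0r c0 cellvol_ge0.
  have x0 : {ffun 'I_N -> 'I_n.+1} := [ffun=> ord0].
  have := @discrete_gagliardo_nirenberg R N n.+1 N2 (fun k => f (gridpt k))
     (fun i k => gdiff n i (gridpt k)) x0 (fun i k => gridpt_le_gdiff k i).
  rewrite -/p -/r => dgn.
  rewrite /A -mulr_suml.
  have DE i : \sum_(k : {ffun 'I_N -> 'I_n.+1}) `|gdiff n i (gridpt k)| =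
      (mesh n / cellvol n) * D n i.
    rewrite /D -mulr_suml.
    under [in RHS]eq_bigr do rewrite normrM normfV (gtr0_norm m0).
    by rewrite -mulr_suml; field; rewrite c0 gt_eqF.
  apply: (@le_trans _ _ (cellvol n * \prod_(i < N) ((mesh n / cellvol n) * D n i) `^ r)).
    rewrite mulrC ler_wpM2l ?(ltW cgt0)//; apply: (le_trans dgn).
    by under eq_bigr do rewrite DE.
  have mc0 : 0 <= mesh n / cellvol n by rewrite divr_ge0// ltW.
  have -> : \prod_(i < N) (mesh n / cellvol n * D n i) `^ r =
      \prod_(i < N) ((mesh n / cellvol n) `^ r * D n i `^ r).
    by apply: eq_bigr => i _; rewrite powRM.
  rewrite big_split/= prodr_const card_ord mulrA ler_wpM2r//.
    by apply: prodr_ge0 => i _; exact: powR_ge0.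
  rewrite /gn_const -/r (cube_vol n) -[cellvol n *+ _]mulr_natr natrX.
  have -> : (2 * M) ^+ N / (cellvol n * n.+1%:R ^+ N) = mesh n ^+ N / cellvol n.
    rewrite -(meshE n) exprMn; set X := n.+1%:R ^+ N; set Y := mesh n ^+ N.
    have X0 : X != 0 by rewrite expf_neq0// pnatr_eq0.
    by field; rewrite c0 X0.
  rewrite -powR_mulrn ?powR_ge0// -powRrM.
  rewrite (_ : r * N%:R = 1 + r); last by rewrite mulrC.
  have mcn0 : mesh n / cellvol n != 0 by rewrite mulf_neq0 ?invr_eq0 ?c0 ?gt_eqF.
  rewrite powRD; last by rewrite mcn0 implybT.
  rewrite powRr1// mulrA [cellvol n * _]mulrC divfK//.
  have {1}-> : mesh n = (mesh n ^+ N.-1) `^ r.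
    by rewrite -powR_mulrn ?(ltW m0)// -powRrM mulfV// powRr1// ltW.
  rewrite -powRM ?exprn_ge0 ?(ltW m0)//.
  by rewrite mulrA -exprSr prednK// ltnW.
apply: (ler_cvg_to cvgA (_ : gn_const * \prod_i D n i `^ r @[n --> \oo] --> _)).
  apply: cvgM; first exact: cvg_cst.
  apply: cvg_big => [|i _]; first exact: mul_continuous.
  have : (fun t : R => `|t| `^ r) (D n i) @[n --> \oo] -->
      `|\int[mu]_(x in cube) `|g i x| | `^ r.
    by apply: (@continuous_cvg _ _ _ _ _ _ (fun t : R => `|t| `^ r));
      [exact: continuous_norm_powR|exact: cvgD].
  have I0 : 0 <= \int[mu]_(x in cube) `|g i x| by apply: Rintegral_ge0.
  rewrite (ger0_norm I0).
  by under eq_cvg do rewrite (ger0_norm (D0 _ _)).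
by apply: nearW => n; exact: AD.
Qed.

End riemann.

(** * Hoelder bounds for real integrals *)
Section almost_everywhere.
Context d (T : measurableType d) (R : realType) (mu : {measure set T -> \bar R}).
Implicit Types P Q S : T -> Prop.

Lemma ae_imply P Q : (forall x, P x -> Q x) ->
  {ae mu, forall x, P x} -> {ae mu, forall x, Q x}.
Proof. by move=> PQ; apply: filterS. Qed.

Lemma ae_imply2 P Q S : (forall x, P x -> Q x -> S x) ->
  {ae mu, forall x, P x} -> {ae mu, forall x, Q x} -> {ae mu, forall x, S x}.
Proof. by move=> PQS; apply: filterS2. Qed.

End almost_everywhere.

Section integral_tools.
Context d (T : measurableType d) (R : realType) (mu : {measure set T -> \bar R}).
Variable D : set T.
Hypothesis mD : measurable D.
Implicit Types f g : T -> R.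

Lemma EFin_Rintegral f : mu.-integrable D (EFin \o f) ->
  (\int[mu]_(x in D) (f x)%:E)%E = (\int[mu]_(x in D) f x)%:E.
Proof. by move=> intf; rewrite /Rintegral fineK//; exact: integrable_fin_num. Qed.

Lemma measurable_norm_powR f p : measurable_fun D f ->
  measurable_fun D (fun x => `|f x| `^ p).
Proof.
move=> mf.
apply: (@measurableT_comp _ _ _ _ _ _ (fun t : R => t `^ p)).
  exact: measurable_powR.
exact: measurableT_comp.
Qed.

Lemma Lnorm_restrict (h : T -> R) (r : R) : 0 < r ->
  ('N[mu]_r%:E[EFin \o h \_ D] = (\int[mu]_(x in D) (`|h x| `^ r)%:E) `^ (r^-1))%E.
Proof.
move=> r0; rewrite Lnorm.unlock; congr (_ `^ _)%E.
rewrite [RHS]integral_mkcond; apply: eq_integral => x _.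
by rewrite /patch /=; case: ifP => _ //=; rewrite normr0 powR0// gt_eqF.
Qed.

Lemma hoelder_on f g (p q : R) : measurable_fun D f -> measurable_fun D g ->
  0 < p -> 0 < q -> p^-1 + q^-1 = 1 ->
  (\int[mu]_(x in D) (`|f x * g x|)%:E <=
   (\int[mu]_(x in D) (`|f x| `^ p)%:E) `^ (p^-1) *
   (\int[mu]_(x in D) (`|g x| `^ q)%:E) `^ (q^-1))%E.
Proof.
move=> mf mg p0 q0 pq.
have mf' : measurable_fun setT (f \_ D) by apply/(measurable_restrict _ _ _).1 => //; rewrite setTI.
have mg' : measurable_fun setT (g \_ D) by apply/(measurable_restrict _ _ _).1 => //; rewrite setTI.
have E1 : ('N[mu]_1[EFin \o (f \_ D \* g \_ D)%R] = \int[mu]_(x in D) (`|f x * g x|)%:E)%E.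
  rewrite Lnorm1 [RHS]integral_mkcond; apply: eq_integral => x _.
  by rewrite /patch /=; case: ifP => _ //=; rewrite mulr0 normr0.
by have := hoelder mu mf' mg' p0 q0 pq; rewrite E1 !Lnorm_restrict.
Qed.

Lemma hoelder_Rintegral f g (p q : R) : measurable_fun D f -> measurable_fun D g ->
  0 < p -> 0 < q -> p^-1 + q^-1 = 1 ->
  mu.-integrable D (EFin \o (fun x => `|f x| `^ p)) ->
  mu.-integrable D (EFin \o (fun x => `|g x| `^ q)) ->
  mu.-integrable D (EFin \o (fun x => f x * g x)) /\
  \int[mu]_(x in D) `|f x * g x| <=
   (\int[mu]_(x in D) (`|f x| `^ p)) `^ (p^-1) *
   (\int[mu]_(x in D) (`|g x| `^ q)) `^ (q^-1).
Proof.
move=> mf mg p0 q0 pq intf intg.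
have := hoelder_on mf mg p0 q0 pq.
rewrite (EFin_Rintegral intf) (EFin_Rintegral intg) !poweR_EFin -EFinM => h.
have intfg : mu.-integrable D (EFin \o (fun x => f x * g x)).
  apply/integrableP; split; first exact/measurable_EFinP/measurable_funM.
  by apply: (le_lt_trans h); rewrite ltry.
split => //; rewrite -lee_fin -EFin_Rintegral//.
exact: (integrable_abse intfg).
Qed.

End integral_tools.

Section signed_power.
Variable R : realType.

(** |t|^(c - 1) t, the odd version of the power t^c. *)
Definition spow (c t : R) : R := t * `|t| `^ (c - 1).

Lemma norm_spow c t : 0 < c -> `|spow c t| = `|t| `^ c.
Proof.
move=> c0; rewrite /spow normrM (ger0_norm (powR_ge0 _ _)).
have [->|t0] := eqVneq t 0; first by rewrite normr0 mul0r powR0 ?gt_eqF.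
rewrite -{1}(@powRr1 _ `|t|)// -powRD; last by rewrite normr_eq0 t0 implybT.
by congr (_ `^ _); ring.
Qed.

(** At 0 the difference quotient is |h|^(c - 1), constant for c = 1 and tending to 0
    for c > 1. *)
Lemma is_derive_spow c (t : R) : 1 <= c -> is_derive t 1 (spow c) (c * `|t| `^ (c - 1)).
Proof.
move=> c1; have c10 : 0 <= c - 1 by rewrite subr_ge0.
have c0 : 0 < c by exact: lt_le_trans c1.
have pos (s : R) : 0 < s -> is_derive s 1 (spow c) (c * `|s| `^ (c - 1)).
  move=> s0.
  have H : \near s, s `^ c = spow c s.
    near=> z; have z0 : 0 < z by near: z; exact: lt_nbhsr.
    rewrite /spow gtr0_norm// -{2}(@powRr1 _ z) ?ltW// -powRD; last by rewrite (gt_eqF z0) implybT.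
    by congr (_ `^ _); ring.
  by apply: (near_eq_is_derive H); rewrite gtr0_norm//; exact: is_derive1_powR.
have [t0|t0|->] := ltgtP t 0; [|exact: pos|].
  have -> : spow c = - (fun s => spow c (- s)).
    by apply/funext => s; rewrite fctE /spow normrN mulNr opprK.
  have nt0 : 0 < - t by rewrite oppr_gt0.
  have d2 := is_derive_scalar_comp (pos _ nt0) (is_deriveNid t (1 : R)).
  have := is_deriveN d2.
  by rewrite normrN mulrN1 opprK.
suff H : h^-1 *: ((spow c \o shift 0) (h *: 1) - spow c 0) @[h --> (0:R)^'] --> c * `|0 : R| `^ (c - 1).
  by apply: DeriveDef; [apply/cvg_ex; exists (c * `|0 : R| `^ (c - 1))|apply/cvg_lim].
have E : c * `|0 : R| `^ (c - 1) = `|0 : R| `^ (c - 1).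
  rewrite normr0; have [->|cn] := eqVneq c 1; first by rewrite mul1r.
  by rewrite powR0 ?mulr0// subr_eq0.
rewrite E.
have ch : {for (0 : R), continuous (fun t : R => `|t| `^ (c - 1))}.
  exact: continuous_norm_powR.
have c0' := (continuous_withinNx _ _).1 ch.
apply: cvg_trans c0'; apply: near_eq_cvg; near=> h.
have h0 : h != 0 by near: h; exact: nbhs_dnbhs_neq.
by rewrite /= /spow addr0 [h%:A]mulr1 mul0r subr0 -[_ *: _]/(_ * _) mulrA mulVf// mul1r.
Unshelve. all: by end_near. Qed.

End signed_power.

(** * The Sobolev inequality *)
Section sobolev.
Variables (R : realType) (N : nat) (M al : R).
Hypothesis M0 : 0 < M.
Hypothesis N2 : (2 <= N)%N.
Hypothesis al1 : 1 <= al.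
Hypothesis alN : al < N%:R.
Local Notation V := 'rV[R]_N.
Local Notation mu := (leb R N).
Local Notation T := (lebT R N).
Local Notation e_ i := (delta_mx ord0 i : V).
Local Notation C := (@cube R N M).

Definition sob_exp : R := al * N%:R / (N%:R - al).

Definition sob_const : R :=
  let ga := al * N.-1%:R / (N%:R - al) in
  (gn_const N M * ga `^ (N%:R / N.-1%:R)) `^ (al * N.-1%:R / N%:R).

Lemma integrable_continuous_cube (F : V -> R) : continuous F ->
  mu.-integrable C (EFin \o F).
Proof.
move=> cF; have [B B0 hB] := bounded_on_box M cF.
apply: (@integrable_bounded _ _ _ _ B); first exact: continuous_leb_measurable.
move=> x xC; apply: hB => i; have /andP[? /ltW ?] := xC i.
by rewrite ler_norml; apply/andP.
Qed.

(** Apply the Gagliardo-Nirenberg inequality to |f|^(ga - 1) f, whose derivative is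
    ga |f|^(ga - 1) grad f, with ga chosen such that ga N / (N - 1) is the Sobolev
    exponent.  Hoelder with exponent al returns a power of the left side, which is
    divided out. *)
Lemma sobolev (f : V -> R) (g : 'I_N -> V -> R) :
  continuous f -> (forall i, continuous (g i)) ->
  (forall i x, is_derive x (e_ i) f (g i x)) ->
  (forall (x : V) i, M <= `|x ord0 i| -> f x = 0) ->
  (\int[mu]_(x in C) `|f x| `^ sob_exp) `^ ((N%:R - al) / N%:R) <=
  sob_const * \sum_i \int[mu]_(x in C) `|g i x| `^ al.
Proof.
move=> cf cg df f0.
have mC : measurable (C : set T) by exact: cube_measurable.
have N0 : 0 < N%:R :> R by rewrite ltr0n ltnW.
have N1 : 0 < N.-1%:R :> R by rewrite ltr0n -ltnS prednK// ltnW.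
have NE : N%:R = N.-1%:R + 1 :> R by rewrite natr1 prednK// ltnW.
have al0 : 0 < al by exact: lt_le_trans al1.
have Na : 0 < N%:R - al by rewrite subr_gt0.
pose ga := al * N.-1%:R / (N%:R - al).
have ga1 : 1 <= ga.
  rewrite /ga ler_pdivlMr// mul1r NE.
  apply: (@le_trans _ _ N.-1%:R); last by rewrite ler_peMl// ltW.
  by rewrite -addrA gerDl subr_le0.
have ga0 : 0 < ga by exact: lt_le_trans ga1.
pose p1 : R := N%:R / N.-1%:R.
have gap : ga * p1 = sob_exp.
  by rewrite /ga /p1 /sob_exp; field; rewrite !gt_eqF.
have se0 : 0 < sob_exp by rewrite -gap mulr_gt0// divr_gt0.
pose X := \int[mu]_(x in C) `|f x| `^ sob_exp.
pose Y := \sum_i \int[mu]_(x in C) `|g i x| `^ al.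
have X0 : 0 <= X by apply: Rintegral_ge0 => x _; exact: powR_ge0.
have Y0 : 0 <= Y.
  by apply: sumr_ge0 => i _; apply: Rintegral_ge0 => x _; exact: powR_ge0.
have cmul (h k : V -> R) : continuous h -> continuous k -> continuous (fun x => h x * k x).
  by move=> ch ck x; exact: (cvgM (ch x) (ck x)).
have ga10 : 0 <= ga - 1 by rewrite subr_ge0.
pose G i x := ga * `|f x| `^ (ga - 1) * g i x.
have cfg i : continuous (fun x => `|f x| `^ (ga - 1) * g i x).
  by apply: cmul => //; exact: continuous_powR_comp.
have cF : continuous (fun x => spow ga (f x)) by apply: cmul => //; exact: continuous_powR_comp.
have cG i : continuous (G i).
  apply: (cmul _ _ _ (cg i)); apply: (cmul _ _ _ (continuous_powR_comp ga10 cf)).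
  exact: cst_continuous.
have dF i x : is_derive x (e_ i) (fun x => spow ga (f x)) (G i x).
  by apply: is_derive_scalar_comp; exact: is_derive_spow.
have F0 (x : V) i : M <= `|x ord0 i| -> spow ga (f x) = 0.
  by move=> /f0; rewrite /spow => ->; rewrite mul0r.
have := gagliardo_nirenberg M0 cF cG dF F0 N2.
rewrite -/p1.
have -> : \int[mu]_(x in C) `|spow ga (f x)| `^ p1 = X.
  by apply: eq_Rintegral => x _; rewrite norm_spow// -powRrM gap.
pose r : R := N.-1%:R^-1.
have r0 : 0 <= r by rewrite invr_ge0.
have bG i : \int[mu]_(x in C) `|G i x| <= ga * (X `^ (1 - al^-1) * Y `^ (al^-1)).
  have -> : \int[mu]_(x in C) `|G i x| =
      ga * \int[mu]_(x in C) `| `|f x| `^ (ga - 1) * g i x|.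
    rewrite -RintegralZl//.
      by apply: eq_Rintegral => x _; rewrite /G -mulrA normrM gtr0_norm.
    exact: (integrable_abse (integrable_continuous_cube (cfg i))).
  rewrite ler_pM2l//.
  have Yi : \int[mu]_(x in C) `|g i x| `^ al <= Y.
    rewrite /Y (bigD1 i)//= lerDl; apply: sumr_ge0 => j _.
    by apply: Rintegral_ge0 => x _; exact: powR_ge0.
  have Yi0 : 0 <= \int[mu]_(x in C) `|g i x| `^ al.
    by apply: Rintegral_ge0 => x _; exact: powR_ge0.
  have alV0 : 0 <= al^-1 by rewrite invr_ge0 ltW.
  (* For al = 1 the conjugate exponent is infinite, but then ga = 1. *)
  have [a1|an1] := eqVneq al 1.
    have gaE : ga = 1.
      by rewrite /ga a1 mul1r -[N%:R - 1](_ : N.-1%:R = _) ?divff ?gt_eqF// NE addrK.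
    rewrite a1 invr1 subrr powRr0 mul1r powRr1//; rewrite a1 in Yi.
    apply: le_trans Yi; rewrite le_eqVlt; apply/orP; left; apply/eqP.
    by apply: eq_Rintegral => x _; rewrite gaE subrr powRr0 mul1r powRr1.
  have al1' : 1 < al by rewrite lt_neqAle eq_sym an1.
  pose q := al / (al - 1).
  have a1n : al - 1 != 0 by rewrite subr_eq0.
  have a1p : 0 < al - 1 by rewrite subr_gt0.
  have q0 : 0 < q by rewrite divr_gt0.
  have qV : q^-1 = 1 - al^-1 by rewrite /q; field; rewrite a1n gt_eqF.
  have fq x : `| `|f x| `^ (ga - 1)| `^ q = `|f x| `^ sob_exp.
    rewrite ger0_norm ?powR_ge0// -powRrM; congr (_ `^ _).
    rewrite /ga /q /sob_exp NE; have := Na; rewrite NE => Na'.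
    by field; rewrite a1n gt_eqF.
  have := @hoelder_Rintegral _ T R mu C mC (fun x => `|f x| `^ (ga - 1)) (g i) q al.
  have mf : measurable_fun (C : set T) (fun x => `|f x| `^ (ga - 1)).
    by apply: continuous_leb_measurable; exact: continuous_powR_comp.
  have mg : measurable_fun (C : set T) (g i) by exact: continuous_leb_measurable.
  move=> /(_ mf mg q0 al0); rewrite qV subrK => /(_ erefl).
  case.
  - have := integrable_continuous_cube (continuous_powR_comp (ltW se0) cf).
    by congr (integrable _ _ _); apply/funext => x; rewrite /= fq.
  - by apply: integrable_continuous_cube; apply: continuous_powR_comp => //; exact: ltW.
  move=> _ /le_trans; apply.
  rewrite (_ : \int[mu]_(x in C) _ `^ q = X); last by apply: eq_Rintegral => x _; rewrite fq.
  by rewrite ler_wpM2l ?powR_ge0//; exact: ler_powR2r.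
move=> XGN.
have {XGN} : X <= (gn_const N M) * (ga * (X `^ (1 - al^-1) * Y `^ al^-1)) `^ p1.
  apply: (le_trans XGN); rewrite ler_wpM2l ?powR_ge0//.
  rewrite (_ : p1 = r * N%:R); last by rewrite mulrC.
  rewrite powRrM powR_mulrn ?powR_ge0// -[in X in _ <= _ ^+ X](card_ord N) -prodr_const.
  apply: ler_prod => i _; rewrite powR_ge0/=; apply: ler_powR2r => //.
  by apply: Rintegral_ge0 => x _; exact: normr_ge0.
rewrite -/X -/Y.
(* Dividing by a power of X is possible unless X = 0. *)
have [->|Xn0] := eqVneq X 0.
  move=> _; rewrite powR0; first by rewrite mulr_ge0// powR_ge0.
  by rewrite mulf_neq0 ?invr_eq0 ?gt_eqF.
have Xp : 0 < X by rewrite lt0r Xn0.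
set A := (gn_const N M) * ga `^ p1.
have K0 : 0 <= (gn_const N M) by exact: powR_ge0.
have A0 : 0 <= A by rewrite mulr_ge0// powR_ge0.
pose s := al * N.-1%:R / N%:R.
have s0 : 0 <= s by rewrite !mulr_ge0 ?invr_ge0 ?(ltW N0) ?(ltW al0) ?(ltW N1).
have p1s : p1 * s = al by rewrite /p1 /s; field; rewrite !gt_eqF.
rewrite powRM ?(ltW ga0) ?mulr_ge0 ?powR_ge0// mulrA -/A => Xle.
have := ler_powR2r s0 X0 Xle.
rewrite powRM ?powR_ge0// -[A `^ s]/sob_const -powRrM p1s.
rewrite powRM ?powR_ge0// -!powRrM mulVf ?gt_eqF// powRr1// mulrBl mul1r mulVf ?gt_eqF//.
move=> h.
have Xpos : 0 < X `^ (al - 1) by rewrite powR_gt0.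
rewrite -(ler_pM2r Xpos) -powRD; last by rewrite Xn0 implybT.
rewrite (_ : _ + _ = s).
  by apply: (le_trans h); rewrite -mulrA ler_wpM2l ?powR_ge0// mulrC.
by rewrite /s NE; field; rewrite -NE gt_eqF.
Qed.
End sobolev.

(** * Energy density and coercivity *)
Section nfunction.
Variables (R : realType) (phi : R -> R).
Hypothesis hphi : C1 phi.
Hypothesis hphi2 : cond_phi2 phi.
Local Notation Phi := (Phi_of phi).
Local Notation lam := (@lebesgue_measure R).

Definition flux_fun (t : R) : R := t * phi t.
Local Notation p := flux_fun.

Definition energy (t : R) : R := `|t| * flux_fun `|t|.
Local Notation B := energy.

Lemma continuous_phi : continuous phi.
Proof. by move=> t; apply/differentiable_continuous/derivable1_diffP; exact: (hphi.1 t). Qed.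

Lemma continuous_flux : continuous p.
Proof. by move=> t; exact: (cvgM cvg_id (@continuous_phi t)). Qed.

Lemma flux0 : p 0 = 0. Proof. by rewrite /flux_fun mul0r. Qed.

Lemma flux_gt0 t : 0 < t -> 0 < p t.
Proof.
move=> t0.
have t20 : 0 < t / 2 by rewrite divr_gt0.
have lt2 : p (t / 2) < p t by apply: hphi2 => //; lra.
apply: le_lt_trans lt2.
have c0 := @continuous_flux 0; rewrite /continuous_at flux0 in c0.
have cr : p s @[s --> (0:R)^'+] --> (0 : R) by exact: cvg_at_right_filter c0.
apply: (cvgr_to_le cr); near=> s.
have s0 : 0 < s by near: s; exact: nbhs_right_gt.
have st : s < t / 2 by near: s; exact: nbhs_right_lt.
exact/ltW/hphi2.
Unshelve. all: by end_near. Qed.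

Lemma flux_ge0 t : 0 <= t -> 0 <= p t.
Proof.
by rewrite le_eqVlt => /orP[/eqP <-|/flux_gt0/ltW//]; rewrite flux0.
Qed.

Lemma flux_mono s t : 0 <= s -> s <= t -> p s <= p t.
Proof.
move=> s0; rewrite le_eqVlt => /orP[/eqP ->//|st].
move: s0; rewrite le_eqVlt => /orP[/eqP s0|s0]; last exact/ltW/hphi2.
by rewrite -s0 flux0 flux_ge0// s0 ltW.
Qed.

Lemma energy_ge0 t : 0 <= B t.
Proof. by rewrite mulr_ge0// flux_ge0. Qed.

Lemma continuous_energy : continuous B.
Proof.
move=> t; apply: cvgM; first exact: norm_continuous.
apply: (@continuous_comp _ _ _ (fun t : R => `|t|) p); first exact: norm_continuous.
exact: continuous_flux.
Qed.

Lemma energy_mono s t : `|s| <= `|t| -> B s <= B t.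
Proof. by move=> st; apply: ler_pM => //; [exact: flux_ge0|exact: flux_mono]. Qed.

(** Shrinking the argument by c gains the factor c; this replaces homogeneity. *)
Lemma energyZ c t : 0 <= c <= 1 -> B (c * t) <= c * B t.
Proof.
move=> /andP[c0 c1]; rewrite /energy normrM (ger0_norm c0) -mulrA ler_wpM2l//.
by rewrite ler_wpM2l//; apply: flux_mono; rewrite ?mulr_ge0// ler_piMl.
Qed.

Lemma energy_eq0_cvg (s : nat -> R) :
  B (s n) @[n --> \oo] --> (0 : R) -> s n @[n --> \oo] --> (0 : R).
Proof.
move=> Bs; apply/cvgr0Pnorm_lt => e e0.
have Be : 0 < B e by rewrite mulr_gt0 ?normr_gt0 ?gt_eqF// flux_gt0// normr_gt0 gt_eqF.
move/cvgr0Pnorm_lt : Bs => /(_ _ Be); apply: filterS => n h.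
rewrite ltNge; apply/negP => es; move: h; apply/negP; rewrite -leNgt.
by rewrite ger0_norm ?energy_ge0//; apply: energy_mono; rewrite gtr0_norm.
Qed.

(** A substitute for the Young inequality: replace the smaller argument by the
    larger one. *)
Lemma flux_mul_le s t : 0 <= s -> 0 <= t -> p s * t <= B s + B t.
Proof.
move=> s0 t0; rewrite /energy !ger0_norm//.
have [st|ts] := leP s t.
  rewrite mulrC (le_trans (_ : _ <= t * p t))//; last by rewrite lerDr mulr_ge0// flux_ge0.
  by rewrite ler_wpM2l//; exact: flux_mono.
rewrite mulrC (le_trans (_ : _ <= s * p s))//; last by rewrite lerDl mulr_ge0// flux_ge0.
by rewrite ler_wpM2r ?flux_ge0// ltW.
Qed.

Lemma flux_integrable a b : lam.-integrable `[a, b] (EFin \o p).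
Proof.
apply: continuous_compact_integrable; first exact: segment_compact.
exact/continuous_subspaceT/continuous_flux.
Qed.

Lemma flux_integral_subset a b d : `[a, b] `<=` `[0, d] ->
  \int[lam]_(s in `[a, b]) p s <= \int[lam]_(s in `[0, d]) p s.
Proof.
move=> sub; rewrite /Rintegral fine_le//.
- by apply: integrable_fin_num => //; exact: flux_integrable.
- by apply: integrable_fin_num => //; exact: flux_integrable.
apply: ge0_subset_integral => //=.
- by apply: measurable_int; exact: flux_integrable.
- by move=> x; rewrite in_itv/= lee_fin => /andP[x0 _]; exact: flux_ge0.
Qed.

Lemma Phi_norm t : Phi `|t| = Phi t.
Proof. by rewrite /Phi_of normr_id. Qed.

Lemma Phi_mono s t : `|s| <= `|t| -> Phi s <= Phi t.
Proof.
by move=> st; apply: flux_integral_subset; apply: subset_itvl; rewrite bnd_simp.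
Qed.

Lemma Phi_ge0 t : 0 <= Phi t.
Proof.
apply: Rintegral_ge0 => x /=; rewrite in_itv/= => /andP[x0 _]; exact: flux_ge0.
Qed.

Lemma Phi0 : Phi 0 = 0.
Proof. by rewrite /Phi_of normr0 set_itv1 Rintegral_set1. Qed.

Lemma Phi_measurable : measurable_fun setT Phi.
Proof.
rewrite (_ : Phi = (fun s => Phi (Num.max 0 s)) \o Num.norm); last first.
  by apply/funext => t /=; rewrite (max_idPr _)// Phi_norm.
apply: measurableT_comp => //.
apply: nondecreasing_measurable => // s t st.
apply: Phi_mono; rewrite !ger0_norm ?(le_max 0) ?lexx//.
by rewrite ge_max !le_max lexx st orbT.
Qed.

Lemma Rintegral_cst_itv (a b c : R) : a <= b ->
  \int[lam]_(s in `[a, b]) (cst c) s = c * (b - a).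
Proof.
move=> ab; rewrite Rintegral_cst//; congr (_ * _).
have E : lebesgue_measure (`[a, b]%classic : set R) = (b - a)%:E.
  rewrite lebesgue_measure_itv/= lte_fin; case: ltP => // ba.
  by rewrite (_ : b - a = 0)//; apply/eqP; rewrite subr_eq0 eq_le ba.
exact: (congr1 fine E).
Qed.

Lemma Phi_le_energy t : Phi t <= B t.
Proof.
rewrite /Phi_of /energy.
have : \int[lam]_(s in `[0, `|t|]) p s <= \int[lam]_(s in `[0, `|t|]) (cst (p `|t|)) s.
  apply: le_Rintegral => //.
  - exact: flux_integrable.
  - by apply: continuous_compact_integrable; [exact: segment_compact|exact/continuous_subspaceT/cst_continuous].
  - by move=> s /=; rewrite in_itv/= => /andP[s0 st]; exact: flux_mono.
by rewrite Rintegral_cst_itv// subr0 mulrC.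
Qed.

(** The integral of p over [t, 2 t] alone is at least t p t. *)
Lemma energy_le_Phi2 t : B t <= Phi (2 * t).
Proof.
rewrite /Phi_of /energy normrM (ger0_norm (ler0n _ 2)).
have y0 := normr_ge0 t; move: `|t| y0 => y y0.
have : \int[lam]_(s in `[y, 2 * y]) (cst (p y)) s <= \int[lam]_(s in `[y, 2 * y]) p s.
  apply: le_Rintegral => //.
  - by apply: continuous_compact_integrable; [exact: segment_compact|exact/continuous_subspaceT/cst_continuous].
  - exact: flux_integrable.
  - by move=> s /=; rewrite in_itv/= => /andP[s0 st]; exact: flux_mono.
rewrite Rintegral_cst_itv; last by lra.
rewrite (_ : p y * _ = y * p y); last by ring.
move=> /le_trans; apply.
by apply: flux_integral_subset; apply: subset_itvr; rewrite bnd_simp.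
Qed.

Lemma coercive_of_equiv m : 1 <= m -> Nfun_equiv Phi (fun t => `|t| `^ m) ->
  exists c0 C0 : R, [/\ 0 < c0, 0 <= C0 & forall t, c0 * `|t| `^ m <= B t + C0].
Proof.
move=> m1 [c1 [c2 [t0 [c10 _ t00 h]]]].
exists c1, (c1 * t0 `^ m); split => //; first by rewrite mulr_ge0 ?powR_ge0// ltW.
move=> t; have [tt|tt] := leP t0 `|t|.
  have /andP[+ _] := h _ tt; rewrite normr_id => h1.
  apply: (le_trans h1); rewrite Phi_norm (le_trans (Phi_le_energy t))// lerDl.
  by rewrite mulr_ge0 ?powR_ge0// ltW.
rewrite (@le_trans _ _ (c1 * t0 `^ m))//; last by rewrite lerDr energy_ge0.
rewrite ler_pM2l//; apply: ler_powR2r => //; last exact: ltW.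
exact: le_trans ler01 m1.
Qed.

(** The lower bound in the index condition says that t^(1 - l) p t has a nonnegative
    derivative, so p t >= p 1 t^(l - 1) for t >= 1. *)
Lemma coercive_of_lower_index N l m : cond_phi3 N l m phi ->
  exists c0 C0 : R, [/\ 0 < c0, 0 <= C0 & forall t, c0 * `|t| `^ l <= B t + C0].
Proof.
move=> [/andP[l1 _] _ _ h].
have phi_gt0 (t : R) : 0 < t -> 0 < phi t.
  by move=> t0; have := flux_gt0 t0; rewrite /flux_fun pmulr_rgt0.
have dp (t : R) : is_derive t 1 p (derive1 p t).
  apply: DeriveDef; last by rewrite derive1E.
  by apply: derivableM => //; exact: (hphi.1 t).
pose q t := p t * t `^ (1 - l).
have dq (t : R) : 0 < t -> is_derive t 1 q ((derive1 p t - (l - 1) * phi t) * t `^ (1 - l)).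
  move=> t0.
  apply: (is_derive_eq (is_deriveM (dp t) (is_derive1_powR (1 - l) t0))).
  rewrite -![_ *: _]/(_ * _).
  have -> : t `^ (1 - l) = t * t `^ (1 - l - 1).
    rewrite -{2}(@powRr1 _ t) ?ltW// -powRD; last by rewrite (gt_eqF t0) implybT.
    by congr (_ `^ _); ring.
  by rewrite /flux_fun; ring.
have qmono (t : R) : 1 <= t -> q 1 <= q t.
  move=> t1.
  have dqi x : x \in `]1, t[ -> is_derive x 1 q ((derive1 p x - (l - 1) * phi x) * x `^ (1 - l)).
    by rewrite in_itv/= => /andP[x1 _]; apply: dq; exact: lt_trans x1.
  apply: (@ger0_derive1_le_cc _ q 1 t).
  - by move=> x /dqi [].
  - move=> x xi; have [_] := dqi x xi; rewrite -derive1E => ->.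
    move: xi; rewrite in_itv/= => /andP[x1 _].
    have x0 : 0 < x by exact: lt_trans x1.
    rewrite mulr_ge0 ?powR_ge0// subr_ge0.
    by have /andP[+ _] := h x x0; rewrite ler_pdivlMr// phi_gt0.
  - apply: continuous_in_subspaceT => x /set_mem /=; rewrite in_itv/= => /andP[x1 _].
    exact: is_derive1_continuous (dq x (lt_le_trans ltr01 x1)).
  - by rewrite in_itv/= lexx.
  - by rewrite in_itv/= t1 lexx.
  - exact: t1.
have p1 : 0 < p 1 by exact: flux_gt0.
(* For |t| <= 1 the additive constant p 1 alone suffices. *)
exists (p 1), (p 1); split => //; first exact: ltW.
move=> t; have [t1|t1] := leP 1 `|t|; last first.
  rewrite (@le_trans _ _ (p 1))//; last by rewrite lerDr energy_ge0.
  rewrite -[leRHS]mulr1 ler_pM2l// -[leRHS](congr1 (fun f => f l) (@powR1 R)); apply: ler_powR2r => //; last exact: ltW.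
  exact: le_trans l1.
rewrite (@le_trans _ _ (B t))//; last by rewrite lerDl ltW.
have t0 : 0 < `|t| by exact: lt_le_trans t1.
have := qmono _ t1; rewrite /q powR1 mulr1 => hq.
apply: (le_trans (ler_wpM2r (powR_ge0 _ _) hq)).
rewrite -mulrA -powRD; last by rewrite (gt_eqF t0) implybT.
by rewrite subrK powRr1// mulrC /energy.
Qed.

End nfunction.

(** * Test functions and weak derivatives *)
Section test_functions.
Variables (R : realType) (N : nat) (M : R).
Hypothesis M0 : 0 < M.
Local Notation V := 'rV[R]_N.
Local Notation mu := (leb R N).
Local Notation T := (lebT R N).
Local Notation e_ i := (delta_mx ord0 i : V).
Variable Omega : set V.
Hypothesis oO : open Omega.
Hypothesis OM : forall x, Omega x -> forall i, `|x ord0 i| < M.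

Definition pder i (f : V -> R) : V -> R := fun x => 'D_(e_ i) f x.

Lemma Omega_measurable : measurable (Omega : set T).
Proof. exact: open_leb_measurable. Qed.

Lemma Omega_sub_cube : Omega `<=` cube M.
Proof. by move=> x /OM xM i; have := xM i; rewrite ltr_norml => /andP[/ltW -> ->]. Qed.

Lemma Omega_fin : (mu Omega < +oo)%E.
Proof.
by apply: (le_lt_trans _ (cube_fin N M)); exact/le_outer_measure/Omega_sub_cube.
Qed.

Lemma integrable_continuous (f : V -> R) : continuous f ->
  mu.-integrable Omega (EFin \o f).
Proof.
move=> cf; have mC := @cube_measurable R N M.
have iC : mu.-integrable (cube M) (EFin \o f) by exact: integrable_continuous_cube.
exact: (integrableS mC Omega_measurable Omega_sub_cube iC).
Qed.

Lemma Rintegral_Omega_cube (f : V -> R) : (forall x, ~ Omega x -> f x = 0) ->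
  \int[mu]_(x in Omega) f x = \int[mu]_(x in cube M) f x.
Proof.
move=> f0; rewrite /Rintegral integral_mkcond [in RHS]integral_mkcond.
congr (fine (integral _ _ _)); apply/funext => x; rewrite /patch.
have [xO|xO] := pselect (Omega x).
  by rewrite !mem_set//; exact: Omega_sub_cube.
by rewrite memNset// f0//; case: ifP.
Qed.

Lemma test_eq0 psi x : test_function Omega psi -> ~ Omega x -> psi x = 0.
Proof.
move=> [_ _ sub] nO; apply/eqP; rewrite -[_ == _]negbK; apply/negP => px.
by apply: nO; apply: sub; exact: subset_closure.
Qed.

Lemma test_smooth_expr psi : test_function Omega psi -> smooth_expr psi.
Proof. by move=> [/SmoothBase]. Qed.

Lemma smooth_continuous (f : V -> R) : smooth_expr f -> continuous f.
Proof. by move=> /smooth_expr_step[]. Qed.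

Lemma smooth_derivable (f : V -> R) i x : smooth_expr f -> derivable f x (e_ i).
Proof. by move=> /smooth_expr_step[_ /(_ i) []]. Qed.

Lemma smooth_pder (f : V -> R) i : smooth_expr f -> smooth_expr (pder i f).
Proof. by move=> /smooth_expr_step[_ /(_ i) []]. Qed.

(** Smoothness comes from the syntactic class, compactness of the support from psi. *)
Lemma test_of_support psi f : test_function Omega psi -> smooth_expr f ->
  [set x | f x != 0] `<=` closure [set x | psi x != 0] -> test_function Omega f.
Proof.
move=> [_ cpsi psiO] sf fpsi.
have sub : closure [set x | f x != 0] `<=` closure [set x | psi x != 0].
  by apply: (subset_trans (closureS fpsi)) => x; exact: closed_closure.
split; first exact: smooth_expr_smooth.
  exact: (subclosed_compact (@closed_closure _ _) cpsi sub).
exact: subset_trans sub psiO.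
Qed.

Lemma test_comp psi f : test_function Omega psi -> smooth_expr f ->
  (forall x, psi x = 0 -> f x = 0) -> test_function Omega f.
Proof.
move=> tpsi sf f0; apply: (test_of_support tpsi sf) => x /= fx.
by apply: subset_closure => /=; apply: contra_neq fx => /f0.
Qed.

Lemma test_pder psi i : test_function Omega psi -> test_function Omega (pder i psi).
Proof.
move=> tpsi; apply: (test_of_support tpsi); first exact/smooth_pder/test_smooth_expr.
move=> x /= dx; apply: contrapT => ncl; move/eqP: dx; apply.
have : open (~` closure [set x | psi x != 0]) by rewrite openC; exact: closed_closure.
rewrite openE => /(_ _ ncl) near0.
rewrite /pder (@near_eq_derive _ _ _ _ (cst 0)) ?derive_cst//.
move: near0; apply: filterS => y /= ny.
by apply/eqP; rewrite -[_ == _]negbK; apply/negP => py; apply: ny; exact: subset_closure.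
Qed.

Lemma integral_pder_test psi i : test_function Omega psi ->
  \int[mu]_(x in Omega) pder i psi x = 0.
Proof.
move=> tpsi; have sp := test_smooth_expr tpsi.
rewrite Rintegral_Omega_cube; last by move=> x; exact: (test_eq0 (test_pder i tpsi)).
apply: (@integral_partial_eq0 _ _ _ M0 psi (fun i => pder i psi)).
- by move=> j; exact/smooth_continuous/smooth_pder.
- by move=> j x; apply: derivableP; exact: smooth_derivable.
- move=> x j Mx; apply: (test_eq0 tpsi) => /OM /(_ j).
  by rewrite ltNge Mx.
Qed.

Lemma integrable_loc_mul v psi : loc_integrable Omega v -> test_function Omega psi ->
  mu.-integrable Omega (EFin \o (fun x => v x * psi x)).
Proof.
move=> lv tpsi; have [_ cK KO] := tpsi.
set K := closure _ in cK KO.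
have cpsi := smooth_continuous (test_smooth_expr tpsi).
have mK : measurable (K : set T) by apply: closed_leb_measurable; exact: closed_closure.
have mO := Omega_measurable.
have [B B0 hB] := bounded_on_box M cpsi.
have iK : mu.-integrable K (EFin \o v) by exact: lv.
have iK2 : mu.-integrable K (EFin \o (fun x => v x * psi x)).
  have iBv : mu.-integrable K (fun x => (B%:E * (v x)%:E)%E) by exact: integrableZl.
  apply: (le_integrable mK _ _ iBv).
    apply/measurable_EFinP; apply: measurable_funM.
      by apply/measurable_EFinP; exact: measurable_int iK.
    exact: continuous_leb_measurable.
  move=> x xK /=; rewrite lee_fin !normrM mulrC ler_wpM2r// (ger0_norm B0).
  by apply: hB => i; apply/ltW/OM/KO.
have h1 := (integrable_mkcond (EFin \o (fun x : T => v x * psi x)) mK).1 iK2.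
apply/(integrable_mkcond _ mO).
move: h1; congr (integrable _ _ _); apply/funext => x; rewrite /patch /=.
have [xK|xK] := pselect (K x); first by rewrite !mem_set//; exact: KO.
rewrite memNset//; case: ifP => // _.
suff -> : psi x = 0 by rewrite mulr0.
apply/eqP; rewrite -[_ == _]negbK; apply/negP => px.
by apply: xK; exact: subset_closure.
Qed.

Lemma compact_leb_measurable (K : set V) : compact K -> measurable (K : set T).
Proof.
by move=> cK; apply: closed_leb_measurable; apply: compact_closed => //; exact: norm_hausdorff.
Qed.

Lemma continuous_loc_integrable f : continuous f -> loc_integrable Omega f.
Proof.
move=> cf K cK KO.
have mK : measurable (K : set T).
  exact: compact_leb_measurable.
exact: (integrableS Omega_measurable mK KO (integrable_continuous cf)).
Qed.

Lemma weak_partial_test psi i : test_function Omega psi ->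
  is_weak_partial Omega i psi (pder i psi).
Proof.
move=> tpsi; have sp := test_smooth_expr tpsi.
split.
- exact/continuous_loc_integrable/smooth_continuous.
- exact/continuous_loc_integrable/smooth_continuous/smooth_pder.
move=> eta teta; have se := test_smooth_expr teta.
have tpe : test_function Omega (fun x => psi x * eta x).
  by apply: (test_comp tpsi); [exact: SmoothMul|move=> x ->; rewrite mul0r].
have := integral_pder_test i tpe.
under eq_Rintegral => x _.
  rewrite /pder deriveM; [|exact: smooth_derivable|exact: smooth_derivable].
  rewrite -![_ *: _]/(_ * _) (mulrC (eta x)).
  over.
rewrite RintegralD.
- by move/eqP; rewrite addr_eq0 => /eqP.
- exact: Omega_measurable.
- apply: integrable_continuous; apply: smooth_continuous; apply: SmoothMul => //.
  exact: (smooth_pder i se).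
- apply: integrable_continuous; apply: smooth_continuous; apply: SmoothMul => //.
  exact: (smooth_pder i sp).
Qed.

Lemma loc_integrableB v w : loc_integrable Omega v -> loc_integrable Omega w ->
  loc_integrable Omega (fun x => v x - w x).
Proof.
move=> lv lw K cK KO.
have mK : measurable (K : set T).
  exact: compact_leb_measurable.
exact: (integrableB mK (lv K cK KO) (lw K cK KO)).
Qed.

Lemma weak_partialB i u v u' v' : is_weak_partial Omega i u v ->
  is_weak_partial Omega i u' v' ->
  is_weak_partial Omega i (fun x => u x - u' x) (fun x => v x - v' x).
Proof.
move=> [lu lv h] [lu' lv' h']; split; [exact: loc_integrableB..|].
move=> psi tpsi.
have mO := Omega_measurable.
under eq_Rintegral do rewrite mulrBl.
rewrite RintegralB//; [|exact: (integrable_loc_mul lu (test_pder i tpsi))|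
  exact: (integrable_loc_mul lu' (test_pder i tpsi))].
under [in RHS]eq_Rintegral do rewrite mulrBl.
rewrite RintegralB//; [|exact: integrable_loc_mul..].
by rewrite h// h'// opprB opprK addrC.
Qed.

(** The Orlicz-Sobolev norm is expressed by the chosen representative [wpartial]; it
    can be computed only through uniqueness almost everywhere. *)
Lemma weak_partial_unique i u v v' : is_weak_partial Omega i u v ->
  is_weak_partial Omega i u v' -> {ae mu, forall x, Omega x -> v x = v' x}.
Proof.
move=> [lu lv h] [_ lv' h'].
have mO := Omega_measurable.
have dtest psi : test_function Omega psi ->
    \int[mu]_(x in Omega) ((v x - v' x) * psi x) = 0.
  move=> tpsi.
  under eq_Rintegral do rewrite mulrBl.
  rewrite RintegralB//; [|exact: integrable_loc_mul..].
  by rewrite -[X in X - _]opprK -h// h'// opprK subrr.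
have := fundamental_lemma oO (loc_integrableB lv lv') dtest.
apply: (@ae_imply _ T R mu) => x h0 Ox; apply/eqP; rewrite -subr_eq0.
by rewrite h0.
Qed.

Lemma wpartialP i u : (exists v, is_weak_partial Omega i u v) ->
  is_weak_partial Omega i u (wpartial Omega i u).
Proof. by move=> h; exact: (xgetPex (cst 0) h). Qed.

Lemma wpartial_test psi i : test_function Omega psi ->
  {ae mu, forall x, Omega x -> wpartial Omega i psi x = pder i psi x}.
Proof.
move=> tpsi; have w := weak_partial_test i tpsi.
exact: weak_partial_unique (wpartialP (ex_intro _ _ w)) w.
Qed.

Lemma wpartialB_test u psi i : (exists v, is_weak_partial Omega i u v) ->
  test_function Omega psi ->
  (exists v, is_weak_partial Omega i (fun x => u x - psi x) v) /\
  {ae mu, forall x, Omega x ->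
    wpartial Omega i (fun x => u x - psi x) x = wpartial Omega i u x - pder i psi x}.
Proof.
move=> eu tpsi.
have w := weak_partialB (wpartialP eu) (weak_partial_test i tpsi).
split; first by eexists; exact: w.
exact: weak_partial_unique (wpartialP (ex_intro _ _ w)) w.
Qed.

End test_functions.

(** * Modulars and norms of test functions *)
Section orlicz_sobolev.
Variables (R : realType) (N : nat) (M : R).
Hypothesis M0 : 0 < M.
Local Notation V := 'rV[R]_N.
Local Notation mu := (leb R N).
Local Notation T := (lebT R N).
Variable Omega : set V.
Hypothesis oO : open Omega.
Hypothesis OM : forall x, Omega x -> forall i, `|x ord0 i| < M.
Variable phi : R -> R.
Hypothesis hphi : C1 phi.
Hypothesis hphi2 : cond_phi2 phi.
Local Notation Phi := (Phi_of phi).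
Local Notation B := (energy phi).

Let mO : measurable (Omega : set T) := @Omega_measurable R N Omega oO.

Lemma measurable_Phi_norm (v : V -> R) (lam : R) : measurable_fun (Omega : set T) v ->
  measurable_fun (Omega : set T) (fun x => (Phi (`|v x| / lam))%:E).
Proof.
move=> mv; apply/measurable_EFinP.
apply: (@measurableT_comp _ _ _ _ _ _ Phi); first exact: Phi_measurable.
exact: (measurable_funM (measurableT_comp (@normr_measurable R setT) mv) (@measurable_cst _ _ _ _ _ lam^-1)).
Qed.

Lemma measurable_energy (v : V -> R) : measurable_fun (Omega : set T) v ->
  measurable_fun (Omega : set T) (fun x => B (v x)).
Proof.
move=> mv; apply: (@measurableT_comp _ _ _ _ _ _ B) mv.
by apply: continuous_measurable_fun; exact: continuous_energy.
Qed.

Lemma ae_eq_measurable (v w : V -> R) : measurable_fun (Omega : set T) v ->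
  {ae mu, forall x, Omega x -> w x = v x} -> measurable_fun (Omega : set T) w.
Proof.
move=> /measurable_EFinP mv vw; apply/measurable_EFinP.
apply: (ae_measurable_fun (mu := mu) _ _ mv).
  exact: measure_is_complete_caratheodory.
by apply: (@ae_imply _ T R mu) vw => x h Ox /=; rewrite h.
Qed.

Lemma luxemburg_ge0 Psi (v : V -> R) : (0 <= luxemburg Psi Omega v)%E.
Proof. by apply: le_ereal_inf_tmp => _ [lam [/ltW l0 _] <-]; rewrite lee_fin. Qed.

(** B v <= 2 lam B (v / (2 lam)) <= 2 lam Phi (v / lam), and for some lam < e the
    integral of Phi (|v| / lam) is at most 1. *)
Lemma luxemburg_energy (v : V -> R) (e : R) : measurable_fun (Omega : set T) v ->
  e <= 2^-1 -> (luxemburg Phi Omega v < e%:E)%E ->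
  (\int[mu]_(x in Omega) (B (v x))%:E <= (2 * e)%:E)%E.
Proof.
move=> mv e12 /ereal_inf_lt [_ [lam [l0 hl] <-]]; rewrite lte_fin => le.
apply: (@le_trans _ _ (\int[mu]_(x in Omega) ((2 * lam)%:E * (Phi (`|v x| / lam))%:E))%E).
  apply: (ge0_le_integral _ mO).
  - by move=> x _; rewrite lee_fin energy_ge0.
  - by apply/measurable_EFinP; exact: measurable_energy.
  - by apply: measurable_funeM; exact: measurable_Phi_norm.
  move=> x _; rewrite -EFinM lee_fin.
  have {1}-> : v x = (2 * lam) * (v x / (2 * lam)).
    by rewrite mulrC divfK// mulf_neq0// gt_eqF.
  apply: (le_trans (energyZ hphi hphi2 _ _)).
    by apply/andP; split; [rewrite mulr_ge0// ltW|lra].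
  rewrite ler_pM2l ?mulr_gt0//; apply: (le_trans (energy_le_Phi2 hphi hphi2 _)).
  apply: (Phi_mono hphi hphi2).
  have -> : 2 * (v x / (2 * lam)) = v x / lam by field; rewrite gt_eqF.
  by rewrite !normrM normr_id.
rewrite (ge0_integralZl _ mO).
- apply: (@le_trans _ _ ((2 * lam)%:E * 1)%E).
    by rewrite lee_pmul2l// lte_fin mulr_gt0.
  by rewrite mule1 lee_fin; lra.
- exact: measurable_Phi_norm.
- by move=> x _; rewrite lee_fin Phi_ge0.
- by rewrite lee_fin mulr_ge0// ltW.
Qed.

Lemma luxemburg_ae0 (v : V -> R) : measurable_fun (Omega : set T) v ->
  {ae mu, forall x, Omega x -> v x = 0} -> (luxemburg Phi Omega v <= 0)%E.
Proof.
move=> mv v0; apply/lee_addgt0Pr => e e0; rewrite add0e.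
apply: ereal_inf_lbound; exists e => //; split => //.
rewrite (ae_eq_integral (cst 0%E) _ mO); first by rewrite integral0.
- exact: measurable_Phi_norm.
- exact: measurable_cst.
- by apply: (@ae_imply _ T R mu) v0 => x h Ox; rewrite h// normr0 mul0r Phi0.
Qed.

Lemma in_orlicz_ae_bounded (v w : V -> R) b : measurable_fun (Omega : set T) v ->
  (forall x, Omega x -> `|v x| <= b) ->
  {ae mu, forall x, Omega x -> w x = v x} -> in_orlicz Phi Omega w.
Proof.
move=> mv vb vw; have mw := ae_eq_measurable mv vw.
split => //; exists 1 => //.
rewrite (ae_eq_integral (fun x : T => (Phi (`|v x| / 1))%:E) _ mO).
- apply: (@le_lt_trans _ _ (\int[mu]_(x in Omega) (cst (Phi b)%:E x))%E).
    apply: (ge0_le_integral _ mO).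
    + by move=> x _; rewrite lee_fin Phi_ge0.
    + exact: measurable_Phi_norm.
    + exact: measurable_cst.
    + move=> x Ox; rewrite lee_fin; apply: Phi_mono => //.
      rewrite divr1 normr_id; apply: (le_trans (vb _ Ox)); exact: ler_norm.
  rewrite integral_cst//= lte_mul_pinfty ?lee_fin ?Phi_ge0//.
  exact: Omega_fin OM.
- exact: measurable_Phi_norm.
- exact: measurable_Phi_norm.
- by apply: (@ae_imply _ T R mu) vw => x h Ox; rewrite h.
Qed.

Lemma continuous_bounded_Omega (f : V -> R) : continuous f ->
  exists b, forall x, Omega x -> `|f x| <= b.
Proof.
move=> cf; have [b _ hb] := bounded_on_box M cf.
by exists b => x Ox; apply: hb => i; exact/ltW/OM.
Qed.

Lemma test_W1 psi : test_function Omega psi -> W1 Phi Omega psi.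
Proof.
move=> tpsi; have sp := test_smooth_expr tpsi.
split.
  have cp := smooth_continuous sp; have [b hb] := continuous_bounded_Omega cp.
  have mp : measurable_fun (Omega : set T) psi by exact: continuous_leb_measurable.
  by apply: (in_orlicz_ae_bounded mp hb); exact: aeW.
move=> i; split; first by exists (pder i psi); exact: (weak_partial_test M0 oO OM i tpsi).
have cp := smooth_continuous (smooth_pder i sp).
have [b hb] := continuous_bounded_Omega cp.
have mp : measurable_fun (Omega : set T) (pder i psi) by exact: continuous_leb_measurable.
apply: (in_orlicz_ae_bounded mp hb).
exact: (wpartial_test M0 oO OM i tpsi).
Qed.

Lemma test_W10 psi : test_function Omega psi -> W10 Phi Omega psi.
Proof.
move=> tpsi; split; first exact: test_W1.
move=> e e0; exists psi => //.
apply: (@le_lt_trans _ _ 0%E); last by rewrite lte_fin.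
have sp := test_smooth_expr tpsi.
apply: (@le_trans _ _ (0 + 0)%E); last by rewrite adde0.
apply: leeD.
  apply: luxemburg_ae0; last by apply: aeW => x _; rewrite subrr.
  under eq_fun do rewrite subrr; exact: measurable_cst.
apply: sume_le0 => i _.
have [_ h] := wpartialB_test M0 oO OM (ex_intro _ _ (weak_partial_test M0 oO OM i tpsi)) tpsi.
have h0 : {ae mu, forall x, Omega x -> wpartial Omega i (fun x => psi x - psi x) x = 0}.
  apply: (@ae_imply2 _ T R mu) h (wpartial_test M0 oO OM i tpsi) => x h1 h2 Ox.
  by rewrite h1// h2// subrr.
apply: luxemburg_ae0 => //.
by apply: (ae_eq_measurable (v := cst 0)) => //; exact: measurable_cst.
Qed.

End orlicz_sobolev.

(** * Limits of integrals *)
Section summable.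
Context d (T : measurableType d) (R : realType) (mu : {measure set T -> \bar R}).
Variable D : set T.
Hypothesis mD : measurable D.

(** If the integrals of S n are summable, the sum of the S n is integrable by monotone
    convergence.  It dominates every S n, and its general term tends to 0 wherever
    it converges. *)
Lemma summable_dominated (S : nat -> T -> R) (c : R) :
  (forall n, measurable_fun D (S n)) -> (forall n x, D x -> 0 <= S n x) -> 0 <= c ->
  (forall n, (\int[mu]_(x in D) (S n x)%:E <= (c / (2 ^ n.+1)%:R)%:E)%E) ->
  exists2 G : T -> R, mu.-integrable D (EFin \o G) &
    {ae mu, forall x, D x -> (forall n, S n x <= G x) /\ S n x @[n --> \oo] --> (0 : R)}.
Proof.
move=> mS S0 c0 intS.
pose F (x : T) : \bar R := (\sum_(n <oo) (S n x)%:E)%E.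
have F0 x : D x -> (0 <= F x)%E.
  by move=> Dx; apply: nneseries_ge0 => n _ _; rewrite lee_fin S0.
have mF : measurable_fun D F.
  apply: (ge0_emeasurable_sum (P := xpredT)) => [k x Dx _|k _].
    by rewrite lee_fin S0.
  exact/measurable_EFinP.
have intF : mu.-integrable D F.
  apply/integrableP; split => //.
  rewrite (eq_integral F); last by move=> x /set_mem Dx; rewrite gee0_abs ?F0.
  rewrite (integral_nneseries _ mD) => [|n|n x Dx]; last 2 first.
  - exact/measurable_EFinP.
  - by rewrite lee_fin S0.
  apply: (@le_lt_trans _ _ c%:E); last by rewrite ltry.
  apply: (@le_trans _ _ (\sum_(n <oo) (0 + (c / (2 ^ n.+1)%:R)%:E))%E).
    apply: lee_nneseries => n *; last by rewrite add0e.
    by apply: integral_ge0 => x Dx; rewrite lee_fin S0.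
  apply: (le_trans (epsilon_trick _ _ c0)) => //.
  by rewrite eseries0// add0e.
exists (fine \o F).
  apply: (le_integrable mD _ _ intF).
    apply/measurable_EFinP; apply: (measurable_comp measurableT) => //.
  move=> x Dx /=; have := F0 x Dx.
  by case: (F x) => [r _|_|//] /=; [exact: lexx|exact: leey].
have := integrable_ae mD intF; apply: filterS => x h Dx.
have Ffin := h Dx.
have part n : \sum_(0 <= k < n) S k x <= fine (F x).
  rewrite -lee_fin fineK// -sumEFin.
  by apply: nneseries_lim_ge => k *; rewrite lee_fin S0.
split.
  move=> n; apply: le_trans (part n.+1).
  by rewrite big_nat_recr//= lerDr; apply: sumr_ge0 => k _; exact: S0.
apply: cvg_series_cvg_0; apply: nondecreasing_is_cvgn.
  apply/nondecreasing_seqP => n; rewrite /series/= big_nat_recr//= lerDl; exact: S0.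
by exists (fine (F x)) => _ [n _ <-]; exact: part.
Qed.

Lemma integral_addsum_le n (f : T -> R) (g : 'I_n -> T -> R) (b : R) :
  measurable_fun D f -> (forall i, measurable_fun D (g i)) ->
  (forall x, 0 <= f x) -> (forall i x, 0 <= g i x) ->
  (\int[mu]_(x in D) (f x)%:E <= b%:E)%E ->
  (forall i, (\int[mu]_(x in D) (g i x)%:E <= b%:E)%E) ->
  (\int[mu]_(x in D) (f x + \sum_(i < n) g i x)%:E <= (b *+ n.+1)%:E)%E.
Proof.
move=> mf mg f0 g0 fb gb.
under eq_integral do rewrite EFinD -sumEFin.
rewrite ge0_integralD//; last 4 first.
- by move=> x _; rewrite lee_fin.
- exact/measurable_EFinP.
- by move=> x _; apply: sume_ge0 => i _; rewrite lee_fin.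
- by apply: emeasurable_sum => i; exact/measurable_EFinP.
rewrite ge0_integral_sum//; last 2 first.
- by move=> i; exact/measurable_EFinP.
- by move=> i x _; rewrite lee_fin.
apply: (@le_trans _ _ (b%:E + \sum_(i < n) b%:E)%E).
  by apply: leeD => //; apply: lee_sum => i _.
by rewrite sumEFin -EFinD lee_fin sumr_const card_ord -mulrS.
Qed.

Lemma fatou_bound (f : nat -> T -> R) (g : T -> R) (b : nat -> R) (c : R) :
  (forall n, measurable_fun D (f n)) -> measurable_fun D g ->
  (forall n x, D x -> 0 <= f n x) ->
  {ae mu, forall x, D x -> f n x @[n --> \oo] --> g x} ->
  (forall n, (\int[mu]_(x in D) (f n x)%:E <= (b n)%:E)%E) ->
  b n @[n --> \oo] --> c ->
  (\int[mu]_(x in D) (g x)%:E <= c%:E)%E.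
Proof.
move=> mf mg f0 fg intf bc.
have mef n : measurable_fun D (fun x => (f n x)%:E) by exact/measurable_EFinP.
have lim_g : {ae mu, forall x, D x -> (g x)%:E = limn_einf (fun n => (f n x)%:E)}.
  move: fg; apply: filterS => x h Dx.
  have cv : (f n x)%:E @[n --> \oo] --> (g x)%:E.
    by apply: cvg_EFin; [exact: nearW|exact: h].
  have ce := cvg_limn_einf_sup cv.
  by rewrite ce.1.
rewrite (ae_eq_integral (fun x => limn_einf (fun n => (f n x)%:E)))//.
- apply: (le_trans (fatou mu mD mef _)); first by move=> n x Dx; rewrite lee_fin f0.
  have cb : (b n)%:E @[n --> \oo] --> c%:E by apply: cvg_EFin => //; exact: nearW.
  rewrite limn_einf_lim -(cvg_lim _ cb)//; apply: lee_lim.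
  - exact: is_cvg_einfs.
  - by apply/cvg_ex; exists c%:E.
  apply: nearW => n; apply: le_trans (intf n).
  by apply: ereal_inf_lbound; exists n => /=.
- exact/measurable_EFinP.
- apply: measurableT_comp => //; apply: measurable_fun_limn_esup => n.
  by apply: measurableT_comp.
Qed.

Hypothesis cmu : measure_is_complete mu.

(** Completeness of the measure makes limits almost everywhere measurable. *)
Lemma ae_cvg_measurable (f : nat -> T -> R) (g : T -> R) :
  (forall n, measurable_fun D (f n)) ->
  {ae mu, forall x, D x -> f n x @[n --> \oo] --> g x} -> measurable_fun D g.
Proof.
move=> mf fg; apply/measurable_EFinP.
apply: (@ae_measurable_fun _ _ _ _ cmu _ (fun x => limn_esup (fun n => (f n x)%:E))).
  move: fg; apply: filterS => x h Dx.
  have cv : (f n x)%:E @[n --> \oo] --> (g x)%:E.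
    by apply: cvg_EFin; [exact: nearW|exact: h].
  by rewrite (cvg_limn_einf_sup cv).2.
by apply: measurable_fun_limn_esup => n; exact/measurable_EFinP.
Qed.

Lemma dominated_convergence_Rintegral (f : nat -> T -> R) (g G : T -> R) :
  (forall n, measurable_fun D (f n)) ->
  {ae mu, forall x, D x -> f n x @[n --> \oo] --> g x} ->
  mu.-integrable D (EFin \o G) ->
  {ae mu, forall x, D x -> forall n, `|f n x| <= G x} ->
  mu.-integrable D (EFin \o g) /\
  \int[mu]_(x in D) f n x @[n --> \oo] --> \int[mu]_(x in D) g x.
Proof.
move=> mf fg intG fG; have mg := ae_cvg_measurable mf fg.
have [] := @dominated_convergence _ _ _ mu _ mD (fun n x => (f n x)%:E)
  (EFin \o g) (EFin \o G).
- by move=> n; exact/measurable_EFinP.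
- exact/measurable_EFinP.
- move: fg; apply: filterS => x h Dx; apply: cvg_EFin; [exact: nearW|exact: h].
- exact: intG.
- by move: fG; apply: filterS => x h n Dx; rewrite lee_fin h.
move=> intg _ h; split => //.
have fing := integrable_fin_num mD intg.
by rewrite /Rintegral; apply: fine_cvg; rewrite fineK.
Qed.

End summable.

(** * Approximation by test functions *)
Section approximation.
Variables (R : realType) (N : nat) (M : R).
Hypothesis M0 : 0 < M.
Local Notation V := 'rV[R]_N.
Local Notation mu := (leb R N).
Local Notation T := (lebT R N).
Variable Omega : set V.
Hypothesis oO : open Omega.
Hypothesis OM : forall x, Omega x -> forall i, `|x ord0 i| < M.
Variable phi : R -> R.
Hypothesis hphi : C1 phi.
Hypothesis hphi2 : cond_phi2 phi.
Local Notation Phi := (Phi_of phi).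
Local Notation B := (energy phi).

Let mO : measurable (Omega : set T) := @Omega_measurable R N Omega oO.

Lemma W1norm_luxemburg (v : V -> R) e : (W1norm Phi Omega v < e)%E ->
  (luxemburg Phi Omega v < e)%E /\
  forall i, (luxemburg Phi Omega (wpartial Omega i v) < e)%E.
Proof.
move=> h; split; last move=> i; apply: le_lt_trans h; rewrite /W1norm.
  by rewrite leeDl// sume_ge0// => i _; exact: luxemburg_ge0.
rewrite (bigD1 i)//= addeCA leeDl//.
by rewrite adde_ge0 ?luxemburg_ge0// sume_ge0// => j _; exact: luxemburg_ge0.
Qed.

(** The norm distances to u decrease like 2^(- n), hence so do the modulars: their sum
    is an integrable function, and B (x n) -> 0 forces x n -> 0. *)
Lemma W10_approximation (u : V -> R) : W10 Phi Omega u ->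
  exists (psi : nat -> V -> R) (D : V -> R),
  [/\ forall n, test_function Omega (psi n), mu.-integrable Omega (EFin \o D) &
   {ae mu, forall x, Omega x -> [/\ psi n x @[n --> \oo] --> u x,
     forall i, pder i (psi n) x @[n --> \oo] --> wpartial Omega i u x &
     forall n i, B (wpartial Omega i u x - pder i (psi n) x) <= D x]}].
Proof.
move=> [[[mu_u _] hpart] happ].
have mud i : measurable_fun (Omega : set T) (wpartial Omega i u) := (hpart i).2.1.
pose e n : R := 2^-1 / (2 ^ n.+1)%:R.
have e0 n : 0 < e n by rewrite divr_gt0 ?invr_gt0// ltr0n expn_gt0.
have e12 n : e n <= 2^-1.
  by rewrite ler_pdivrMr ?ltr0n ?expn_gt0// ler_peMr ?invr_ge0// ler1n expn_gt0.
have exP n : exists psi, test_function Omega psi /\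
   (W1norm Phi Omega (fun x => (u x - psi x)%R) < (e n)%:E)%E.
  by have [psi tpsi h] := happ _ (e0 n); exists psi.
have [psi psiP] := choice exP.
have tpsi n : test_function Omega (psi n) := (psiP n).1.
have spsi n := test_smooth_expr (tpsi n).
have mpsi n : measurable_fun (Omega : set T) (psi n).
  by apply: continuous_leb_measurable; exact: smooth_continuous.
have mdpsi n i : measurable_fun (Omega : set T) (pder i (psi n)).
  by apply: continuous_leb_measurable; apply: smooth_continuous; exact: smooth_pder.
pose td n i x := wpartial Omega i u x - pder i (psi n) x.
have mtd n i : measurable_fun (Omega : set T) (td n i) by exact: measurable_funB.
pose S n x := B (u x - psi n x) + \sum_(i < N) B (td n i x).
have mBtd n i : measurable_fun (Omega : set T) (fun x => B (td n i x)).
  exact: (measurable_energy hphi (mtd n i)).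
have mBu n : measurable_fun (Omega : set T) (fun x => B (u x - psi n x)).
  exact: (measurable_energy hphi (measurable_funB mu_u (mpsi n))).
have mS n : measurable_fun (Omega : set T) (S n).
  apply: measurable_funD; first exact: mBu.
  apply: measurable_sum; exact: mBtd.
have B0 t : 0 <= B t by exact: energy_ge0.
have S0 n x : 0 <= S n x by rewrite addr_ge0// sumr_ge0.
have intBu n : (\int[mu]_(x in Omega) (B (u x - psi n x))%:E <= (2 * e n)%:E)%E.
  exact: (luxemburg_energy oO hphi hphi2 (measurable_funB mu_u (mpsi n)) (e12 n)
    (W1norm_luxemburg (psiP n).2).1).
have intBtd n i : (\int[mu]_(x in Omega) (B (td n i x))%:E <= (2 * e n)%:E)%E.
  have [_ ae1] := wpartialB_test M0 oO OM (hpart i).1 (tpsi n).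
  have mw := ae_eq_measurable (mtd n i) ae1.
  have h := luxemburg_energy oO hphi hphi2 mw (e12 n) ((W1norm_luxemburg (psiP n).2).2 i).
  rewrite (ae_eq_integral (fun x : T => (B (wpartial Omega i (fun x => u x - psi n x) x))%:E) _ mO).
  - exact: h.
  - by apply/measurable_EFinP; exact: mBtd.
  - by apply/measurable_EFinP; exact: (measurable_energy hphi mw).
  - by apply: (@ae_imply _ T R mu) ae1 => x h1 Ox; rewrite h1.
have intS n : (\int[mu]_(x in Omega) (S n x)%:E <= (N.+1%:R / (2 ^ n.+1)%:R)%:E)%E.
  have -> : N.+1%:R / (2 ^ n.+1)%:R = (2 * e n) *+ N.+1 :> R.
    by rewrite -[RHS]mulr_natl /e [2 * _]mulrA mulfV// mul1r.
  exact: (integral_addsum_le mO (mBu n) (mBtd n) (fun x => B0 _) (fun i x => B0 _) (intBu n) (intBtd n)).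
have [G intG aeG] := summable_dominated mO mS (fun n x _ => S0 n x) (ler0n _ _) intS.
exists psi, G; split => //.
apply: (@ae_imply _ T R mu) aeG => x h Ox; have [SG S_0] := h Ox.
have Sl n : B (u x - psi n x) <= S n x by rewrite lerDl sumr_ge0.
have Sr n i : B (td n i x) <= S n x.
  rewrite /S (bigD1 i)//= addrCA lerDl addr_ge0// sumr_ge0//.
have cvgB0 (a : nat -> R) : (forall n, B (a n) <= S n x) -> a n @[n --> \oo] --> (0 : R).
  move=> aS; apply: (energy_eq0_cvg hphi hphi2).
  by apply: (squeeze_cvgr _ (cvg_cst 0) S_0); apply: nearW => n; rewrite B0 aS.
split.
- have := cvgB0 _ Sl => /(cvgB (cvg_cst (u x))); rewrite subr0.
  by under eq_cvg do rewrite subKr.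
- move=> i; have := cvgB0 _ (Sr ^~ i) => /(cvgB (cvg_cst (wpartial Omega i u x))); rewrite subr0.
  by under eq_cvg do rewrite subKr.
- by move=> n i; exact: le_trans (Sr n i) (SG n).
Qed.

End approximation.

(** * Limits of the gradient terms *)
Section gradient_limits.
Context d (T : measurableType d) (R : realType) (mu : {measure set T -> \bar R}).
Variable D : set T.
Hypothesis mD : measurable D.
Hypothesis cmu : measure_is_complete mu.
Hypothesis finD : (mu D < +oo)%E.
Variable phi : R -> R.
Hypothesis hphi : C1 phi.
Hypothesis hphi2 : cond_phi2 phi.
Local Notation B := (energy phi).
Local Notation p := (flux_fun phi).

Variables (N : nat) (u : T -> R) (ud : 'I_N -> T -> R).
Variables (psi : nat -> T -> R) (dpsi : nat -> 'I_N -> T -> R) (Dom : T -> R).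
Hypothesis mud : forall i, measurable_fun D (ud i).
Hypothesis mpsi : forall n, measurable_fun D (psi n).
Hypothesis mdpsi : forall n i, measurable_fun D (dpsi n i).
Hypothesis intDom : mu.-integrable D (EFin \o Dom).
Hypothesis approx : {ae mu, forall x, D x -> [/\ psi n x @[n --> \oo] --> u x,
     forall i, dpsi n i x @[n --> \oo] --> ud i x &
     forall n i, B (ud i x - dpsi n i x) <= Dom x]}.

Definition grad_norm (x : T) : R := Num.sqrt (\sum_(i < N) ud i x ^+ 2).
Local Notation w := grad_norm.

Hypothesis intB : mu.-integrable D (EFin \o (fun x => B (w x))).

Lemma grad_norm_ge i x : `|ud i x| <= w x.
Proof.
rewrite -sqrtr_sqr /grad_norm ler_sqrt; last by apply: sumr_ge0 => j _; exact: sqr_ge0.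
by rewrite (bigD1 i)//= lerDl sumr_ge0// => j _; exact: sqr_ge0.
Qed.

Lemma grad_norm_sq x : w x ^+ 2 = \sum_(i < N) ud i x ^+ 2.
Proof. by rewrite sqr_sqrtr// sumr_ge0// => j _; exact: sqr_ge0. Qed.

Lemma energy_grad_norm x : phi (w x) * \sum_(i < N) ud i x * ud i x = B (w x).
Proof.
under eq_bigr do rewrite -expr2.
by rewrite -grad_norm_sq /energy /flux_fun ger0_norm ?sqrtr_ge0//; ring.
Qed.

Lemma grad_norm_measurable : measurable_fun D w.
Proof.
apply: (@measurableT_comp _ _ _ _ _ _ (@Num.sqrt R)).
  by apply: continuous_measurable_fun; exact: sqrt_continuous.
apply: measurable_sum => i; exact: measurable_funX.
Qed.

Lemma flux_grad_le i x : `|phi (w x) * ud i x| <= p (w x).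
Proof.
have w0 : 0 <= w x by exact: sqrtr_ge0.
rewrite normrM (le_trans (ler_wpM2l _ (grad_norm_ge i x)))//.
by rewrite -{2}(ger0_norm w0) -normrM mulrC ger0_norm ?flux_ge0.
Qed.

(** Write t = ud i x - (ud i x - t): the flux of u against the gradient of psi n is
    controlled by the energies of u and of the difference, the quantities that the
    approximation dominates. *)
Lemma flux_dpsi_le i x t : `|phi (w x) * ud i x * t| <= 2 * B (w x) + B (ud i x - t).
Proof.
have w0 : 0 <= w x by exact: sqrtr_ge0.
rewrite normrM (le_trans (ler_wpM2r _ (flux_grad_le i x)))//.
have -> : t = ud i x - (ud i x - t) by rewrite subKr.
set s := ud i x - t.
apply: (@le_trans _ _ (p (w x) * (w x + `|s|))).
  rewrite ler_wpM2l ?flux_ge0// (le_trans (ler_normB _ _))// lerD2r.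
  exact: grad_norm_ge.
rewrite mulrDr (_ : ud i x - _ = s); last by rewrite subKr.
have h1 := flux_mul_le hphi hphi2 w0 (normr_ge0 s).
have h2 : p (w x) * w x = B (w x) by rewrite /energy ger0_norm// mulrC.
have h3 : B `|s| = B s by rewrite /energy normr_id.
by rewrite h2; rewrite h3 in h1; lra.
Qed.

Variables (G' : R -> R) (K : R).
Hypothesis cG' : continuous G'.
Hypothesis G'K : forall t, `|G' t| <= K.

Lemma measurable_comp_continuous (h : R -> R) (v : T -> R) : continuous h ->
  measurable_fun D v -> measurable_fun D (fun x => h (v x)).
Proof. by move=> ch mv; apply: measurableT_comp => //; exact: continuous_measurable_fun. Qed.

(** The integrands, the left side of the equation tested with G(psi n), are all below
    K N (2 B w + Dom), since Dom dominates the energies of the differences. *)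
Lemma flux_limit :
  \int[mu]_(x in D) (phi (w x) * \sum_(i < N) ud i x * (G' (psi n x) * dpsi n i x)) @[n --> \oo] -->
  \int[mu]_(x in D) (B (w x) * G' (u x)).
Proof.
have K0 : 0 <= K by exact: le_trans (G'K 0).
have mw := grad_norm_measurable.
apply: (@dominated_convergence_Rintegral _ _ _ _ _ mD cmu _ _
  (fun x => K * (2 * B (w x) + Dom x) *+ N) _ _ _ _).2.
- move=> n; apply: measurable_funM.
    by apply: measurable_comp_continuous => //; exact: continuous_phi.
  apply: measurable_sum => i; apply: measurable_funM => //.
  by apply: measurable_funM => //; exact: measurable_comp_continuous.
- apply: (ae_imply _ approx) => x h Dx; have [pu dpu _] := h Dx.
  have -> : B (w x) * G' (u x) = phi (w x) * \sum_(i < N) ud i x * (G' (u x) * ud i x).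
    rewrite -energy_grad_norm -mulrA; congr (_ * _); rewrite mulr_suml.
    by apply: eq_bigr => i _; ring.
  apply: cvgM; first exact: cvg_cst.
  apply: cvg_big => [|i _]; first exact: add_continuous.
  apply: cvgM; first exact: cvg_cst.
  apply: cvgM => //; apply: continuous_cvg => //; exact: cG'.
- have h : mu.-integrable D (EFin \o (fun x => (K * N%:R * 2) * B (w x) + (K * N%:R) * Dom x)).
    have h1 := integrableZl mD (K * N%:R * 2) intB.
    have h2 := integrableZl mD (K * N%:R) intDom.
    exact: (integrableD mD h1 h2).
  move: h; congr (integrable _ _ _); apply/funext => x; congr EFin.
  by rewrite -mulr_natr; ring.
- apply: (ae_imply _ approx) => x h Dx n; have [_ _ BD] := h Dx.
  rewrite mulr_sumr (le_trans (ler_norm_sum _ _ _))//.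
  rewrite -[N in leRHS](card_ord N) -sumr_const; apply: ler_sum => i _.
  rewrite (_ : phi _ * _ = G' (psi n x) * (phi (w x) * ud i x * dpsi n i x)); last by ring.
  rewrite normrM; apply: ler_pM => //.
  by apply: (le_trans (flux_dpsi_le _ _ _)); rewrite lerD2l.
Qed.

Variables (al c0 C0 : R).
Hypothesis al0 : 0 < al.
Hypothesis c00 : 0 < c0.
Hypothesis coer : forall t, c0 * `|t| `^ al <= B t + C0.

(** Coercivity turns the domination of energies into a domination of alpha-th powers. *)
Lemma power_dpsi_le i x t :
  `|t| `^ al <= 2 `^ al / c0 * (B (w x) + B (ud i x - t) + 2 * C0).
Proof.
have tl : `|t| <= w x + `|ud i x - t|.
  rewrite -{1}(subKr (ud i x) t) (le_trans (ler_normB _ _))// lerD2r.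
  exact: grad_norm_ge.
set s := ud i x - t in tl *.
have w0 : 0 <= w x by exact: sqrtr_ge0.
pose m := Num.max (w x) `|s|.
have m0 : 0 <= m by rewrite le_max w0.
have tm : `|t| <= 2 * m.
  by apply: (le_trans tl); rewrite mulr_natl mulr2n lerD// le_max lexx ?orbT.
apply: (le_trans (ler_powR2r (ltW al0) (normr_ge0 _) tm)).
rewrite powRM// -mulrA ler_wpM2l ?powR_ge0//.
rewrite ler_pdivlMl//.
apply: (@le_trans _ _ (c0 * (w x `^ al + `|s| `^ al))).
  rewrite ler_pM2l// /m; have [_|_] := ltP (w x) `|s|.
    by rewrite lerDr powR_ge0.
  by rewrite lerDl powR_ge0.
have h1 := coer (w x); have h2 := coer s; rewrite (ger0_norm w0) in h1.
by rewrite mulrDr; lra.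
Qed.

Lemma integrable_cst_fin (k : R) : mu.-integrable D (EFin \o cst k).
Proof.
apply: measurable_bounded_integrable => //.
by exists `|k|; split => // y ky x _; exact: ltW.
Qed.

Lemma gradient_power_limit i :
  mu.-integrable D (EFin \o (fun x => `|G' (u x) * ud i x| `^ al)) /\
  \int[mu]_(x in D) `|G' (psi n x) * dpsi n i x| `^ al @[n --> \oo] -->
  \int[mu]_(x in D) `|G' (u x) * ud i x| `^ al.
Proof.
have K0 : 0 <= K by exact: le_trans (G'K 0).
apply: (@dominated_convergence_Rintegral _ _ _ _ _ mD cmu _ _
  (fun x => K `^ al * (2 `^ al / c0 * (B (w x) + Dom x + 2 * C0)))).
- move=> n; apply: measurable_norm_powR; apply: measurable_funM => //.
  exact: measurable_comp_continuous.
- apply: (ae_imply _ approx) => x h Dx; have [pu dpu _] := h Dx.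
  apply: (@continuous_cvg _ _ _ _ _ _ (fun t : R => `|t| `^ al)).
    exact: (continuous_norm_powR (ltW al0)).
  apply: cvgM => //; apply: continuous_cvg => //; exact: cG'.
- have h1 := integrableD mD (integrableD mD intB intDom) (integrable_cst_fin (2 * C0)).
  have h := integrableZl mD (K `^ al * (2 `^ al / c0)) h1.
  move: h; congr (integrable _ _ _); apply/funext => x; rewrite /= -!EFinD -EFinM; congr EFin.
  by ring.
- apply: (ae_imply _ approx) => x h Dx n; have [_ _ BD] := h Dx.
  rewrite ger0_norm ?powR_ge0// normrM powRM//.
  apply: ler_pM; rewrite ?powR_ge0//; first exact: ler_powR2r (ltW al0) _ _.
  apply: (le_trans (power_dpsi_le i x _)).
  rewrite ler_wpM2l ?mulr_ge0 ?powR_ge0 ?invr_ge0 ?(ltW c00)//.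
  by rewrite lerD2r lerD2l.
Qed.

End gradient_limits.

(** * Composition with nonlinear functions *)
Section ae_tools.
Context d (T : measurableType d) (R : realType) (mu : {measure set T -> \bar R}).
Variable D : set T.
Hypothesis mD : measurable D.
Hypothesis cmu : measure_is_complete mu.

Lemma ae_eq_Rintegral (f g : T -> R) : measurable_fun D f ->
  {ae mu, forall x, D x -> f x = g x} ->
  \int[mu]_(x in D) f x = \int[mu]_(x in D) g x.
Proof.
move=> /measurable_EFinP mf fg; congr fine.
have mg : measurable_fun D (EFin \o g).
  apply: (@ae_measurable_fun _ _ _ _ cmu _ (EFin \o f)) => //.
  by move: fg; apply: filterS => x h Dx /=; rewrite h.
apply: ae_eq_integral => //.
by move: fg; apply: filterS => x h Dx /=; rewrite h.
Qed.

Lemma ae_forall_ord N (P : 'I_N -> T -> Prop) :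
  (forall i, {ae mu, forall x, P i x}) -> {ae mu, forall x, forall i, P i x}.
Proof. by move=> h; apply: filter_forall. Qed.

End ae_tools.

Lemma cvg_powR_ge0 (R : realType) (a : nat -> R) (l e : R) : 0 <= e ->
  (forall n, 0 <= a n) -> a n @[n --> \oo] --> l ->
  a n `^ e @[n --> \oo] --> l `^ e.
Proof.
move=> e0 a0 al.
have l0 : 0 <= l.
  by rewrite -(cvg_lim _ al)//; apply: limr_ge; [apply/cvg_ex; exists l|exact: nearW].
have cc : {for l, continuous (fun t : R => `|t| `^ e)} by exact: continuous_norm_powR.
rewrite (_ : (fun n => a n `^ e) = (fun t : R => `|t| `^ e) \o a).
  by rewrite -(ger0_norm l0); exact: continuous_cvg cc al.
by apply/funext => n; rewrite /= ger0_norm.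
Qed.

Section chain_functions.
Variable R : realType.

(** The real functions that may be composed with a test function: the result is again
    a test function, with gradient given by the chain rule.  G 0 = 0 preserves the
    support. *)
Definition chain_fun (G G' : R -> R) : Prop :=
  [/\ G 0 = 0, forall t : R, is_derive t 1 G (G' t), continuous G' &
   forall N (f : 'rV[R]_N -> R), smooth_expr f -> smooth_expr (fun x => G (f x))].

Lemma chain_fun_continuous G G' : chain_fun G G' -> continuous G.
Proof. by move=> [_ dG _ _]; move=> t; exact: is_derive1_continuous (dG t). Qed.

Lemma chain_fun_comp G G' H H' : chain_fun G G' -> chain_fun H H' ->
  chain_fun (fun t => G (H t)) (fun t => G' (H t) * H' t).
Proof.
move=> cG cH; have ctH := chain_fun_continuous cH.
move: cG cH => [G0 dG cG' sG] [H0 dH cH' sH]; split.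
- by rewrite H0.
- by move=> t; exact: is_derive_scalar_comp.
- move=> t; apply: cvgM; last exact: cH'.
  by apply: continuous_comp; [exact: ctH|exact: cG'].
- by move=> N f sf; apply: sG; exact: sH.
Qed.

End chain_functions.
Arguments chain_fun {R}.

Section weak_identities.
Variables (R : realType) (N : nat) (M : R).
Hypothesis M0 : 0 < M.
Hypothesis hN : (1 < N)%N.
Local Notation V := 'rV[R]_N.
Local Notation mu := (leb R N).
Local Notation T := (lebT R N).
Local Notation e_ i := (delta_mx ord0 i : V).
Variable Omega : set V.
Hypothesis oO : open Omega.
Hypothesis OM : forall x, Omega x -> forall i, `|x ord0 i| < M.
Variable phi : R -> R.
Hypothesis hphi : C1 phi.
Hypothesis hphi2 : cond_phi2 phi.
Local Notation Phi := (Phi_of phi).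
Local Notation B := (energy phi).
Let mO : measurable (Omega : set T) := @Omega_measurable R N Omega oO.
Let cmu : measure_is_complete mu. Proof. exact: measure_is_complete_caratheodory. Qed.

Variable u : V -> R.
Hypothesis uW : W10 Phi Omega u.
Local Notation ud := (fun i (x : T) => wpartial Omega i u x).
Hypothesis intB : mu.-integrable Omega (EFin \o (fun x : T => B (wgrad_norm Omega u x))).

Let mud i : measurable_fun (Omega : set T) (ud i).
Proof. by case: uW => [[_ h] _]; exact: (h i).2.1. Qed.

Lemma test_chain G G' psi : chain_fun G G' -> test_function Omega psi ->
  test_function Omega (fun x => G (psi x)).
Proof.
move=> [G0 _ _ sG] tpsi; apply: (test_comp tpsi).
  by apply: sG; exact: test_smooth_expr tpsi.
by move=> x ->.
Qed.

Lemma is_derive_chain G G' (psi : V -> R) i (x : V) : chain_fun G G' ->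
  test_function Omega psi ->
  is_derive x (e_ i) (fun x => G (psi x)) (G' (psi x) * pder i psi x).
Proof.
move=> [_ dG _ _] tpsi; apply: is_derive_scalar_comp.
by apply: derivableP; exact: smooth_derivable (test_smooth_expr tpsi).
Qed.

Lemma pder_chain G G' (psi : V -> R) i (x : V) : chain_fun G G' ->
  test_function Omega psi ->
  pder i (fun x => G (psi x)) x = G' (psi x) * pder i psi x.
Proof. by move=> cG tpsi; have [_ h] := is_derive_chain i x cG tpsi; exact: h. Qed.

Let mtest psi : test_function Omega psi -> measurable_fun (Omega : set T) psi.
Proof.
by move=> tpsi; apply: continuous_leb_measurable; exact: smooth_continuous (test_smooth_expr tpsi).
Qed.

Variable f : V -> R.
Hypothesis weak : forall v, test_function Omega v ->
    [/\ mu.-integrable Omega (EFin \o (fun x : T => phi (wgrad_norm Omega u x) *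
          \sum_(i < N) wpartial Omega i u x * wpartial Omega i v x)),
        mu.-integrable Omega (EFin \o (fun x : T => f x * v x)) &
        \int[mu]_(x in Omega) (phi (wgrad_norm Omega u x) *
          \sum_(i < N) wpartial Omega i u x * wpartial Omega i v x) =
        \int[mu]_(x in Omega) (f x * v x)].
Variable h : V -> R.
Hypothesis inth : mu.-integrable Omega (EFin \o (h : T -> R)).
Hypothesis fh : forall x, Omega x -> `|f x| <= h x.

(** Dominated convergence in the equation tested with G(psi n).  On the right the
    dominating function is a multiple of h, because G is bounded. *)
Lemma identity_bounded G G' K : chain_fun G G' -> (forall t, `|G t| <= K) ->
  (forall t, `|G' t| <= K) ->
  mu.-integrable Omega (EFin \o (fun x : T => f x * G (u x))) /\
  \int[mu]_(x in Omega) (B (wgrad_norm Omega u x) * G' (u x)) =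
  \int[mu]_(x in Omega) (f x * G (u x)).
Proof.
move=> chG GK G'K; have cG := chain_fun_continuous chG; have [_ _ cG' _] := chG.
have [psi [D [tpsi intD approx]]] := W10_approximation M0 oO OM hphi hphi2 uW.
have mpsi n := mtest (tpsi n).
have mdpsi n i : measurable_fun (Omega : set T) (pder i (psi n)) := mtest (test_pder i (tpsi n)).
have tv n := test_chain chG (tpsi n).
have L1 := flux_limit mO cmu hphi hphi2 mud mpsi mdpsi intD approx intB cG' G'K.
have E n : \int[mu]_(x in Omega) (phi (grad_norm ud x) *
     \sum_(i < N) ud i x * (G' (psi n x) * pder i (psi n) x)) =
     \int[mu]_(x in Omega) (f x * G (psi n x)).
  have [w1 _ <-] := weak (tv n); apply/esym.
  apply: (ae_eq_Rintegral mO cmu).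
    by apply/measurable_EFinP; exact: measurable_int w1.
  have a1 := ae_forall_ord (fun i => wpartial_test M0 oO OM i (tv n)).
  apply: (@ae_imply _ T R mu) a1 => x h1 Ox; congr (_ * _); apply: eq_bigr => i _.
  by rewrite h1// (pder_chain _ _ chG).
have K0 : 0 <= K by exact: le_trans (GK 0).
have [intfG L2] : mu.-integrable Omega (EFin \o (fun x : T => f x * G (u x))) /\
   \int[mu]_(x in Omega) (f x * G (psi n x)) @[n --> \oo] --> \int[mu]_(x in Omega) (f x * G (u x)).
  apply: (@dominated_convergence_Rintegral _ T R mu Omega mO cmu _ _ (fun x => K * h x)).
  - move=> n; have [_ w2 _] := weak (tv n).
    by apply/measurable_EFinP; exact: measurable_int w2.
  - apply: (@ae_imply _ T R mu) approx => x h1 Ox; have [pu _ _] := h1 Ox.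
    apply: cvgM; first exact: cvg_cst.
    by apply: continuous_cvg => //; exact: cG.
  - exact: (integrableZl mO K inth).
  - apply: aeW => x Ox n; rewrite normrM mulrC; apply: ler_pM => //; exact: fh.
split => //.
move: L1; under eq_cvg do rewrite E.
by move=> L1; exact: (cvg_unique _ L1 L2).
Qed.

Variables (al c0 C0 : R).
Hypothesis al1 : 1 <= al.
Hypothesis alN : al < N%:R.
Hypothesis c00 : 0 < c0.
Hypothesis coer : forall t, c0 * `|t| `^ al <= B t + C0.

(** The Sobolev inequality passes from H(psi n) to H(u): Fatou on the left, dominated
    convergence on the right. *)
Lemma sobolev_limit H H' K : chain_fun H H' -> (forall t, `|H' t| <= K) ->
  (forall i, mu.-integrable Omega (EFin \o (fun x : T => `|H' (u x) * ud i x| `^ al))) /\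
  (\int[mu]_(x in Omega) (`|H (u x)| `^ sob_exp N al)%:E <=
   ((sob_const N M al * \sum_(i < N) \int[mu]_(x in Omega) `|H' (u x) * ud i x| `^ al)
     `^ (N%:R / (N%:R - al)))%:E)%E.
Proof.
move=> chH H'K; have cH := chain_fun_continuous chH; have [H0 _ cH' _] := chH.
have al0 : 0 < al by exact: lt_le_trans al1.
have N0 : 0 < N%:R :> R by rewrite ltr0n ltnW.
have Na0 : 0 < N%:R - al by rewrite subr_gt0.
have [psi [D [tpsi intD approx]]] := W10_approximation M0 oO OM hphi hphi2 uW.
have mpsi n := mtest (tpsi n).
have mdpsi n i : measurable_fun (Omega : set T) (pder i (psi n)) := mtest (test_pder i (tpsi n)).
have tv n := test_chain chH (tpsi n).
have L i := gradient_power_limit mO cmu (Omega_fin OM) mpsi mdpsi intD approx intB cH' H'K al0 c00 coer i.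
split; first by move=> i; exact: (L i).1.
have se0 : 0 < sob_exp N al by rewrite /sob_exp divr_gt0 ?mulr_gt0.
have mu_u : measurable_fun (Omega : set T) u by case: uW => [[[]]].
pose S n := \sum_(i < N) \int[mu]_(x in Omega) `|H' (psi n x) * pder i (psi n) x| `^ al.
apply: (@fatou_bound _ T R mu Omega mO (fun n x => `|H (psi n x)| `^ sob_exp N al) _
  (fun n => (sob_const N M al * S n) `^ (N%:R / (N%:R - al)))).
- by move=> n; exact: measurable_norm_powR (mtest (tv n)).
- exact: measurable_norm_powR (measurable_comp_continuous cH mu_u).
- by move=> n x _; exact: powR_ge0.
- apply: (@ae_imply _ T R mu) approx => x h1 Ox; have [pu _ _] := h1 Ox.
  apply: (@continuous_cvg _ _ _ _ _ _ (fun t : R => `|H t| `^ sob_exp N al)) => //.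
  apply: (@continuous_comp _ _ _ H (fun t : R => `|t| `^ sob_exp N al)); first exact: cH.
  exact: (continuous_norm_powR (ltW se0)).
- move=> n.
  have cv : continuous (fun x => H (psi n x)) := smooth_continuous (test_smooth_expr (tv n)).
  have i1 := integrable_continuous oO OM (continuous_powR_comp (ltW se0) cv).
  rewrite (EFin_Rintegral mO i1) lee_fin.
  have cp : forall i, continuous (fun x => H' (psi n x) * pder i (psi n) x).
    move=> i; rewrite (_ : (fun x => _) = pder i (fun x => H (psi n x))).
      exact: smooth_continuous (smooth_pder i (test_smooth_expr (tv n))).
    by apply/funext => x; rewrite (pder_chain i x chH (tpsi n)).
  have v0 (x : V) i : M <= `|x ord0 i| -> H (psi n x) = 0.
    by move=> Mx; apply: (test_eq0 (tv n)) => /OM /(_ i); rewrite ltNge Mx.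
  have := sobolev M0 hN al1 alN cv cp (fun i x => is_derive_chain i x chH (tpsi n)) v0.
  have z x : ~ Omega x -> psi n x = 0 by exact: test_eq0.
  rewrite -(Rintegral_Omega_cube OM); last first.
    by move=> x /z ->; rewrite H0 normr0 powR0// gt_eqF.
  under [X in _ <= _ * X -> _]eq_bigr => i _.
    rewrite -(Rintegral_Omega_cube OM); last first.
      by move=> x nx; rewrite (test_eq0 (test_pder i (tpsi n)) nx) mulr0 normr0 powR0// gt_eqF.
    over.
  set X := (X in X `^ _ <= _) => XS.
  have X0 : 0 <= X by apply: Rintegral_ge0 => x _; exact: powR_ge0.
  have e0 : 0 <= N%:R / (N%:R - al) by rewrite divr_ge0 ?(ltW N0) ?(ltW Na0).
  have := ler_powR2r e0 (powR_ge0 _ _) XS.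
  by rewrite -powRrM mulrA divfK ?mulfV ?powRr1 ?gt_eqF.
- have SS : sob_const N M al * S n @[n --> \oo] -->
     sob_const N M al * \sum_(i < N) \int[mu]_(x in Omega) `|H' (u x) * ud i x| `^ al.
    apply: cvgM; first exact: cvg_cst.
    apply: cvg_big => [|i _]; first exact: add_continuous.
    exact: (L i).2.
  have e0 : 0 <= N%:R / (N%:R - al) by rewrite divr_ge0 ?(ltW N0) ?(ltW Na0).
  have sc0 : 0 <= sob_const N M al by exact: powR_ge0.
  have Sn n : 0 <= S n.
    by apply: sumr_ge0 => i _; apply: Rintegral_ge0 => x _; exact: powR_ge0.
  apply: (cvg_powR_ge0 e0 _ SS) => n; exact: mulr_ge0.
Qed.

End weak_identities.

(** * Truncation and growth weights *)
Section weights.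
Variable R : realType.
Implicit Types p e s t : R.

Let pow1R s : (1 : R) `^ s = 1. Proof. by rewrite powR1. Qed.

Let quad_gt0 p t : 0 <= p -> 0 < 1 + p * (t * t).
Proof. by move=> p0; rewrite ltr_pwDl// mulr_ge0// -expr2 sqr_ge0. Qed.

Lemma is_derive_quad_pow p s t : 0 <= p ->
  is_derive t 1 (fun t : R => (1 + p * (t * t)) `^ s)
    (2 * s * (p * t) * (1 + p * (t * t)) `^ (s - 1)).
Proof.
move=> p0.
have d1 := is_derive_id t (1 : R).
have d2 := is_deriveD (is_derive_cst (1 : R) t 1) (is_deriveZ p (is_deriveM d1 d1)).
have d3 : is_derive t 1 (fun t : R => 1 + p * (t * t)) (0 + p *: (t *: 1 + t *: 1)) by exact: d2.
have := @is_derive_scalar_comp R R _ _ t 1 _ _ (is_derive1_powR s (quad_gt0 t p0)) d3.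
rewrite (_ : 2 * s * (p * t) * _ = s * (1 + p * (t * t)) `^ (s - 1) * (0 + p *: (t *: 1 + t *: 1)))//.
by rewrite add0r -![_ *: _]/(_ * _); ring.
Qed.

(** ((1 + p t^2) / (1 + e t^2))^s.  For p = 0 and s = 1 / 2, t times the weight is a
    smooth truncation of t at height e^(- 1 / 2); for p = 1 and small e it grows like
    |t|^(1 + 2 s) up to the scale e^(- 1 / 2) and linearly beyond. *)
Definition weight p e s t := (1 + p * (t * t)) `^ s * (1 + e * (t * t)) `^ (- s).

(** The derivative of t weight(t) is weight(t) (1 + 2 s log_slope(t)). *)
Definition log_slope p e t := p * (t * t) / (1 + p * (t * t)) - e * (t * t) / (1 + e * (t * t)).

Lemma weight_gt0 p e s t : 0 <= p -> 0 <= e -> 0 < weight p e s t.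
Proof. by move=> p0 e0; rewrite mulr_gt0// powR_gt0// quad_gt0. Qed.

Lemma weight_powR p e s a t : 0 <= p -> 0 <= e -> weight p e s t `^ a = weight p e (a * s) t.
Proof.
move=> p0 e0; rewrite /weight powRM ?powR_ge0// -!powRrM.
by rewrite mulNr ![s * a]mulrC.
Qed.

Lemma weightE p e s t : 0 <= p -> 0 <= e ->
  weight p e s t = ((1 + p * (t * t)) / (1 + e * (t * t))) `^ s.
Proof.
move=> p0 e0; rewrite /weight powRM ?invr_ge0 ?(ltW (quad_gt0 _ _))//.
by rewrite -powR_inv1 ?(ltW (quad_gt0 _ _))// -powRrM mulN1r.
Qed.

Lemma chain_fun_weight p e s : 0 <= p -> 0 <= e ->
  chain_fun (fun t => t * weight p e s t)
    (fun t => weight p e s t * (1 + 2 * s * log_slope p e t)).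
Proof.
move=> p0 e0.
have dw (t : R) : is_derive t 1 (weight p e s) _ := is_deriveM (is_derive_quad_pow s t p0) (is_derive_quad_pow (- s) t e0).
have cq (q b : R) : 0 <= q -> continuous (fun t : R => (1 + q * (t * t)) `^ b).
  by move=> q0 t; exact: is_derive1_continuous (is_derive_quad_pow b t q0).
have cpq (q : R) : 0 <= q -> continuous (fun t : R => q * (t * t) / (1 + q * (t * t))).
  move=> q0; rewrite (_ : (fun t => _) = (fun t => q * (t * t) * (1 + q * (t * t)) `^ (-1))).
    move=> t; apply: cvgM; last exact: cq.
    by apply: cvgM; [exact: cvg_cst|apply: cvgM; exact: cvg_id].
  by apply/funext => t; rewrite powR_inv1// ltW// quad_gt0.
split.
- by rewrite mul0r.
- move=> t; have := is_deriveM (is_derive_id t (1 : R)) (dw t).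
  set A := (X in is_derive _ _ _ X -> _); set A' := (X in _ -> is_derive _ _ _ X).
  suff -> : A = A' by [].
  rewrite /A /A' /= /weight /log_slope -![_ *: _]/(_ * _).
  have qn : 1 + p * (t * t) != 0 by rewrite gt_eqF// quad_gt0.
  have en : 1 + e * (t * t) != 0 by rewrite gt_eqF// quad_gt0.
  have powB (x b : R) : 0 < x -> x `^ (b - 1) = x `^ b / x.
    move=> x0; rewrite powRD; last by rewrite (gt_eqF x0) implybT.
    by rewrite powR_inv1// ltW.
  rewrite !powB ?quad_gt0//.
  move: qn en; set P := _ `^ s; set Q := _ `^ (- s) => qn en.
  field.
  by rewrite qn en.
- move=> t; apply: cvgM; first by apply: cvgM; exact: cq.
  apply: cvgD; first exact: cvg_cst.
  by apply: cvgM; [exact: cvg_cst|apply: cvgB; exact: cpq].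
- move=> N f sf; apply: SmoothMul => //.
  have sq (q b : R) : 0 <= q -> smooth_expr (fun x => (1 + q * (f x * f x)) `^ b).
    move=> q0; apply: SmoothPow => [|x]; last exact: quad_gt0.
    by apply: SmoothAdd; [exact: SmoothCst|apply: SmoothMul; [exact: SmoothCst|exact: SmoothMul]].
  by apply: SmoothMul; exact: sq.
Qed.

Lemma frac_bounds p t : 0 <= p -> 0 <= p * (t * t) / (1 + p * (t * t)) <= 1.
Proof.
move=> p0; have q0 := quad_gt0 t p0.
have pt : 0 <= p * (t * t) by rewrite mulr_ge0// -expr2 sqr_ge0.
by rewrite divr_ge0 ?(ltW q0)//= ler_pdivrMr// mul1r lerDr.
Qed.

Lemma weight_trunc_le1 e t : 0 <= e -> weight 0 e 2^-1 t <= 1.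
Proof.
move=> e0; rewrite weightE// -[leRHS](pow1R 2^-1); apply: ler_powR2r; first by rewrite invr_ge0.
  by rewrite mul0r addr0 mul1r invr_ge0 ltW// quad_gt0.
by rewrite mul0r addr0 mul1r invf_le1 ?quad_gt0// lerDl mulr_ge0// -expr2 sqr_ge0.
Qed.

Lemma trunc_slope e t : 0 <= e -> 0 <= 1 + 2 * 2^-1 * log_slope 0 e t <= 1.
Proof.
move=> e0; rewrite mulfV// mul1r /log_slope !mul0r sub0r.
by have /andP[h1 h2] := frac_bounds t e0; rewrite subr_ge0 h2/= gerBl.
Qed.

Lemma trunc_le e t : 0 < e -> `|t * weight 0 e 2^-1 t| <= e^-1 `^ 2^-1.
Proof.
move=> e0; have q0 := quad_gt0 t (ltW e0).
rewrite normrM (ger0_norm (ltW (weight_gt0 _ _ _ _)))// ?(ltW e0)//.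
rewrite weightE ?(ltW e0)// mul0r addr0 mul1r.
have -> : `|t| = (t * t) `^ 2^-1.
  by rewrite -expr2 powR12_sqrt ?sqr_ge0// sqrtr_sqr.
have t0 : 0 <= t * t by rewrite -expr2 sqr_ge0.
rewrite -powRM ?invr_ge0 ?(ltW q0)//; apply: ler_powR2r; first by rewrite invr_ge0.
  by rewrite mulr_ge0 ?invr_ge0 ?(ltW q0).
by rewrite ler_pdivrMr// ler_pdivlMl// lerDr.
Qed.

Lemma cvg_quad_pow (e : nat -> R) s t : (forall n, 0 <= e n) -> e n @[n --> \oo] --> (0 : R) ->
  (1 + e n * (t * t)) `^ s @[n --> \oo] --> (1 : R).
Proof.
move=> e0 ecvg.
have cc : {for (1 : R), continuous (fun x : R => x `^ s)}.
  by apply: is_derive1_continuous; exact: is_derive1_powR.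
rewrite -[X in _ --> X](pow1R s); apply: (continuous_cvg _ cc).
rewrite -[X in _ --> X](addr0 1) -(mul0r (t * t)).
by apply: cvgD; [exact: cvg_cst|apply: cvgM => //; exact: cvg_cst].
Qed.

Lemma cvg_weight p (e : nat -> R) s t : 0 <= p -> (forall n, 0 <= e n) -> e n @[n --> \oo] --> (0 : R) ->
  weight p (e n) s t @[n --> \oo] --> (1 + p * (t * t)) `^ s.
Proof.
move=> p0 e0 ecvg; rewrite -[X in _ --> X]mulr1.
by apply: cvgM; [exact: cvg_cst|exact: cvg_quad_pow].
Qed.

Lemma cvg_trunc_slope (e : nat -> R) t : (forall n, 0 <= e n) -> e n @[n --> \oo] --> (0 : R) ->
  1 + 2 * 2^-1 * log_slope 0 (e n) t @[n --> \oo] --> (1 : R).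
Proof.
move=> e0 ecvg; rewrite -[X in _ --> X](addr0 1).
apply: cvgD; first exact: cvg_cst.
rewrite -[X in _ --> X](mulr0 (2 * 2^-1)).
apply: cvgM; first exact: cvg_cst.
rewrite /log_slope mul0r mul0r -[X in _ --> X](subrr (0 : R)).
apply: cvgB; first exact: cvg_cst.
rewrite -[X in _ --> X](mul0r (1 : R)); apply: cvgM.
  by rewrite -[X in _ --> X](mul0r (t * t)); apply: cvgM => //; exact: cvg_cst.
have := cvg_quad_pow (-1) t e0 ecvg.
rewrite (_ : (fun n => _ `^ _) = (fun n => (1 + e n * (t * t))^-1))//.
by apply/funext => n; rewrite powR_inv1// ltW// quad_gt0.
Qed.

Variable e : R.
Hypothesis e01 : 0 < e <= 1.
Let e0 : 0 < e. Proof. by case/andP: e01. Qed.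
Let e1 : e <= 1. Proof. by case/andP: e01. Qed.
Let tt0 t : 0 <= t * t. Proof. by rewrite -expr2 sqr_ge0. Qed.

Lemma weight_le s t : 0 <= s -> weight 1 e s t <= e^-1 `^ s.
Proof.
move=> s0; rewrite weightE ?(ltW e0)//; apply: ler_powR2r => //.
  by rewrite divr_ge0// ltW// quad_gt0// (ltW e0).
rewrite ler_pdivrMr ?quad_gt0 ?(ltW e0)// ler_pdivlMl// mulrDr mulr1 mul1r lerD2r //.
Qed.

Lemma weight_le_quad s t : 0 <= s -> weight 1 e s t <= (1 + t * t) `^ s.
Proof.
move=> s0; rewrite weightE ?(ltW e0)// mul1r; apply: ler_powR2r => //.
  by rewrite divr_ge0// ltW// ?quad_gt0// ?(ltW e0)// -[t * t]mul1r quad_gt0.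
rewrite ler_pdivrMr ?quad_gt0 ?(ltW e0)// ler_peMr ?addr_ge0//.
by rewrite lerDl mulr_ge0// ltW.
Qed.

Lemma growth_slope s t : 0 <= s -> 1 <= 1 + 2 * s * log_slope 1 e t <= 1 + 2 * s.
Proof.
move=> s0; rewrite lerDl lerD2l.
have s2 : 0 <= 2 * s by rewrite mulr_ge0.
have /andP[h1 h2] := frac_bounds t (@ler01 R).
have /andP[h3 h4] := frac_bounds t (ltW e0).
have h5 : e * (t * t) / (1 + e * (t * t)) <= 1 * (t * t) / (1 + 1 * (t * t)).
  rewrite ler_pdivrMr ?quad_gt0 ?(ltW e0)// mulrAC ler_pdivlMr ?quad_gt0//.
  have h5 : e * (t * t) <= t * t by rewrite ler_piMl.
  by lra.
apply/andP; split; first by rewrite mulr_ge0// subr_ge0.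
by rewrite ler_piMr// lerBlDr (le_trans h2)// lerDl.
Qed.

End weights.

(** * Testing with functions of linear growth *)
Section linear_growth.
Context d (T : measurableType d) (R : realType) (mu : {measure set T -> \bar R}).
Variable D : set T.
Hypothesis mD : measurable D.
Hypothesis cmu : measure_is_complete mu.
Variables (u f E : T -> R).
Hypothesis mu_u : measurable_fun D u.
Hypothesis E0 : forall x, D x -> 0 <= E x.
Hypothesis intE : mu.-integrable D (EFin \o E).
Hypothesis intfu : mu.-integrable D (EFin \o (fun x => f x * u x)).
Hypothesis identity : forall G G' (K : R), chain_fun G G' ->
  (forall t, `|G t| <= K) -> (forall t, `|G' t| <= K) ->
  mu.-integrable D (EFin \o (fun x => f x * G (u x))) /\
  \int[mu]_(x in D) (E x * G' (u x)) = \int[mu]_(x in D) (f x * G (u x)).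

(** Apply the bounded case to G composed with a smooth truncation, whose height tends
    to infinity; |G(tau t)| <= K |t| makes f u dominate the right side. *)
Lemma identity_linear_growth G G' (K : R) : chain_fun G G' ->
  (forall t, `|G t| <= K * `|t|) -> (forall t, `|G' t| <= K) ->
  mu.-integrable D (EFin \o (fun x => f x * G (u x))) /\
  \int[mu]_(x in D) (E x * G' (u x)) = \int[mu]_(x in D) (f x * G (u x)).
Proof.
move=> chG GK G'K; have cG := chain_fun_continuous chG; have [_ _ cG' _] := chG.
have K0 : 0 <= K by exact: le_trans (G'K 0).
pose e n : R := n.+1%:R^-1.
have e0 n : 0 < e n by rewrite invr_gt0.
have ecvg : e n @[n --> \oo] --> (0 : R) by exact: cvg_harmonic.
pose tau n t : R := t * weight 0 (e n) 2^-1 t.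
pose dtau n t : R := weight 0 (e n) 2^-1 t * (1 + 2 * 2^-1 * log_slope 0 (e n) t).
have chtau n : chain_fun (tau n) (dtau n) by apply: chain_fun_weight => //; exact: ltW.
have chGt n := chain_fun_comp chG (chtau n).
have wt0 n t : 0 <= weight 0 (e n) 2^-1 t by exact/ltW/weight_gt0/ltW.
have wt1 n t : weight 0 (e n) 2^-1 t <= 1 by exact/weight_trunc_le1/ltW.
have dtau1 n t : `|dtau n t| <= 1.
  have /andP[h1 h2] := trunc_slope t (ltW (e0 n)).
  rewrite ger0_norm; first exact: (mulr_ile1 (wt0 n t) h1 (wt1 n t) h2).
  exact: (mulr_ge0 (wt0 n t) h1).
have taut n t : `|tau n t| <= `|t|.
  by rewrite normrM (ger0_norm (wt0 n t)) ler_piMr.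
have tau_cvg t : tau n t @[n --> \oo] --> t.
  rewrite -[X in _ --> X](mulr1 t); apply: cvgM; first exact: cvg_cst.
  have := @cvg_weight R 0 e 2^-1 t (lexx 0) (fun n => ltW (e0 n)) ecvg.
  by rewrite mul0r addr0 powR1.
have dtau_cvg t : dtau n t @[n --> \oo] --> (1 : R).
  rewrite -[X in _ --> X](mulr1 1); apply: cvgM.
    have := @cvg_weight R 0 e 2^-1 t (lexx 0) (fun n => ltW (e0 n)) ecvg.
    by rewrite mul0r addr0 powR1.
  exact: (@cvg_trunc_slope R e t (fun n => ltW (e0 n)) ecvg).
have GtK n t : `|G (tau n t)| <= K * `|t|.
  by apply: (le_trans (GK _)); rewrite ler_wpM2l.
have G'tK n t : `|G' (tau n t) * dtau n t| <= K.
  by rewrite normrM -[leRHS]mulr1 ler_pM.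
have idn n : mu.-integrable D (EFin \o (fun x => f x * G (tau n (u x)))) /\
    \int[mu]_(x in D) (E x * (G' (tau n (u x)) * dtau n (u x))) =
    \int[mu]_(x in D) (f x * G (tau n (u x))).
  pose K' := Num.max K (K * (e n)^-1 `^ 2^-1).
  apply: (identity (K := K') (chGt n)) => t; rewrite le_max.
    apply/orP; right; apply: (le_trans (GK _)); rewrite ler_wpM2l//.
    exact: trunc_le.
  by rewrite G'tK.
have mE : measurable_fun D E by apply/measurable_EFinP; exact: measurable_int intE.
have [_ L1] : mu.-integrable D (EFin \o (fun x => E x * G' (u x))) /\
   \int[mu]_(x in D) (E x * (G' (tau n (u x)) * dtau n (u x))) @[n --> \oo] -->
   \int[mu]_(x in D) (E x * G' (u x)).
  apply: (dominated_convergence_Rintegral mD cmu (G := fun x => K * E x)).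
  - move=> n; apply: measurable_funM => //.
    by have [_ _ c _] := chGt n; exact: measurable_comp_continuous c mu_u.
  - apply: aeW => x Dx; apply: cvgM; first exact: cvg_cst.
    rewrite -[X in _ --> X]mulr1; apply: cvgM; last exact: dtau_cvg.
    by apply: continuous_cvg; [exact: cG'|exact: tau_cvg].
  - exact: (integrableZl mD K intE).
  - apply: aeW => x Dx n; rewrite normrM mulrC (ger0_norm (E0 Dx)).
    by rewrite ler_wpM2r ?E0.
have [intG L2] : mu.-integrable D (EFin \o (fun x => f x * G (u x))) /\
   \int[mu]_(x in D) (f x * G (tau n (u x))) @[n --> \oo] -->
   \int[mu]_(x in D) (f x * G (u x)).
  apply: (dominated_convergence_Rintegral mD cmu (G := fun x => K * `|f x * u x|)).
  - by move=> n; apply/measurable_EFinP; exact: measurable_int (idn n).1.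
  - apply: aeW => x Dx; apply: cvgM; first exact: cvg_cst.
    by apply: continuous_cvg; [exact: cG|exact: tau_cvg].
  - exact: (integrableZl mD K (integrable_abse intfu)).
  - apply: aeW => x Dx n; rewrite !normrM mulrCA ler_wpM2l//.
split => //.
move: L1; under eq_cvg do rewrite (idn _).2.
by move=> L1; exact: (cvg_unique _ L1 L2).
Qed.

End linear_growth.

(** * Absorbing the potential *)
Section absorption.
Context d (T : measurableType d) (R : realType) (mu : {measure set T -> \bar R}).
Variable D : set T.
Hypothesis mD : measurable D.
Hypothesis cmu : measure_is_complete mu.
Hypothesis finD : (mu D < +oo)%E.
Implicit Types f g h : T -> R.

Lemma integrable_dominated f g : measurable_fun D f -> mu.-integrable D (EFin \o g) ->
  (forall x, D x -> `|f x| <= g x) -> mu.-integrable D (EFin \o f).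
Proof.
move=> mf intg fg; apply: (le_integrable mD _ _ intg); first exact/measurable_EFinP.
by move=> x Dx; rewrite /= lee_fin (le_trans (fg x Dx))// ler_norm.
Qed.

Lemma integrable_of_powR f (p : R) : 1 <= p -> measurable_fun D f ->
  mu.-integrable D (EFin \o (fun x => `|f x| `^ p)) -> mu.-integrable D (EFin \o f).
Proof.
move=> p1 mf intf.
apply: (integrable_dominated mf (integrableD mD (integrable_cst_fin mD finD 1) intf)) => x _ /=.
have [f1|/ltW f1] := leP `|f x| 1; first by rewrite (le_trans f1)// lerDl powR_ge0.
apply: (@le_trans _ _ (`|f x| `^ p)); last by rewrite lerDr.
by rewrite -[leLHS]powRr1// ler_powR.
Qed.

Variables (a : T -> R) (p : R).
Hypothesis p1 : 1 <= p.
Hypothesis ma : measurable_fun D a.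
Hypothesis a0 : forall x, D x -> 0 <= a x.
Hypothesis intap : mu.-integrable D (EFin \o (fun x => `|a x| `^ p)).

Definition tail (k : R) (x : T) : R := if a x <= k then 0 else a x.

Lemma tail_measurable k : measurable_fun D (tail k).
Proof.
apply: measurable_fun_if => //.
- by apply: measurable_fun_ler => //; exact: measurable_cst.
- by apply: (measurable_funS _ _ ma) => // x [].
Qed.

Lemma tail_power_small (c e : R) : 0 < c -> 0 < e -> exists2 k : R, 0 <= k &
  (\int[mu]_(x in D) `|tail k x| `^ p) `^ c <= e.
Proof.
move=> c0 e0.
have [_ lim] : mu.-integrable D (EFin \o (fun=> 0 : R)) /\
   \int[mu]_(x in D) `|tail n%:R x| `^ p @[n --> \oo] --> \int[mu]_(x in D) (0 : R).
  apply: (dominated_convergence_Rintegral mD cmu (G := fun x => `|a x| `^ p)).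
  - by move=> n; exact: measurable_norm_powR (tail_measurable _).
  - apply: aeW => x Dx; apply: cvg_near_cst.
    near=> n; rewrite /tail ifT ?normr0 ?powR0 ?gt_eqF ?(lt_le_trans _ p1)//.
    by apply: (le_trans (ler_norm _)); near: n; exact: nbhs_infty_ger.
  - exact: intap.
  - apply: aeW => x Dx n; rewrite ger0_norm ?powR_ge0//.
    rewrite /tail; case: ifP => // _; rewrite normr0 powR0 ?powR_ge0//.
    by rewrite gt_eqF// (lt_le_trans _ p1).
rewrite Rintegral_cst// mul0r in lim.
have := cvg_powR_ge0 (ltW c0) _ lim.
rewrite powR0 ?gt_eqF// => /(_ _)/cvgr_le.
have h0 n : 0 <= \int[mu]_(x in D) `|tail n%:R x| `^ p.
  by apply: Rintegral_ge0 => x _; exact: powR_ge0.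
move=> /(_ h0 e e0) [n _ hn]; exists n%:R => //.
exact: (hn n (leqnn n)).
Unshelve. all: by end_near. Qed.

(** Hoelder is applied only where a exceeds k. *)
Lemma absorb_potential h (q k : R) : measurable_fun D h -> (forall x, D x -> 0 <= h x) ->
  0 < q -> p^-1 + q^-1 = 1 -> 0 <= k ->
  mu.-integrable D (EFin \o h) ->
  mu.-integrable D (EFin \o (fun x => `|h x| `^ q)) ->
  mu.-integrable D (EFin \o (fun x => a x * h x)) /\
  \int[mu]_(x in D) (a x * h x) <= k * \int[mu]_(x in D) h x +
    (\int[mu]_(x in D) `|tail k x| `^ p) `^ p^-1 *
    (\int[mu]_(x in D) `|h x| `^ q) `^ q^-1.
Proof.
move=> mh h0 q0 pq k0 inth inthq.
have p0 : 0 < p by exact: lt_le_trans p1.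
have [intah _] := hoelder_Rintegral mD ma mh p0 q0 pq intap inthq.
have mt := tail_measurable k.
have intt : mu.-integrable D (EFin \o (fun x => `|tail k x| `^ p)).
  apply: (integrable_dominated _ intap); first exact: measurable_norm_powR.
  move=> x Dx.
  rewrite ger0_norm ?powR_ge0// /tail; case: ifP => // _.
  by rewrite normr0 powR0 ?powR_ge0// gt_eqF.
have [intth le_th] := hoelder_Rintegral mD mt mh p0 q0 pq intt inthq.
split => //; apply: (le_trans _ (lerD (lexx _) le_th)).
have intkh := integrableZl mD k inth.
have intth' := integrable_abse intth.
rewrite -RintegralZl// -RintegralD//.
apply: le_Rintegral => //; first exact: (integrableD mD intkh intth').
move=> x Dx; have hx := h0 x Dx; rewrite /tail.
case: ifPn => [ak|_]; first by rewrite mul0r normr0 addr0 ler_wpM2r.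
by rewrite ger0_norm ?mulr_ge0 ?a0// lerDr mulr_ge0.
Qed.

End absorption.

(** * The Brezis-Kato iteration *)
Section pointwise.
Variables (R : realType) (al s e : R).
Hypothesis al1 : 1 <= al.
Hypothesis s0 : 0 <= s.
Hypothesis e01 : 0 < e <= 1.
Implicit Types t : R.

Let e0 : 0 < e. Proof. by case/andP: e01. Qed.
Let al0 : 0 < al. Proof. exact: lt_le_trans al1. Qed.
Let as0 : 0 <= al * s. Proof. by rewrite mulr_ge0 // ltW. Qed.
Let wt0 b t : 0 <= weight 1 e b t. Proof. by apply/ltW/weight_gt0 => //; exact: ltW. Qed.

Lemma norm_mul_weight t : `|t * weight 1 e s t| `^ al = `|t| `^ al * weight 1 e (al * s) t.
Proof. by rewrite normrM (ger0_norm (wt0 _ _)) powRM// weight_powR// ltW. Qed.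

(** For |t| <= 1 the weight is at most 2^(al s); for |t| >= 1 it is at most |t|^al times
    itself. *)
Lemma weight_le_power t :
  weight 1 e (al * s) t <= 2 `^ (al * s) + `|t| `^ al * weight 1 e (al * s) t.
Proof.
have [t1|/ltW t1] := leP `|t| 1.
  rewrite -[leLHS]addr0 lerD ?mulr_ge0 ?powR_ge0//.
  apply: (le_trans (weight_le_quad e01 t as0)); apply: ler_powR2r => //.
    by rewrite addr_ge0// -expr2 sqr_ge0.
  by rewrite lerD2l -expr2 -real_normK ?num_real// expr_le1.
rewrite -[leLHS]add0r lerD ?powR_ge0//.
by rewrite ler_peMl// -(powRr0 `|t|) ler_powR// ltW.
Qed.

(** Same dichotomy at |t| = 1.  The bound does not involve e. *)
Lemma power_weight_le t :
  `|t| `^ al * weight 1 e (al * s) t <= 2 `^ (al * s) * (1 + `|t| `^ (al * (1 + 2 * s))).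
Proof.
have P0 : 0 <= 2 `^ (al * s) :> R by exact: powR_ge0.
have h := weight_le_quad e01 t as0.
have tt : t * t = `|t| ^+ 2 by rewrite real_normK ?num_real// expr2.
have q0 : 0 <= 1 + t * t by rewrite addr_ge0// tt exprn_ge0.
apply: (le_trans (ler_wpM2l (powR_ge0 _ _) h)).
have [t1|/ltW t1] := leP `|t| 1.
  apply: (@le_trans _ _ (1 * 2 `^ (al * s))).
    apply: ler_pM; rewrite ?powR_ge0//.
      by have := ler_powR2r (ltW al0) (normr_ge0 t) t1; rewrite powR1.
    by apply: ler_powR2r => //; rewrite lerD2l tt expr_le1.
  by rewrite mulrC ler_wpM2l// lerDl powR_ge0.
rewrite mulrDr mulr1 -[leLHS]add0r lerD//.
have q2 : 1 + t * t <= 2 * (`|t| `^ 2).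
  rewrite powR_mulrn// tt mulr_natl mulr2n lerD2r.
  by rewrite exprn_ege1.
apply: (le_trans (ler_wpM2l (powR_ge0 _ _) (ler_powR2r as0 q0 q2))).
rewrite powRM ?powR_ge0// -powRrM mulrCA ler_wpM2l// -powRD; last first.
  by rewrite (gt_eqF (lt_le_trans ltr01 t1)) implybT.
by rewrite le_eqVlt (_ : al + _ = al * (1 + 2 * s)) ?eqxx//; ring.
Qed.

(** (1 + |t|^(al - 1)) |t| <= 1 + 2 |t|^al, multiplied by the weight. *)
Lemma growth_term_le (a y t : R) : 0 <= a -> `|y| <= a * (1 + `|t| `^ (al - 1)) ->
  `|y * (t * weight 1 e (al * s) t)| <=
   2 `^ (al * s) * a + 3 * (a * (`|t| `^ al * weight 1 e (al * s) t)).
Proof.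
move=> a0 ya; have h := weight_le_power t; move: (wt0 (al * s) t) h.
set W := weight _ _ _ _ => W0 h.
have ta : `|t| * `|t| `^ (al - 1) = `|t| `^ al.
  have [->|t0] := eqVneq t 0; first by rewrite normr0 mul0r powR0// gt_eqF.
  rewrite -{1}(@powRr1 _ `|t|)// -powRD; last by rewrite normr_eq0 t0 implybT.
  by congr (_ `^ _); ring.
have t1 : `|t| <= 1 + `|t| `^ al.
  have [t1|/ltW t1] := leP `|t| 1; first by rewrite (le_trans t1)// lerDl powR_ge0.
  rewrite -[leLHS]add0r lerD// -[leLHS]powRr1// ler_powR//.
rewrite (normrM y) (normrM t) (ger0_norm W0).
apply: (@le_trans _ _ (a * ((1 + 2 * `|t| `^ al) * W))).
  rewrite (mulrA `|y|) mulrA ler_wpM2r//.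
  apply: (le_trans (ler_wpM2r (normr_ge0 _) ya)); rewrite -mulrA ler_wpM2l//.
  by rewrite mulrDl mul1r mulrC ta; lra.
rewrite [leRHS](_ : _ = a * (2 `^ (al * s) + 3 * (`|t| `^ al * W))); last by ring.
by rewrite ler_wpM2l// mulrDl mul1r -mulrA; lra.
Qed.

Lemma slope_power_le (t v w : R) : `|v| <= w ->
  `|weight 1 e s t * (1 + 2 * s * log_slope 1 e t) * v| `^ al <=
  (1 + 2 * s) `^ al * (w `^ al * weight 1 e (al * s) t).
Proof.
move=> vw; have /andP[h1 h2] := growth_slope e01 t s0.
have w0 : 0 <= w by exact: le_trans vw.
have s20 : 0 <= 1 + 2 * s by rewrite addr_ge0 ?mulr_ge0.
rewrite -(@weight_powR _ 1 e s al t) ?(ltW e0)//.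
move: (weight 1 e s t) (wt0 s t) => W W0; rewrite -powRM// -powRM ?mulr_ge0//.
apply: ler_powR2r; [exact: ltW|exact: normr_ge0|].
rewrite !normrM (ger0_norm W0) ger0_norm ?(le_trans ler01)//.
rewrite [leRHS](_ : _ = W * (1 + 2 * s) * w); last by ring.
by apply: ler_pM => //; [rewrite mulr_ge0// (le_trans ler01)|rewrite ler_wpM2l].
Qed.

End pointwise.

Lemma absorb_half (R : realType) (c Z A ah Ch kI dZ CI : R) : 0 < c ->
  c * Z <= A + 3 * ah + Ch -> ah <= kI + dZ -> 3 * dZ <= c / 2 * Z -> Ch <= CI ->
  Z <= 2 / c * (A + 3 * kI + CI).
Proof. by move=> c0 h1 h2 h3 h4; rewrite mulrAC ler_pdivlMr//; lra. Qed.

Lemma absorb_const (R : realType) (de C c Z : R) : 0 < de ->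
  de * (6 * (C + 1)) = c -> 0 <= Z -> 3 * (de * (C * Z)) <= c / 2 * Z.
Proof.
move=> de0 <- Z0; rewrite [leLHS](_ : _ = 3 * (de * C) * Z); last by ring.
by rewrite ler_wpM2r//; lra.
Qed.

Section brezis_kato.
Context d (T : measurableType d) (R : realType) (mu : {measure set T -> \bar R}).
Variable D : set T.
Hypothesis mD : measurable D.
Hypothesis cmu : measure_is_complete mu.
Hypothesis finD : (mu D < +oo)%E.
Variables (N : nat) (al c0 C0 Cs : R).
Hypothesis al1 : 1 <= al.
Hypothesis alN : al < N%:R.
Hypothesis c00 : 0 < c0.
Hypothesis C00 : 0 <= C0.
Hypothesis Cs0 : 0 <= Cs.
Variables (u w a f E : T -> R) (ud : 'I_N -> T -> R).
Hypothesis mu_u : measurable_fun D u.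
Hypothesis mw : measurable_fun D w.
Hypothesis udw : forall i x, `|ud i x| <= w x.
Hypothesis E0 : forall x, D x -> 0 <= E x.
Hypothesis intE : mu.-integrable D (EFin \o E).
Hypothesis coer : forall x, D x -> c0 * w x `^ al <= E x + C0.
Hypothesis ma : measurable_fun D a.
Hypothesis a0 : forall x, D x -> 0 <= a x.
Hypothesis inta : mu.-integrable D (EFin \o (fun x => `|a x| `^ (N%:R / al))).
Hypothesis fa : forall x, D x -> `|f x| <= a x * (1 + `|u x| `^ (al - 1)).
Hypothesis identity : forall G G' (K : R), chain_fun G G' ->
  (forall t, `|G t| <= K * `|t|) -> (forall t, `|G' t| <= K) ->
  mu.-integrable D (EFin \o (fun x => f x * G (u x))) /\
  \int[mu]_(x in D) (E x * G' (u x)) = \int[mu]_(x in D) (f x * G (u x)).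
Hypothesis sob : forall H H' (K : R), chain_fun H H' -> (forall t, `|H' t| <= K) ->
  (forall i, mu.-integrable D (EFin \o (fun x => `|H' (u x) * ud i x| `^ al))) /\
  (\int[mu]_(x in D) (`|H (u x)| `^ sob_exp N al)%:E <=
   ((Cs * \sum_(i < N) \int[mu]_(x in D) `|H' (u x) * ud i x| `^ al)
     `^ (N%:R / (N%:R - al)))%:E)%E.

Let al0 : 0 < al. Proof. exact: lt_le_trans al1. Qed.
Let N0 : 0 < N%:R :> R. Proof. exact: lt_trans alN. Qed.
Let Na0 : 0 < N%:R - al. Proof. by rewrite subr_gt0. Qed.

Definition chi : R := N%:R / (N%:R - al).
Let chi0 : 0 < chi. Proof. by rewrite divr_gt0. Qed.
Let chi1 : 1 < chi. Proof. by rewrite ltr_pdivlMr// mul1r gtrBl. Qed.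
Let sobE : sob_exp N al = al * chi.
Proof. by rewrite /sob_exp /chi mulrA. Qed.

Lemma integrable_gradient_power : mu.-integrable D (EFin \o (fun x => w x `^ al)).
Proof.
have iE := integrableZl mD c0^-1 (integrableD mD intE (integrable_cst_fin mD finD C0)).
apply: (integrable_dominated mD _ iE) => [|x Dx].
  by apply: (measurableT_comp (measurable_powR al)).
rewrite ger0_norm ?powR_ge0//= ler_pdivlMl//; exact: coer.
Qed.

Lemma integrable_bounded_mul (h b : T -> R) (K : R) : mu.-integrable D (EFin \o h) ->
  measurable_fun D b -> (forall x, `|b x| <= K) ->
  mu.-integrable D (EFin \o (fun x => h x * b x)).
Proof.
move=> ih mb bK.
have ih' := integrableZl mD K (integrable_abse ih).
apply: (integrable_dominated mD _ ih') => [|x Dx].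
  by apply: measurable_funM => //; apply/measurable_EFinP; exact: measurable_int ih.
by rewrite normrM mulrC ler_wpM2r.
Qed.

Section fixed_exponent.
Variable s : R.
Hypothesis s0 : 0 <= s.
Hypothesis intu : mu.-integrable D (EFin \o (fun x => `|u x| `^ (al * (1 + 2 * s)))).
Let as0 : 0 <= al * s. Proof. by rewrite mulr_ge0 // ltW. Qed.
Let P : R := 2 `^ (al * s).
Let P0 : 0 <= P. Proof. exact: powR_ge0. Qed.

Let inta1 : mu.-integrable D (EFin \o a).
Proof. by apply: (integrable_of_powR mD finD _ ma inta); rewrite ler_pdivlMr// mul1r ltW. Qed.

Section fixed_eps.
Variable e : R.
Hypothesis e01 : 0 < e <= 1.
Let e0 : 0 < e. Proof. by case/andP: e01. Qed.
Let W x := w x `^ al * weight 1 e (al * s) (u x).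
Let h x := `|u x| `^ al * weight 1 e (al * s) (u x).
Let wt0 b t : 0 <= weight 1 e b t. Proof. by apply/ltW/weight_gt0 => //; exact: ltW. Qed.

Let mweight b : measurable_fun D (fun x => weight 1 e b (u x)).
Proof.
apply: (measurableT_comp _ mu_u); apply: measurable_funM.
  apply: (measurableT_comp (measurable_powR _)); apply: measurable_funD => //.
  by apply: measurable_funM => //; exact: measurable_funM.
apply: (measurableT_comp (measurable_powR _)); apply: measurable_funD => //.
by apply: measurable_funM => //; exact: measurable_funM.
Qed.

Let bweight b x : 0 <= b -> `|weight 1 e b (u x)| <= e^-1 `^ b.
Proof. by move=> b0; rewrite (ger0_norm (wt0 _ _)); exact: weight_le. Qed.

Let slope_bound b t : 0 <= b ->
  `|weight 1 e b t * (1 + 2 * b * log_slope 1 e t)| <= e^-1 `^ b * (1 + 2 * b).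
Proof.
move=> b0; have /andP[h1 h2] := growth_slope e01 t b0.
have h3 := weight_le e01 t b0.
rewrite normrM (ger0_norm (wt0 b t)) ger0_norm ?(le_trans ler01)//.
by apply: ler_pM => //; exact: le_trans h1.
Qed.

Let chw b : chain_fun (fun t => t * weight 1 e b t)
    (fun t => weight 1 e b t * (1 + 2 * b * log_slope 1 e t)).
Proof. by apply: chain_fun_weight => //; exact: ltW. Qed.

Let intW : mu.-integrable D (EFin \o W).
Proof.
apply: (integrable_bounded_mul integrable_gradient_power (mweight _)) => x; exact: bweight.
Qed.

Let h0 x : 0 <= h x. Proof. by rewrite mulr_ge0// powR_ge0. Qed.

Lemma integrable_power_weight : mu.-integrable D (EFin \o h).
Proof.
have ib := integrableZl mD P (integrableD mD (integrable_cst_fin mD finD 1) intu).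
apply: (integrable_dominated mD _ ib) => [|x _].
  by apply: measurable_funM => //; exact: measurable_norm_powR.
by rewrite ger0_norm//; exact: power_weight_le.
Qed.

Let hchi x : `|h x| `^ chi = `|u x * weight 1 e s (u x)| `^ sob_exp N al.
Proof. by rewrite (ger0_norm (h0 x)) sobE powRrM norm_mul_weight// ltW. Qed.

Lemma sobolev_weight :
  (\int[mu]_(x in D) (`|u x * weight 1 e s (u x)| `^ sob_exp N al)%:E <=
   ((Cs * N%:R * (1 + 2 * s) `^ al * \int[mu]_(x in D) W x) `^ chi)%:E)%E.
Proof.
have [iH le_sob] := sob (chw s) (fun t => slope_bound t s0).
apply: (le_trans le_sob); rewrite lee_fin; apply: ler_powR2r; first exact: ltW.
  rewrite mulr_ge0//; apply: sumr_ge0 => i _.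
  by apply: Rintegral_ge0 => x _; exact: powR_ge0.
rewrite -!mulrA ler_wpM2l//; set X := _ * \int[mu]_(x in D) W x.
have -> : N%:R * X = \sum_(i < N) X by rewrite sumr_const card_ord mulr_natl.
apply: ler_sum => i _; rewrite /X -RintegralZl//.
apply: le_Rintegral => //; first exact: (integrableZl mD _ intW).
by move=> x Dx; exact: slope_power_le.
Qed.

Lemma integrable_sobolev_weight : mu.-integrable D (EFin \o (fun x => `|h x| `^ chi)).
Proof.
apply/integrableP; split.
  apply/measurable_EFinP; apply: measurable_norm_powR.
  by apply/measurable_EFinP; exact: measurable_int integrable_power_weight.
apply: (@le_lt_trans _ _ (\int[mu]_(x in D) (`|u x * weight 1 e s (u x)| `^ sob_exp N al)%:E)%E).
  rewrite le_eqVlt; apply/orP; left; apply/eqP; apply: eq_integral => x _.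
  by rewrite /= hchi ger0_norm ?powR_ge0.
by apply: (le_lt_trans sobolev_weight); rewrite ltry.
Qed.

(** The derivative of the test function is at least its weight, so the energy term
    dominates c0 times the left side up to C0 times the weight. *)
Lemma energy_inequality : mu.-integrable D (EFin \o (fun x => a x * h x)) ->
  c0 * \int[mu]_(x in D) W x <=
  P * \int[mu]_(x in D) a x + 3 * \int[mu]_(x in D) (a x * h x) +
  C0 * (P * fine (mu D) + \int[mu]_(x in D) h x).
Proof.
move=> intah.
pose b := al * s; pose K := e^-1 `^ b * (1 + 2 * b).
have e1b0 : 0 <= e^-1 `^ b by exact: powR_ge0.
have b1 : 1 <= 1 + 2 * b by rewrite lerDl mulr_ge0.
have Glin t : `|t * weight 1 e b t| <= K * `|t|.
  rewrite normrM mulrC ler_wpM2r// (ger0_norm (wt0 _ _)).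
  by apply: (le_trans (weight_le e01 t as0)); rewrite ler_peMr.
have [ifG id] := identity (chw b) Glin (fun t => slope_bound t as0).
have mG' : measurable_fun D (fun x => weight 1 e b (u x) * (1 + 2 * b * log_slope 1 e (u x))).
  by have [_ _ c _] := chw b; exact: measurable_comp_continuous c mu_u.
have iEG' := integrable_bounded_mul intE mG' (fun x => slope_bound (u x) as0).
have iwt : mu.-integrable D (EFin \o (fun x => weight 1 e b (u x))).
  apply: (integrable_dominated mD (mweight b) (integrable_cst_fin mD finD (e^-1 `^ b))) => x _.
  exact: bweight.
have iC0wt := integrableZl mD C0 iwt.
rewrite -RintegralZl//.
apply: (@le_trans _ _ (\int[mu]_(x in D) (E x * (weight 1 e b (u x) * (1 + 2 * b * log_slope 1 e (u x))) +
   C0 * weight 1 e b (u x)))).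
  apply: le_Rintegral => //; first exact: (integrableZl mD c0 intW).
    exact: (integrableD mD iEG' iC0wt).
  move=> x Dx; rewrite /W -/b; have /andP[sl _] := growth_slope e01 (u x) as0.
  move: (weight 1 e b (u x)) (wt0 b (u x)) => Q Q0.
  rewrite (mulrA c0) (mulrA (E x)); apply: (le_trans (ler_wpM2r Q0 (coer Dx))).
  by rewrite mulrDl lerD2r; apply: ler_peMr sl; rewrite mulr_ge0// E0.
rewrite RintegralD// id RintegralZl//; apply: lerD.
  have iPa := integrableZl mD P inta1; have i3ah := integrableZl mD 3 intah.
  rewrite -!RintegralZl// -RintegralD//.
  apply: le_Rintegral => //; first exact: (integrableD mD iPa i3ah).
  move=> x Dx; apply: (le_trans (ler_norm _)).
  exact: (growth_term_le al1 s0 e01 (a0 Dx) (fa Dx)).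
have inth := integrable_power_weight.
rewrite ler_wpM2l// -Rintegral_cst// -RintegralD//; last exact: (integrable_cst_fin mD finD P).
apply: le_Rintegral => //; first exact: (integrableD mD (integrable_cst_fin mD finD P) integrable_power_weight).
by move=> x Dx; exact: weight_le_power.
Qed.

End fixed_eps.

(** The level k is chosen before e, so large that the part of a above k contributes,
    after the Sobolev inequality, at most half of the left side. *)
Lemma energy_bound : exists Y : R, forall e, 0 < e <= 1 ->
  \int[mu]_(x in D) (w x `^ al * weight 1 e (al * s) (u x)) <= Y.
Proof.
pose p := N%:R / al.
have [C' [C'0 C'E]] : exists C', 0 <= C' /\ C' = Cs * N%:R * (1 + 2 * s) `^ al.
  by eexists; split; last reflexivity; rewrite !mulr_ge0 ?powR_ge0.
have p1 : 1 <= p by rewrite /p ler_pdivlMr// mul1r ltW.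
have pV : p^-1 = al / N%:R by rewrite /p invf_div.
have p0 : 0 < p^-1 by rewrite pV divr_gt0.
(* 3 de C' <= c0 / 2, where C' is the constant of the Sobolev inequality. *)
have [de de0 deE] : exists2 de, 0 < de & de * (6 * (C' + 1)) = c0.
  have C1 : 0 < 6 * (C' + 1) by rewrite mulr_gt0// ltr_wpDl.
  by exists (c0 / (6 * (C' + 1))); [rewrite divr_gt0|rewrite divfK// gt_eqF].
have [k k0 tail_de] := tail_power_small mD cmu p1 ma inta p0 de0.
pose I := \int[mu]_(x in D) (P * (1 + `|u x| `^ (al * (1 + 2 * s)))).
pose Y := P * \int[mu]_(x in D) a x + 3 * (k * I) + C0 * (P * fine (mu D) + I).
exists (2 / c0 * Y) => e e01.
have e0 : 0 < e by case/andP: e01.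
pose h x := `|u x| `^ al * weight 1 e (al * s) (u x).
have inth := integrable_power_weight e01.
have inthchi := integrable_sobolev_weight e01.
have h0 x : 0 <= h x by rewrite mulr_ge0 ?powR_ge0// ltW// weight_gt0// ltW.
have mh : measurable_fun D h by apply/measurable_EFinP; exact: measurable_int inth.
have pq : p^-1 + chi^-1 = 1.
  by rewrite pV /chi invf_div; field; rewrite gt_eqF.
have [intah le_ah] := absorb_potential mD p1 ma a0 inta mh (fun x _ => h0 x) chi0 pq k0 inth inthchi.
have := energy_inequality e01 intah.
set Z := \int[mu]_(x in D) (w x `^ al * _) => enZ.
have Z0 : 0 <= Z.
  by apply: Rintegral_ge0 => x Dx; rewrite mulr_ge0 ?powR_ge0// ltW// weight_gt0// ltW.
have hI : \int[mu]_(x in D) h x <= I.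
  apply: le_Rintegral => //.
    exact: (integrableZl mD P (integrableD mD (integrable_cst_fin mD finD 1) intu)).
  by move=> x _; exact: power_weight_le.
have sobZ : (\int[mu]_(x in D) `|h x| `^ chi) `^ chi^-1 <= C' * Z.
  have := sobolev_weight e01; rewrite -/Z -C'E.
  rewrite (_ : (\int[mu]_(x in D) _)%E = (\int[mu]_(x in D) `|h x| `^ chi)%:E); last first.
    rewrite -(EFin_Rintegral mD inthchi); apply: eq_integral => x _.
    by rewrite /h (ger0_norm (h0 x)) sobE powRrM norm_mul_weight// ltW.
  rewrite lee_fin => le1.
  have X0 : 0 <= \int[mu]_(x in D) `|h x| `^ chi.
    by apply: Rintegral_ge0 => x _; exact: powR_ge0.
  have c10 : 0 <= chi^-1 by rewrite invr_ge0 ltW.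
  have le2 := ler_powR2r c10 X0 le1.
  have CZ0 : 0 <= C' * Z by exact: (mulr_ge0 C'0 Z0).
  apply: (le_trans le2).
  by rewrite -powRrM mulfV; [rewrite powRr1|rewrite gt_eqF].
have ah_le : \int[mu]_(x in D) (a x * h x) <= k * I + de * (C' * Z).
  apply: (le_trans le_ah); apply: lerD; first by rewrite ler_wpM2l.
  by apply: ler_pM; rewrite ?powR_ge0.
have deC := absorb_const de0 deE Z0.
have C0h : C0 * (P * fine (mu D) + \int[mu]_(x in D) h x) <= C0 * (P * fine (mu D) + I).
  exact: (ler_wpM2l C00 (lerD (lexx _) hI)).
exact: (absorb_half c00 enZ ah_le deC C0h).
Qed.

(** Fatou as e tends to 0, and |t|^(1 + 2 s) <= |t| (1 + t^2)^s. *)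
Lemma integrability_step :
  mu.-integrable D (EFin \o (fun x => `|u x| `^ (al * chi * (1 + 2 * s)))).
Proof.
have [Y YP] := energy_bound.
pose e n : R := n.+1%:R^-1.
have e01 n : 0 < e n <= 1 by rewrite invr_gt0 ltr0n/= invf_le1 ?ler1n ?ltr0n.
have e0 n : 0 <= e n by have /andP[/ltW] := e01 n.
have ecvg : e n @[n --> \oo] --> (0 : R) by exact: cvg_harmonic.
have se0 : 0 <= sob_exp N al by rewrite sobE mulr_ge0// ltW.
pose g x := `|u x * (1 + 1 * (u x * u x)) `^ s| `^ sob_exp N al.
have mg : measurable_fun D g.
  apply: measurable_norm_powR; apply: measurable_funM => //.
  apply: (measurableT_comp (measurable_powR _)); apply: measurable_funD => //.
  by apply: measurable_funM => //; exact: measurable_funM.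
have mf n : measurable_fun D (fun x => `|u x * weight 1 (e n) s (u x)| `^ sob_exp N al).
  apply: measurable_norm_powR.
  exact: measurable_comp_continuous (chain_fun_continuous (chain_fun_weight s ler01 (e0 n))) mu_u.
pose C' := Cs * N%:R * (1 + 2 * s) `^ al.
have C'0 : 0 <= C' by rewrite !mulr_ge0 ?powR_ge0.
have intg : mu.-integrable D (EFin \o g).
  apply/integrableP; split; first exact/measurable_EFinP.
  apply: (@le_lt_trans _ _ ((C' * Y) `^ chi)%:E); last by rewrite ltry.
  rewrite (eq_integral (fun x => (g x)%:E)); last first.
    by move=> x _; rewrite /= ger0_norm ?powR_ge0.
  apply: (fatou_bound mD mf mg (fun n x _ => powR_ge0 _ _) _ _ (cvg_cst ((C' * Y) `^ chi))).
    apply: aeW => x Dx.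
    apply: (@continuous_cvg _ _ _ _ _ _ (fun t : R => `|t| `^ sob_exp N al)).
      exact: (continuous_norm_powR se0).
    by apply: cvgM; [exact: cvg_cst|exact: (@cvg_weight R 1 e s (u x) ler01 e0 ecvg)].
  move=> n; apply: (le_trans (sobolev_weight (e01 n))); rewrite lee_fin.
  have Z0 : 0 <= \int[mu]_(x in D) (w x `^ al * weight 1 (e n) (al * s) (u x)).
    by apply: Rintegral_ge0 => x Dx; rewrite mulr_ge0 ?powR_ge0// ltW// weight_gt0.
  apply: ler_powR2r; [exact: ltW|exact: (mulr_ge0 C'0 Z0)|].
  exact: (ler_wpM2l C'0 (YP _ (e01 n))).
apply: (integrable_dominated mD _ intg); first exact: measurable_norm_powR.
move=> x _; rewrite ger0_norm ?powR_ge0// /g.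
rewrite [al * chi * _]mulrC powRrM -sobE; apply: (ler_powR2r se0 (powR_ge0 _ _)).
rewrite normrM (ger0_norm (powR_ge0 _ _)) mul1r.
have [->|u0] := eqVneq (u x) 0.
  by rewrite normr0 powR0 ?mul0r// gt_eqF// ltr_pwDl// mulr_ge0.
rewrite powRD; last by rewrite normr_eq0 u0 implybT.
rewrite powRr1// ler_wpM2l// powRrM; apply: (ler_powR2r s0 (powR_ge0 _ _)).
by rewrite powR_mulrn// real_normK ?num_real// expr2 lerDr.
Qed.

End fixed_exponent.

(** The exponents al chi^n are reached by induction, and they are unbounded; between
    them, |u|^q <= 1 + |u|^r for q <= r. *)
Lemma integrable_all_powers (q : R) : 0 <= q ->
  mu.-integrable D (EFin \o (fun x => `|u x| `^ q)).
Proof.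
move=> q0.
have chid : chain_fun (fun t : R => t) (cst 1).
  split => // [t|t]; first exact: is_derive_id.
  exact: cvg_cst.
have pow n : mu.-integrable D (EFin \o (fun x => `|u x| `^ (al * chi ^+ n.+1))).
  elim: n => [|n ih].
    rewrite expr1 -sobE; have [_ h] := sob chid (fun=> lexx `|1 : R|).
    apply/integrableP; split; first exact/measurable_EFinP/measurable_norm_powR.
    apply: (le_lt_trans _ (ltry _)); apply: (le_trans _ h).
    rewrite le_eqVlt; apply/orP; left; apply/eqP; apply: eq_integral => x _.
    by rewrite /= ger0_norm ?powR_ge0.
  pose s := (chi ^+ n.+1 - 1) / 2.
  have s0 : 0 <= s by rewrite divr_ge0// subr_ge0 exprn_ege1// ltW.
  have sE : 1 + 2 * s = chi ^+ n.+1 by rewrite /s; field.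
  have := @integrability_step s s0; rewrite sE => /(_ ih).
  by rewrite [chi ^+ n.+2]exprS mulrA.
have [n qn] : exists n, q <= al * chi ^+ n.+1.
  have c1 : `|chi^-1| < 1 by rewrite ger0_norm ?invr_ge0 ?(ltW chi0)// invf_lt1.
  have q1 : 0 < (q + 1)^-1 by rewrite invr_gt0 ltr_wpDl.
  have := cvg_expr c1 => /cvgr_lt/(_ _ q1)[n _ /(_ n (leqnn n))/=].
  rewrite exprVn ltf_pV2 ?posrE ?exprn_gt0 ?ltr_wpDl// => qn; exists n.
  apply: (@le_trans _ _ (chi ^+ n)); first by rewrite (le_trans _ (ltW qn))// lerDl.
  apply: (@le_trans _ _ (chi ^+ n.+1)).
    by rewrite exprS ler_peMl ?exprn_ge0 ?(ltW chi0) ?(ltW chi1).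
  by rewrite ler_peMl// exprn_ge0// ltW.
have ib := integrableD mD (integrable_cst_fin mD finD 1) (pow n).
apply: (integrable_dominated mD _ ib); first exact: measurable_norm_powR.
move=> x _; rewrite ger0_norm ?powR_ge0//=.
have [u1|/ltW u1] := leP `|u x| 1.
  have := ler_powR2r q0 (normr_ge0 _) u1; rewrite powR1 => /le_trans; apply.
  by rewrite lerDl powR_ge0.
by rewrite -[leLHS]add0r lerD// ler_powR.
Qed.

End brezis_kato.

(** * Integrability of weak solutions *)
Section Lp_restriction.
Context d (T : measurableType d) (R : realType) (mu : {measure set T -> \bar R}).
Variable D : set T.
Hypothesis mD : measurable D.

Lemma Lfun_restrict (h : T -> R) (r : R) : 0 < r ->
  (h \_ D \in Lfun mu r%:E) <->
  measurable_fun D h /\ mu.-integrable D (EFin \o (fun x => `|h x| `^ r)).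
Proof.
move=> r0.
have mE : measurable_fun setT (h \_ D) <-> measurable_fun D h.
  by have := measurable_restrict h mD (@measurableT _ T); rewrite setTI; tauto.
have int0 : (0 <= \int[mu]_(x in D) (`|h x| `^ r)%:E)%E.
  by apply: integral_ge0 => x _; rewrite lee_fin powR_ge0.
have intE : (\int[mu]_(x in D) `|(EFin \o (fun x : T => (`|h x| `^ r)%R)) x| =
    \int[mu]_(x in D) (`|h x| `^ r)%:E)%E.
  by apply: eq_integral => x _; rewrite /= ger0_norm ?powR_ge0.
have fE : finite_norm mu r%:E (h \_ D) <-> (\int[mu]_(x in D) (`|h x| `^ r)%:E < +oo)%E.
  rewrite /finite_norm Lnorm_restrict//; split; last exact: poweR_lty.
  move: int0; case: (\int[mu]_(x in D) _)%E => [y _ _|_|//]; first exact: ltry.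
  by rewrite poweRyr// invr_neq0// gt_eqF.
split.
  move=> /andP[]; rewrite !inE /= => /mE mh /fE fin; split => //.
  apply/integrableP; split; first exact/measurable_EFinP/measurable_norm_powR.
  by rewrite intE.
move=> [mh /integrableP[_]]; rewrite intE => fin.
by apply/andP; rewrite !inE /=; split; [exact/mE|exact/fE].
Qed.

End Lp_restriction.

Lemma bounded_set_box (R : realType) (N : nat) (Omega : set 'rV[R]_N) :
  bounded_set Omega ->
  exists2 M : R, 0 < M & forall x, Omega x -> forall i, `|x ord0 i| < M.
Proof.
move=> [M0 [_ h]]; exists (`|M0| + 2); first by rewrite ltr_wpDl.
move=> x Ox i; apply: (@le_lt_trans _ _ `|x|).
  rewrite [leRHS]/Num.norm/= mx_normrE.
  exact: (le_bigmax _ (fun ij : 'I_1 * 'I_N => `|x ij.1 ij.2|) (ord0, i)).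
apply: (@le_lt_trans _ _ (`|M0| + 1)); last by rewrite ltrD2l ltr1n.
by apply: (h (`|M0| + 1) _ x Ox); rewrite (le_lt_trans (ler_norm _))// ltrDl.
Qed.

Section regularity.
Variables (R : realType) (N : nat).
Hypothesis hN : (1 < N)%N.
Local Notation V := 'rV[R]_N.
Local Notation mu := (leb R N).
Local Notation T := (lebT R N).
Variables (Omega : set V) (M : R).
Hypothesis M0 : 0 < M.
Hypothesis oO : open Omega.
Hypothesis OM : forall x, Omega x -> forall i, `|x ord0 i| < M.
Variable phi : R -> R.
Hypothesis hphi : C1 phi.
Hypothesis hphi2 : cond_phi2 phi.
Local Notation B := (energy phi).

(** Solutions are admissible as test functions, which yields the integrability of
    B(|grad u|) and of g(x, u) u.  The right side itself is integrable as well, since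
    |g(x, u)| is at most 2 a where |u| <= 1 and at most |g(x, u) u| elsewhere. *)
Lemma weak_solution_Lp (g : V -> R -> R) (u a : V -> R) (al c0 C0 : R) :
  weak_solution phi Omega g u ->
  1 <= al -> al < N%:R -> 0 < c0 -> 0 <= C0 ->
  (forall t, c0 * `|t| `^ al <= B t + C0) ->
  in_Lp Omega (N%:R / al) a ->
  (forall x t, Omega x -> `|g x t| <= a x * (1 + `|t| `^ (al - 1))) ->
  forall q : R, 1 <= q -> in_Lp Omega q u.
Proof.
move=> [uW weak] al1 alN c00 C00 coer ha hga q q1.
have mO := Omega_measurable oO; have finO := Omega_fin OM.
have cmu : measure_is_complete mu := @measure_is_complete_caratheodory _ _ _.
have al0 : 0 < al by exact: lt_le_trans al1.
have N0 : 0 < N%:R :> R by exact: lt_trans alN.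
have p1 : 1 <= N%:R / al by rewrite ler_pdivlMr// mul1r ltW.
have p0 : 0 < N%:R / al by exact: lt_le_trans p1.
have [ma intap] := (Lfun_restrict mu mO a p0).1 ha.
have a0 x : Omega x -> 0 <= a x.
  move=> Ox; have := le_trans (normr_ge0 _) (hga x 0 Ox).
  by rewrite pmulr_lge0// ltr_wpDr// powR_ge0.
have mu_u : measurable_fun (Omega : set T) u by case: uW => [[[]]].
have mud i : measurable_fun (Omega : set T) (fun x : T => wpartial Omega i u x).
  by case: uW => [[_ h] _]; exact: (h i).2.1.
have [intB' intfu _] := weak u uW.
have intB : mu.-integrable Omega (EFin \o (fun x : T => B (wgrad_norm Omega u x))).
  rewrite (_ : (EFin \o _) = (EFin \o (fun x : T => phi (wgrad_norm Omega u x) *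
    \sum_(i < N) wpartial Omega i u x * wpartial Omega i u x))); first exact: intB'.
  apply/funext => x; congr EFin; apply/esym.
  exact: (energy_grad_norm phi (fun i (x : T) => wpartial Omega i u x) x).
pose f x := g x (u x); pose h x := `|f x * u x| + 2 * a x.
have inta1 := integrable_of_powR mO finO p1 ma intap.
have inth : mu.-integrable Omega (EFin \o (h : T -> R)).
  exact: (integrableD mO (integrable_abse intfu) (integrableZl mO 2 inta1)).
have fa x : Omega x -> `|f x| <= a x * (1 + `|u x| `^ (al - 1)) by exact: hga.
have fh x : Omega x -> `|f x| <= h x.
  move=> Ox; have ax := a0 x Ox.
  have [u1|/ltW u1] := leP `|u x| 1.
    apply: (le_trans (fa x Ox)); rewrite /h -[leLHS]add0r lerD// mulrC ler_wpM2r//.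
    rewrite -[2]/(1 + 1) lerD2l.
    have := ler_powR2r (_ : 0 <= al - 1) (normr_ge0 _) u1.
    by rewrite powR1 subr_ge0; apply.
  by rewrite /h -[leLHS]addr0 lerD ?mulr_ge0// normrM ler_peMr.
have weakt v : test_function Omega v -> _ := fun tv => weak v (test_W10 M0 oO OM hphi hphi2 tv).
have E0 x : Omega x -> 0 <= B (wgrad_norm Omega u x) by move=> _; exact: energy_ge0.
have idb := identity_bounded M0 oO OM hphi hphi2 uW intB weakt inth fh.
have idl := @identity_linear_growth _ T R mu Omega mO cmu u f
  (fun x => B (wgrad_norm Omega u x)) mu_u E0 intB intfu idb.
have sob := sobolev_limit M0 hN oO OM hphi hphi2 uW intB al1 alN c00 coer.
have q0 : 0 < q by exact: lt_le_trans q1.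
have coerw x : Omega x -> c0 * wgrad_norm Omega u x `^ al <= B (wgrad_norm Omega u x) + C0.
  by move=> _; have := coer (wgrad_norm Omega u x); rewrite (ger0_norm (sqrtr_ge0 _)).
apply/(Lfun_restrict mu mO u q0); split; first exact: mu_u.
exact: (@integrable_all_powers _ T R mu Omega mO cmu finO N al c0 C0 (sob_const N M al)
  al1 alN c00 C00 (powR_ge0 _ _) u (wgrad_norm Omega u) a f
  (fun x => B (wgrad_norm Omega u x)) (fun i x => wpartial Omega i u x)
  mu_u (grad_norm_measurable mud) (grad_norm_ge (fun i (x : T) => wpartial Omega i u x))
  E0 intB coerw ma a0 intap fa idl sob q (ltW q0)).
Qed.

End regularity.

Theorem theorem1p4 (R : realType) (N : nat) (hN : (2 <= N)%N)
    (Omega : set 'rV[R]_N) (hOmega : smooth_bounded_domain Omega)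
    (phi : R -> R) (hphi : C1 phi) (l m : R)
    (hphi1 : cond_phi1 phi) (hphi2 : cond_phi2 phi)
    (hphi3 : cond_phi3 N l m phi)
    (g : 'rV[R]_N -> R -> R) (hg : caratheodory_fun Omega g)
    (alpha : R) (halpha : alpha = l \/ alpha = m)
    (a : 'rV[R]_N -> R) (ha : in_Lp Omega (N%:R / alpha) a)
    (hga : forall x t, Omega x ->
       `|g x t| <= a x * (1 + `|t| `^ (alpha - 1)))
    (hcase :
       (~ Nfun_equiv (Phi_of phi) (fun t => `|t| `^ m) /\ alpha = l) \/
       (Nfun_equiv (Phi_of phi) (fun t => `|t| `^ m) /\ alpha = m))
    (u : 'rV[R]_N -> R) (hu : weak_solution phi Omega g u) :
  forall q : R, 1 <= q -> in_Lp Omega q u.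
Proof.
have [_ oO _ bO _] := hOmega.
have [M M0 OM] := bounded_set_box bO.
have [/andP[l1 lN] /andP[/ltW m1 mN] _ _] := hphi3.
have [al1 alN] : 1 <= alpha /\ alpha < N%:R by case: halpha => ->.
have [c0 [C0 [c00 C00 coer]]] : exists c0 C0 : R,
    [/\ 0 < c0, 0 <= C0 & forall t, c0 * `|t| `^ alpha <= energy phi t + C0].
  case: hcase => [[_ ->]|[heq ->]].
    exact: coercive_of_lower_index hphi3.
  exact: coercive_of_equiv heq.
exact: (weak_solution_Lp hN M0 oO OM hphi hphi2 hu al1 alN c00 C00 coer ha hga).
Qed.
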